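(* Let $\bar m=|\overline{\mathbb D}|\ge2$. For every $\varepsilon\in(0,1]$ let $(\eta_{\varepsilon,n},\kappa_{\varepsilon,n})_{n\ge 0}$ be a Markov renewal process on $\mathbb X\times[0,\infty)$, and let $v_{\varepsilon,i}\in[1,\infty)$, $i\in\overline{\mathbb D}$, be normalisation functions. Assume: (A) $F_{\varepsilon,i}(0)<1$ for all $i\in\mathbb X$, $\varepsilon\in(0,1]$. (B) For every $i\in\overline{\mathbb D}$, $j\in\mathbb X$, either $p_{\varepsilon,ij}>0$ for all $\varepsilon\in(0,1]$ or $p_{\varepsilon,ij}=0$ for all $\varepsilon\in(0,1]$; and for every $i\in\overline{\mathbb D}$ there is a chain $i=j_0,j_1,\dots,j_n$ with $j_1,\dots,j_{n-1}\in\overline{\mathbb D}$, $j_n\in\mathbb D$ and $\prod_{l=1}^n p_{1,j_{l-1}j_l}>0$. (C) $p_{\varepsilon,ij}\to p_{0,ij}$ as $\varepsilon\to0$, for $i\in\overline{\mathbb D}$, $j\in\mathbb X$. (D) For $i\in\overline{\mathbb D}$, $j\in\mathbb Y_{1,i}$: $F_{\varepsilon,ij}(\cdot\, v_{\varepsilon,i})\Rightarrow F_{0,ij}(\cdot)$ as $\varepsilon\to0$, where $F_{0,ij}$ is a proper distribution function with $F_{0,ij}(0)<1$; and $v_{\varepsilon,i}\to v_{0,i}\in[1,\infty]$. (E) For $i\in\overline{\mathbb D}$, $j\in\mathbb Y_{1,i}$: $e_{\varepsilon,ij}<\infty$ for all $\varepsilon\in(0,1]$ and $e_{\varepsilon,ij}/v_{\varepsilon,i}\to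 e_{0,ij}=\int_0^\infty t\,F_{0,ij}(dt)<\infty$ as $\varepsilon\to0$. Let $k_1,\dots,k_{\bar m}$ be an enumeration of $\overline{\mathbb D}$ and assume, with the level-$n$ quantities defined in the context, that as $\varepsilon\to0$: (i) $\tilde p^{(n)}_{\varepsilon,ij}\to\tilde p^{(n)}_{0,ij}\in[0,1]$ for $i\in\overline{\mathbb D}_n$, $j\in\mathbb X_n$, $n=0,\dots,\bar m-1$; (ii) $\hat q^{(n)}_{\varepsilon,ij}\to\hat q^{(n)}_{0,ij}\in[0,1]$ for $i\in\overline{\mathbb D}_n$, $j\in\mathbb Y^{(n)}_i$, $n=1,\dots,\bar m-1$; (iii) $\tilde v^{(n-1)}_{\varepsilon,j}/\tilde v^{(n-1)}_{\varepsilon,i}\to\tilde w^{(n-1)}_{0,ji}\in[0,\infty]$ for $i,j\in\overline{\mathbb D}_{n-1}$, $n=1,\dots,\bar m-1$; (iv) $\tilde w^{(n-1)}_{0,k_ni}<\infty$ for all $i\in\overline{\mathbb D}_{n-1}$, $n=1,\dots,\bar m-1$. Put $a=k_{\bar m-1}$, $b=k_{\bar m}$ and $$\check v_{\varepsilon,a}=\begin{cases}\tilde v^{(\bar m-1)}_{\varepsilon,b},&\tilde p^{(\bar m-2)}_{0,ab}>0,\\ \tilde v^{(\bar m-2)}_{\varepsilon,a},&\tilde p^{(\bar m-2)}_{0,ab}=0.\end{cases}$$ Then, for every $j\in\mathbb D$, $$G_{\varepsilon,\mathbb D,aj}(\cdot\;\check v_{\varepsilon,a})\Rightarrow G_{0,\mathbb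 D,aj}(\cdot)\quad\text{as }\varepsilon\to0,$$ where $G_{0,\mathbb D,aj}$ has the Laplace transform $$\Psi_{0,\mathbb D,aj}(s)=\begin{cases}\tilde\phi^{(\bar m-2)}_{0,aj}(cs)\,\tilde p^{(\bar m-2)}_{0,aj}+\Psi_{0,\mathbb D,bj}(s)\,\tilde\phi^{(\bar m-2)}_{0,ab}(cs)\,\tilde p^{(\bar m-2)}_{0,ab},&\tilde p^{(\bar m-2)}_{0,ab}>0,\\ \tilde\phi^{(\bar m-2)}_{0,aj}(s)\,\tilde p^{(\bar m-2)}_{0,aj},&\tilde p^{(\bar m-2)}_{0,ab}=0,\end{cases}\quad s\ge0,$$ with $c=(1-p^{(\bar m-1)}_{0,bb})\,\tilde w^{(\bar m-2)}_{0,ab}$ and $\Psi_{0,\mathbb D,bj}(s)=\tilde\phi^{(\bar m-1)}_{0,bj}(s)\,\tilde p^{(\bar m-1)}_{0,bj}$ (terms with a zero probability factor are $0$).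
   Context: $\mathbb X=\{1,\dots,M\}$; $\mathbb D$ is a nonempty proper subset of $\mathbb X$, $\overline{\mathbb D}=\mathbb X\setminus\mathbb D$, $\bar m=|\overline{\mathbb D}|$. For each $\varepsilon\in(0,1]$, a Markov renewal process $(\eta_{\varepsilon,n},\kappa_{\varepsilon,n})_{n\ge0}$ is a homogeneous Markov chain on $\mathbb X\times[0,\infty)$ whose transition probabilities $Q_{\varepsilon,ij}(t)=\mathsf P\{\eta_{\varepsilon,1}=j,\kappa_{\varepsilon,1}\le t\mid\eta_{\varepsilon,0}=i,\kappa_{\varepsilon,0}=s\}$ do not depend on $s$. Notation: $p_{\varepsilon,ij}=Q_{\varepsilon,ij}(\infty)$; $F_{\varepsilon,i}(t)=\sum_jQ_{\varepsilon,ij}(t)$; $F_{\varepsilon,ij}=Q_{\varepsilon,ij}/p_{\varepsilon,ij}$ if $p_{\varepsilon,ij}>0$; $e_{\varepsilon,ij}=\int_0^\infty tF_{\varepsilon,ij}(dt)$; $\mathbb Y_{1,i}=\{j\in\mathbb X:p_{1,ij}>0\}$; $\phi_{0,ij}(s)=\int_0^\infty e^{-st}F_{0,ij}(dt)$. Hitting times: $\nu_{\varepsilon,\mathbb D}=\min(n\ge1:\eta_{\varepsilon,n}\in\mathbb D)$, $\tau_{\varepsilon,\mathbb D}=\sum_{n=1}^{\nu_{\varepsilon,\mathbb D}}\kappa_{\varepsilon,n}$, $G_{\varepsilon,\mathbb D,ij}(t)=\mathsf P\{\tau_{\varepsilon,\mathbb D}\le t,\ \eta_{\varepsilon,\nu_{\varepsilon,\mathbb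 D}}=j\mid\eta_{\varepsilon,0}=i\}$. Weak convergence $\Rightarrow$ of possibly improper distribution functions means convergence at continuity points of the limit together with convergence of total masses (equivalently, pointwise convergence of Laplace transforms for all $s\ge0$). Level-$n$ quantities (for a given enumeration $k_1,\dots,k_{\bar m}$ of $\overline{\mathbb D}$). $\mathbb X_n=\mathbb X\setminus\{k_1,\dots,k_n\}$, $\overline{\mathbb D}_n=\overline{\mathbb D}\setminus\{k_1,\dots,k_n\}$, $0\le n\le\bar m-1$. For $\varepsilon\in(0,1]$, $i\in\overline{\mathbb D}_n$, $j\in\mathbb X_n$: $p^{(0)}_{\varepsilon,ij}=p_{\varepsilon,ij}$, $v^{(0)}_{\varepsilon,i}=v_{\varepsilon,i}$, $$\tilde p^{(n)}_{\varepsilon,ij}=\mathrm I(j\ne i)\frac{p^{(n)}_{\varepsilon,ij}}{1-p^{(n)}_{\varepsilon,ii}},\quad \tilde v^{(n)}_{\varepsilon,i}=\frac{v^{(n)}_{\varepsilon,i}}{1-p^{(n)}_{\varepsilon,ii}},\quad p^{(n)}_{\varepsilon,ij}=\tilde p^{(n-1)}_{\varepsilon,ij}+\tilde p^{(n-1)}_{\varepsilon,ik_n}\tilde p^{(n-1)}_{\varepsilon,k_nj},\quad v^{(n)}_{\varepsilon,i}=\tilde v^{(n-1)}_{\varepsilon,i}\quad(n\ge1).$$ (Condition (B) implies $p^{(n)}_{\varepsilon,ii}<1$ for $\varepsilon\in(0,1]$.) $\mathbb Y^{(n)}_i=\{j\in\mathbb X_n:p^{(n)}_{1,ij}>0\}$,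 $\tilde{\mathbb Y}^{(n)}_i=\mathbb Y^{(n)}_i\setminus\{i\}$; for $n\ge1$ and $j\in\mathbb Y^{(n)}_i$, $\hat q^{(n)}_{\varepsilon,ij}=\tilde p^{(n-1)}_{\varepsilon,ij}/p^{(n)}_{\varepsilon,ij}$. $p^{(n)}_{0,ij}=\lim_{\varepsilon\to0}p^{(n)}_{\varepsilon,ij}$, i.e. $p^{(0)}_{0,ij}=p_{0,ij}$ and $p^{(n)}_{0,ij}=\tilde p^{(n-1)}_{0,ij}+\tilde p^{(n-1)}_{0,ik_n}\tilde p^{(n-1)}_{0,k_nj}$. Limiting Laplace transforms and expectations: $\phi^{(0)}_{0,ij}=\phi_{0,ij}$, $e^{(0)}_{0,ij}=e_{0,ij}$. For $i\in\overline{\mathbb D}_n$, $j\in\tilde{\mathbb Y}^{(n)}_i$, writing $p=p^{(n)}_{0,ii}$, $$\tilde\phi^{(n)}_{0,ij}(s)=\begin{cases}\phi^{(n)}_{0,ij}(s),& i\notin\mathbb Y^{(n)}_i,\\ \frac{(1-p)\phi^{(n)}_{0,ij}((1-p)s)}{1-p\,\phi^{(n)}_{0,ii}((1-p)s)},& i\in\mathbb Y^{(n)}_i,\ p<1,\\ (1+e^{(n)}_{0,ii}s)^{-1},& p=1,\end{cases}\qquad\tilde e^{(n)}_{0,ij}=\begin{cases}e^{(n)}_{0,ij},& i\notin\mathbb Y^{(n)}_i,\\(1-p)e^{(n)}_{0,ij}+p\,e^{(n)}_{0,ii},& i\in\mathbb Y^{(n)}_i.\end{cases}$$ For $n\ge1$,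 $i\in\overline{\mathbb D}_n$, $j\in\mathbb Y^{(n)}_i$, writing $k=k_n$, $w=\tilde w^{(n-1)}_{0,k_ni}$, $q=\hat q^{(n)}_{0,ij}$, and $\tilde\phi,\tilde e,\tilde{\mathbb Y}$ for the level $n-1$ objects $\tilde\phi^{(n-1)}_0,\tilde e^{(n-1)}_0,\tilde{\mathbb Y}^{(n-1)}$: (a) if $j,k\in\tilde{\mathbb Y}_i$ and $j\in\tilde{\mathbb Y}_k$: $\phi^{(n)}_{0,ij}(s)=q\tilde\phi_{ij}(s)+(1-q)\tilde\phi_{ik}(s)\tilde\phi_{kj}(ws)$, $e^{(n)}_{0,ij}=q\tilde e_{ij}+(1-q)(\tilde e_{ik}+w\tilde e_{kj})$; (b) if $j\in\tilde{\mathbb Y}_i$ and ($k\notin\tilde{\mathbb Y}_i$ or $j\notin\tilde{\mathbb Y}_k$): $\phi^{(n)}_{0,ij}=\tilde\phi_{ij}$, $e^{(n)}_{0,ij}=\tilde e_{ij}$; (c) if $j\notin\tilde{\mathbb Y}_i$ (in particular $j=i$): $\phi^{(n)}_{0,ij}(s)=\tilde\phi_{ik}(s)\tilde\phi_{kj}(ws)$, $e^{(n)}_{0,ij}=\tilde e_{ik}+w\tilde e_{kj}$. *)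

(* Defs.v *)
From HB Require Import structures.
From mathcomp Require Import all_boot all_order all_algebra.
From mathcomp Require Import all_classical all_reals all_analysis.

Set Implicit Arguments.
Unset Strict Implicit.
Unset Printing Implicit Defensive.

Import Order.TTheory GRing.Theory Num.Theory.
Import numFieldNormedType.Exports.

Local Open Scope classical_set_scope.
Local Open Scope ring_scope.

(* A (possibly improper) distribution function is carried by a finite measure
   mu on the line; mu is concentrated on [0, +oo[ in all uses below. *)
Section distribution_functions.
Context {R : realType}.

Definition dfun (mu : set R -> \bar R) (t : R) : R :=
  fine (mu `]-oo, t]%classic).

Definition mean (mu : set R -> \bar R) : \bar R :=
  (\int[mu]_(t in `[0%R, +oo[%classic) t%:E)%E.

Definition laplace (mu : set R -> \bar R) (s : R) : R :=
  fine (\int[mu]_(t in `[0%R, +oo[%classic) (expR (- (s * t)))%:E)%E.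

(* Weak convergence, as eps decreases to 0, of distribution functions that may
   be improper: the second clause is the convergence of the total masses. *)
Definition weak_cvg (G : R -> R -> R) (G0 : R -> R) : Prop :=
  (forall t, {for t, continuous G0} -> G eps t @[eps --> 0^'+] --> G0 t) /\
  lim (G eps t @[t --> +oo]) @[eps --> 0^'+] --> lim (G0 t @[t --> +oo]).

End distribution_functions.

(* P{ . | eta_0 = i} is the member mr_prob i of the Markov family.  By
   mr_markov the conditional law of (eta_(n+1), kappa_(n+1)) given the past is
   the one of (eta_1, kappa_1) under mr_prob (eta_n): the chain (eta, kappa) is
   homogeneous and its transition probabilities do not depend on kappa_n. *)
Record markov_renewal (R : realType) (X : finType) := MarkovRenewal {
  mr_display : measure_display ;
  mr_space : measurableType mr_display ;
  mr_prob : X -> probability mr_space R ;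
  eta : nat -> mr_space -> X ;
  kappa : nat -> {mfun mr_space >-> R} ;
  measurable_eta : forall n i, measurable (eta n @^-1` [set i]) ;
  kappa_ge0 : forall n w, 0 <= kappa n w ;
  mr_init : forall i, mr_prob i (eta 0 @^-1` [set i]) = 1%E ;
  mr_markov : forall (i : X) (n : nat) (x : nat -> X)
      (B : nat -> set R) (j : X) (t : R),
    (forall m, measurable (B m)) ->
    let H := \bigcap_(m in [set m | (m <= n)%N])
               (eta m @^-1` [set x m] `&` kappa m @^-1` B m) in
    (mr_prob i (H `&` (eta n.+1 @^-1` [set j] `&` kappa n.+1 @^-1` `]-oo, t]%classic))
     = mr_prob i H *
       mr_prob (x n) (eta 1 @^-1` [set j] `&` kappa 1 @^-1` `]-oo, t]%classic))%E
}.

Section markov_renewal_defs.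
Context {R : realType} {X : finType} (Z : markov_renewal R X).

(* Q_ij(t) = dfun (mr_Q i j) t *)
Definition mr_Q (i j : X) : set R -> \bar R :=
  pushforward (mrestr (mr_prob Z i) (measurable_eta Z 1 j)) (kappa Z 1).

Section mr_Q_measure.
Variables i j : X.

Let mr_Q0 : mr_Q i j set0 = 0%E.
Proof. exact: measure0. Qed.

Let mr_Q_ge0 B : (0 <= mr_Q i j B)%E.
Proof. exact: measure_ge0. Qed.

Let mr_Q_sigma_additive : semi_sigma_additive (mr_Q i j).
Proof. exact: measure_semi_sigma_additive. Qed.

HB.instance Definition _ := isMeasure.Build _ _ _ (mr_Q i j)
  mr_Q0 mr_Q_ge0 mr_Q_sigma_additive.

End mr_Q_measure.

Definition mr_p (i j : X) : R := fine (mr_Q i j setT).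

(* F_i(t) *)
Definition mr_Fi (i : X) (t : R) : R := \sum_j dfun (mr_Q i j) t.

(* F_ij = Q_ij / p_ij; the junk value when p_ij = 0 is the Dirac mass at 0. *)
Definition mr_F (i j : X) : probability R R :=
  mnormalize (mr_Q i j) (dirac (0 : R)).

Variable D : {set X}.

(* nu_D = min (n >= 1 : eta_n \in D), None if D is never hit *)
Definition hit_nu (w : mr_space Z) : option nat :=
  if pselect (exists n, (1 <= n)%N && (eta n w \in D)) is left h
  then Some (ex_minn h) else None.

Definition hit_tau (w : mr_space Z) : \bar R :=
  if hit_nu w is Some n then (\sum_(1 <= l < n.+1) kappa Z l w)%:E else +oo%E.

Definition hit_G (i j : X) (t : R) : R :=
  fine (mr_prob Z i [set w | (hit_tau w <= t%:E)%E /\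
                             exists2 n, hit_nu w = Some n & eta n w = j]).

End markov_renewal_defs.

(* Successive exclusion of the states k 1, k 2, ... (indices start at 1).  The
   level-n functions below are total; they are meaningful for i \in Dbar_lev n
   and j \in X_lev n. *)
Section reduction.
Context {R : realType} {X : finType} (k : nat -> X).

Definition X_lev (n : nat) : {set X} :=
  [set x | x \notin [seq k l | l <- iota 1 n]]%SET.

Definition Dbar_lev (D : {set X}) (n : nat) : {set X} := ~: D :&: X_lev n.

Definition loop_free (p : X -> X -> R) (i j : X) : R :=
  if j != i then p i j / (1 - p i i) else 0.

Fixpoint p_lev (p : X -> X -> R) (n : nat) (i j : X) : R :=
  if n is n'.+1 then
    let pt := loop_free (p_lev p n') in pt i j + pt i (k n) * pt (k n) j
  else p i j.

Definition pt_lev (p : X -> X -> R) (n : nat) : X -> X -> R :=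
  loop_free (p_lev p n).

Fixpoint v_lev (p : X -> X -> R) (v : X -> R) (n : nat) (i : X) : R :=
  if n is n'.+1 then v_lev p v n' i / (1 - p_lev p n' i i) else v i.

Definition vt_lev (p : X -> X -> R) (v : X -> R) (n : nat) (i : X) : R :=
  v_lev p v n i / (1 - p_lev p n i i).

Definition qh_lev (p : X -> X -> R) (n : nat) (i j : X) : R :=
  pt_lev p n.-1 i j / p_lev p n i j.

(* Y^(n)_i, to be used with p = p_1 *)
Definition Y_lev (p : X -> X -> R) (n : nat) (i : X) : {set X} :=
  [set j in X_lev n | 0 < p_lev p n i j]%SET.

Definition Yt_lev (p : X -> X -> R) (n : nat) (i : X) : {set X} :=
  Y_lev p n i :\ i.

(* The limits as eps -> 0.  pt0, qh0 and w0 are not functions of p0, since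
   p0_lev n i i may be 1; they are given separately:
     pt0 n i j = lim pt^(n)_ij,  qh0 n i j = lim qh^(n)_ij,
     w0 n j i = lim vt^(n)_j / vt^(n)_i. *)
Variables (p1 p0 : X -> X -> R) (pt0 qh0 : nat -> X -> X -> R)
  (w0 : nat -> X -> X -> \bar R)
  (F0 : X -> X -> probability R R).

Definition p0_lev (n : nat) (i j : X) : R :=
  if n is n'.+1 then pt0 n' i j + pt0 n' i (k n) * pt0 n' (k n) j else p0 i j.

Definition et_step (n : nat) (e : X -> X -> R) (i j : X) : R :=
  let p := p0_lev n i i in
  if i \notin Y_lev p1 n i then e i j else (1 - p) * e i j + p * e i i.

(* from level n to level n.+1 *)
Definition e_step (n : nat) (et : X -> X -> R) (i j : X) : R :=
  let kk := k n.+1 in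
  let w := fine (w0 n kk i) in
  let q := qh0 n.+1 i j in
  if j \in Yt_lev p1 n i then
    if (kk \in Yt_lev p1 n i) && (j \in Yt_lev p1 n kk) then
      q * et i j + (1 - q) * (et i kk + w * et kk j)
    else et i j
  else et i kk + w * et kk j.

Fixpoint e0_lev (n : nat) : X -> X -> R :=
  if n is n'.+1 then e_step n' (et_step n' (e0_lev n'))
  else fun i j => fine (mean (F0 i j)).

Definition phit_step (n : nat) (phi : X -> X -> R -> R) (i j : X) (s : R) : R :=
  let p := p0_lev n i i in
  if i \notin Y_lev p1 n i then phi i j s
  else if p < 1 then
    (1 - p) * phi i j ((1 - p) * s) / (1 - p * phi i i ((1 - p) * s))
  else (1 + e0_lev n i i * s)^-1.

Definition phi_step (n : nat) (phit : X -> X -> R -> R) (i j : X) (s : R) : R :=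
  let kk := k n.+1 in
  let w := fine (w0 n kk i) in
  let q := qh0 n.+1 i j in
  if j \in Yt_lev p1 n i then
    if (kk \in Yt_lev p1 n i) && (j \in Yt_lev p1 n kk) then
      q * phit i j s + (1 - q) * (phit i kk s * phit kk j (w * s))
    else phit i j s
  else phit i kk s * phit kk j (w * s).

Fixpoint phi0_lev (n : nat) : X -> X -> R -> R :=
  if n is n'.+1 then phi_step n' (phit_step n' (phi0_lev n'))
  else fun i j => laplace (F0 i j).

Definition phit0_lev (n : nat) : X -> X -> R -> R :=
  phit_step n (phi0_lev n).

End reduction.

(* Main.v *)
Require Import Defs.
From HB Require Import structures.
From mathcomp Require Import all_boot all_order all_algebra.
From mathcomp Require Import all_classical all_reals all_analysis.
From mathcomp Require Import measurable_realfun.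
From mathcomp Require Import ring lra.

Set Implicit Arguments.
Unset Strict Implicit.
Unset Printing Implicit Defensive.

Import Order.TTheory GRing.Theory Num.Theory.
Import numFieldNormedType.Exports.

Local Open Scope classical_set_scope.
Local Open Scope ring_scope.

(* Laplace transforms turn the hitting times of D into the solution of a linear
   system h_i = q_ij + sum_(y notin D) q_iy h_y, where q_iy = p_iy phi_iy.
   Excluding the states k_1, k_2, ... one after the other is Gaussian
   elimination in this system, so that the reduced processes are needed only
   through their transition probabilities and transforms.  The limit is taken
   along the elimination: what survives every step (mixture, product, rescaling,
   geometric compounding) is the convergence of the transforms together with
   that of their means.  The two combine because x |-> (1 - phi x) / x is
   nonincreasing with limit the mean at 0; this monotonicity gives the
   exponential limit when p_ii -> 1.  Weak convergence is recovered at the end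
   from a continuity theorem, in which indicators are approximated by the
   exponential polynomials (1 - exp (- n x)) ^ N. *)

(** * Transforms and their limits *)

(** States live on different time scales, so the recursion evaluates transforms at arguments that
    move with [eps]: ratios of normalisations and factors [1 - p]. Pointwise convergence alone does
    not survive this. A transform is Lipschitz with its mean as constant, so convergent means make
    the family equicontinuous and the moving arguments harmless; the means thus serve every step,
    not only the exponential limit. The closure properties are proved for an axiomatic class of
    functions, so no law of a reduced process is ever constructed. For fixed [eps] all transforms
    stay in the original time, which lets one parameter [s] run through the whole linear system; the
    scale of each state enters only when the limit is taken. Condition (B) makes the zero pattern of
    every level independent of [eps], so the case distinctions of the recursion are the same for all
    [eps]. When the limiting probability of going from [a] to [b] vanishes, nothing is known about
    the hitting transform of [b] on the scale of [a]; the bound by 1 suffices there. *)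

Section transforms.
Context {R : realType}.
Implicit Types (f g : R -> R) (e c p : R).

(** These properties stand in for being the Laplace transform of a law on the half-line with mean
    [e]; each can be checked directly under the operations of the recursion. [tr_star] is the
    division-free form of the monotonicity of [(1 - f u) / u]. *)
Record transform f e : Prop := Transform {
  tr0 : f 0 = 1;
  tr_ge0 : forall u, 0 <= u -> 0 <= f u;
  tr_noninc : forall u u', 0 <= u -> u <= u' -> f u' <= f u;
  tr_star : forall u u', 0 <= u -> u <= u' -> u * (1 - f u') <= u' * (1 - f u);
  tr_slope : (1 - f u) / u @[u --> 0^'+] --> e }.

Lemma tr_le1 f e u : transform f e -> 0 <= u -> f u <= 1.
Proof. by move=> tf u0; rewrite -(tr0 tf); exact: (tr_noninc tf). Qed.

(** The nonincreasing quotient [(1 - f u) / u] lies below its limit at 0. *)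
Lemma tr_bound f e u : transform f e -> 0 <= u -> 1 - f u <= e * u.
Proof.
move=> tf; rewrite le_eqVlt => /predU1P[<-|u0].
  by rewrite (tr0 tf) subrr mulr0.
rewrite -ler_pdivrMr//; apply: (cvgr_to_ge (tr_slope tf)).
near=> x.
have x0 : 0 < x by near: x; exact: nbhs_right_gt.
have xu : x <= u by near: x; apply: nbhs_right_le.
rewrite ler_pdivrMr// mulrAC ler_pdivlMr// mulrC [leRHS]mulrC.
exact: (tr_star tf (ltW x0) xu).
Unshelve. all: by end_near. Qed.

Lemma tr_mean_ge0 f e : transform f e -> 0 <= e.
Proof.
move=> tf; have := tr_bound tf ler01; rewrite mulr1; apply: le_trans.
by rewrite subr_ge0 (tr_le1 tf).
Qed.

(** [tr_star] gives [u (f u - f u') <= (u' - u) (1 - f u)], and [1 - f u <= e u] lets the factor [u]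
    cancel. *)
Lemma tr_lipschitz f e u u' : transform f e -> 0 <= u -> 0 <= u' ->
  `|f u - f u'| <= e * `|u - u'|.
Proof.
move=> tf; wlog uu' : u u' / u <= u' => [H|] u0 u'0.
  by have [/H|/ltW/H] := leP u u'; [exact|rewrite distrC [X in e * X]distrC; exact].
rewrite ger0_norm; last by rewrite subr_ge0 (tr_noninc tf).
rewrite distrC ger0_norm ?subr_ge0//.
move: u0; rewrite le_eqVlt => /predU1P[<-|u0].
  by rewrite (tr0 tf) subr0; exact: tr_bound.
have h1 := tr_star tf (ltW u0) uu'.
have h2 := tr_bound tf (ltW u0).
rewrite -(ler_pM2l u0).
apply: (@le_trans _ _ ((u' - u) * (1 - f u))); first by lra.
rewrite [leRHS](_ : _ = (u' - u) * (e * u)); last by ring.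
by rewrite ler_wpM2l// subr_ge0.
Qed.

Lemma tr_cvg0 f e : transform f e -> f u @[u --> 0^'+] --> (1 : R).
Proof.
move=> tf; apply/cvgrPdist_le => d d0; near=> u.
have u0 : 0 <= u by apply: ltW; near: u; exact: nbhs_right_gt.
rewrite -(tr0 tf); apply: le_trans (tr_lipschitz tf _ u0) _ => //.
rewrite sub0r normrN ger0_norm//.
apply: (@le_trans _ _ ((e + 1) * u)); first by rewrite ler_wpM2r// lerDl.
have e1 : 0 < e + 1 by rewrite ltr_pwDr// (tr_mean_ge0 tf).
rewrite mulrC -ler_pdivlMr//; near: u; apply: nbhs_right_le.
by rewrite divr_gt0// ltr_pwDr// (tr_mean_ge0 tf).
Unshelve. all: by end_near. Qed.

(** The Dirac mass at 0: a sojourn seen on an infinitely larger time scale. *)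
Lemma tr_cst : transform (fun=> 1) 0.
Proof.
split => //; first by move=> *; rewrite subrr !mulr0.
by under eq_fun do rewrite subrr mul0r; exact: cvg_cst.
Qed.

Lemma tr_scale f e c : transform f e -> 0 <= c ->
  transform (fun u => f (c * u)) (c * e).
Proof.
(* A ratio of scales may tend to 0; the change of variable in the slope needs [c > 0], so [c = 0] is
   treated as the constant transform. *)
move=> tf; rewrite le_eqVlt => /predU1P[<-|c0].
  by rewrite mul0r; under eq_fun do rewrite mul0r (tr0 tf); exact: tr_cst.
split.
- by rewrite mulr0 (tr0 tf).
- by move=> u u0; apply: (tr_ge0 tf); rewrite mulr_ge0// ltW.
- move=> u u' u0 uu'; apply: (tr_noninc tf); first by rewrite mulr_ge0// ltW.
  by rewrite ler_pM2l.
- move=> u u' u0 uu'; rewrite -(ler_pM2l c0) !mulrA; apply: (tr_star tf).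
    by rewrite mulr_ge0// ltW.
  by rewrite ler_pM2l.
- have : (1 - f (c * u)) / (c * u) @[u --> 0^'+] --> e.
    apply: (cvg_comp (fun u => c * u) (fun u => (1 - f u) / u)) (tr_slope tf).
    move=> A [d /= d0 dA]; exists (d / c) => /=; first by rewrite divr_gt0.
    move=> x /=; rewrite sub0r normrN => xd x0; apply: dA => /=; last by rewrite mulr_gt0.
    by rewrite sub0r normrN normrM (gtr0_norm c0) mulrC -ltr_pdivlMr.
  move=> /(@cvgMl_tmp _ _ _ _ _ c); apply: cvg_trans; apply: near_eq_cvg.
  near=> u; have u0 : 0 < u by near: u; exact: nbhs_right_gt.
  by rewrite /=; field; rewrite !gt_eqF.
Unshelve. all: by end_near. Qed.

Lemma tr_mul f g e e' : transform f e -> transform g e' ->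
  transform (fun u => f u * g u) (e + e').
Proof.
move=> tf tg; split.
- by rewrite (tr0 tf) (tr0 tg) mulr1.
- by move=> u u0; rewrite mulr_ge0// ?(tr_ge0 tf)// (tr_ge0 tg).
- move=> u u' u0 uu'; have u'0 := le_trans u0 uu'.
  by rewrite ler_pM ?(tr_ge0 tf)// ?(tr_ge0 tg)// ?(tr_noninc tf)// (tr_noninc tg).
- move=> u u' u0 uu'; have u'0 := le_trans u0 uu'.
  have h1 := tr_star tf u0 uu'; have h2 := tr_star tg u0 uu'.
  (* After this splitting the first summand is [tr_star] for [f]; in the second, [tr_star] for [g]
     carries the weight [f u'], which monotonicity raises to [f u]. *)
  have E x : 1 - f x * g x = (1 - f x) + f x * (1 - g x) by ring.
  rewrite !E !(mulrDr _ (1 - f _)) lerD//.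
  apply: (@le_trans _ _ (f u' * (u' * (1 - g u)))).
    by rewrite mulrCA ler_wpM2l// (tr_ge0 tf).
  rewrite [leRHS]mulrCA ler_wpM2r ?(tr_noninc tf)//.
  by rewrite mulr_ge0// subr_ge0 (tr_le1 tg).
- have -> : (fun u => (1 - f u * g u) / u) =
    (fun u => (1 - f u) / u + f u * ((1 - g u) / u)) by apply/funext => u; ring.
  rewrite -[e' in X in _ --> X]mul1r; apply: cvgD (tr_slope tf) _.
  exact: cvgM (tr_cvg0 tf) (tr_slope tg).
Qed.

Lemma tr_mix f g e e' p : 0 <= p <= 1 -> transform f e -> transform g e' ->
  transform (fun u => p * f u + (1 - p) * g u) (p * e + (1 - p) * e').
Proof.
move=> /andP[p0 p1] tf tg; have p'0 : 0 <= 1 - p by rewrite subr_ge0.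
split.
- by rewrite (tr0 tf) (tr0 tg); ring.
- by move=> u u0; rewrite addr_ge0// mulr_ge0// ?(tr_ge0 tf)// (tr_ge0 tg).
- by move=> u u' u0 uu'; rewrite lerD// ler_wpM2l// ?(tr_noninc tf)// (tr_noninc tg).
- move=> u u' u0 uu'.
  have h1 := ler_wpM2l p0 (tr_star tf u0 uu').
  have h2 := ler_wpM2l p'0 (tr_star tg u0 uu').
  have := lerD h1 h2; lra.
- have -> : (fun u => (1 - (p * f u + (1 - p) * g u)) / u) =
    (fun u => p * ((1 - f u) / u) + (1 - p) * ((1 - g u) / u)).
    by apply/funext => u; ring.
  by apply: cvgD; apply: cvgMl_tmp; [exact: tr_slope tf|exact: tr_slope tg].
Qed.

(** A geometric number of loops with transform [g], then an exit with transform [f]; [p / (1 - p)]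
    is the mean number of loops. *)
Lemma tr_geom f g e e' p : 0 <= p < 1 -> transform f e -> transform g e' ->
  transform (fun u => (1 - p) * f u / (1 - p * g u)) (e + p / (1 - p) * e').
Proof.
move=> /andP[p0 p1] tf tg; have p'0 : 0 < 1 - p by rewrite subr_gt0.
have den u : 0 <= u -> 0 < 1 - p * g u.
  move=> u0; rewrite subr_gt0 (le_lt_trans _ p1)//.
  by rewrite ler_piMr// (tr_le1 tg).
have denV u u' : 0 <= u -> u <= u' -> (1 - p * g u')^-1 <= (1 - p * g u)^-1.
  move=> u0 uu'; rewrite lef_pV2 ?posrE ?den ?(le_trans u0 uu')//.
  by rewrite lerD2l lerN2 ler_wpM2l// (tr_noninc tg).
split.
- by rewrite (tr0 tf) (tr0 tg) !mulr1 divff// gt_eqF.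
- move=> u u0; rewrite mulr_ge0 ?invr_ge0 ?(ltW (den _ _))//.
  by rewrite mulr_ge0 ?(ltW p'0)// (tr_ge0 tf).
- move=> u u' u0 uu'; have u'0 := le_trans u0 uu'.
  rewrite ler_pM ?denV ?invr_ge0 ?(ltW (den _ _))//.
    by rewrite mulr_ge0 ?(ltW p'0)// (tr_ge0 tf).
  by rewrite ler_pM2l// (tr_noninc tf).
- move=> u u' u0 uu'; have u'0 := le_trans u0 uu'.
  have E x : 0 <= x -> 1 - (1 - p) * f x / (1 - p * g x) =
      (p * (1 - g x) + (1 - p) * (1 - f x)) / (1 - p * g x).
    by move=> x0; field; rewrite gt_eqF// den.
  rewrite !E// !mulrA ler_pM ?denV ?invr_ge0 ?(ltW (den _ _))//.
    rewrite mulr_ge0// addr_ge0// mulr_ge0 ?(ltW p'0)// subr_ge0.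
      by rewrite (tr_le1 tg).
    by rewrite (tr_le1 tf).
  have h1 := ler_wpM2l p0 (tr_star tg u0 uu').
  have h2 := ler_wpM2l (ltW p'0) (tr_star tf u0 uu').
  have := lerD h1 h2; lra.
- have : (p * ((1 - g u) / u) + (1 - p) * ((1 - f u) / u)) / (1 - p * g u)
      @[u --> 0^'+] --> (p * e' + (1 - p) * e) / (1 - p * 1).
    apply: cvgM.
      by apply: cvgD; apply: cvgMl_tmp; [exact: tr_slope tg|exact: tr_slope tf].
    apply: cvgV; first by rewrite mulr1 gt_eqF.
    by apply: cvgB; [exact: cvg_cst|apply: cvgMl_tmp; exact: tr_cvg0 tg].
  rewrite (_ : (p * e' + (1 - p) * e) / (1 - p * 1) = e + p / (1 - p) * e'); last first.
    by field; rewrite gt_eqF.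
  apply: cvg_trans; apply: near_eq_cvg; near=> u.
  have u0 : 0 < u by near: u; exact: nbhs_right_gt.
  by rewrite /=; field; rewrite !gt_eqF// den// ltW.
Unshelve. all: by end_near. Qed.

(** The exponential law of mean [e], which is the limit of geometric compounding when the loop
    probability tends to 1. *)
Lemma tr_exp e : 0 <= e -> transform (fun u => (1 + e * u)^-1) e.
Proof.
move=> e0.
have den u : 0 <= u -> 0 < 1 + e * u by move=> u0; rewrite ltr_pwDl// mulr_ge0.
have denV u u' : 0 <= u -> u <= u' -> (1 + e * u')^-1 <= (1 + e * u)^-1.
  move=> u0 uu'; rewrite lef_pV2 ?posrE ?den ?(le_trans u0 uu')//.
  by rewrite lerD2l ler_wpM2l.
split => //.
- by rewrite mulr0 addr0 invr1.
- by move=> u u0; rewrite invr_ge0 ltW// den.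
- move=> u u' u0 uu'; have u'0 := le_trans u0 uu'.
  have E x : 0 <= x -> 1 - (1 + e * x)^-1 = e * x / (1 + e * x).
    by move=> x0; field; rewrite gt_eqF// den.
  rewrite !E// !mulrA (mulrC u) (mulrC u') -(mulrA e u) (mulrC u u') mulrA.
  by rewrite ler_wpM2l ?denV// !mulr_ge0.
- have : e * (1 + e * u)^-1 @[u --> 0^'+] --> e * (1 + e * 0)^-1.
    apply: cvgMl_tmp; apply: cvgV; first by rewrite mulr0 addr0 oner_eq0.
    apply: cvgD; first exact: cvg_cst.
    apply: cvgMl_tmp; apply: cvg_at_right_filter; exact: cvg_id.
  rewrite mulr0 addr0 invr1 mulr1.
  apply: cvg_trans; apply: near_eq_cvg; near=> u.
  have u0 : 0 < u by near: u; exact: nbhs_right_gt.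
  by rewrite /=; field; rewrite !gt_eqF// den// ltW.
Unshelve. all: by end_near. Qed.

End transforms.

(** * Joint convergence of transforms and of their means *)

Section transform_convergence.
Context {R : realType}.

(** [trc_mean] is a separate requirement, since pointwise convergence of transforms does not control
    the means. *)
Record tr_cvg (f : R -> R -> R) (e : R -> R) (f0 : R -> R) (e0 : R) : Prop := TrCvg {
  trc_tr : forall eps, 0 < eps <= 1 -> transform (f eps) (e eps);
  trc_lim : transform f0 e0;
  trc_fun : forall s, 0 <= s -> f eps s @[eps --> 0^'+] --> f0 s;
  trc_mean : e eps @[eps --> 0^'+] --> e0 }.

Lemma near_unit : \forall eps \near (0:R)^'+, 0 < eps <= 1.
Proof.
near=> eps; apply/andP; split; near: eps; first exact: nbhs_right_gt.
exact: nbhs_right_le.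
Unshelve. all: by end_near. Qed.

(** Replacing [u eps] by its limit costs at most [e eps * |u eps - u0|], which vanishes because
    [e eps] converges. *)
Lemma trc_cont f e (f0 : R -> R) e0 (u : R -> R) (u0 : R) : tr_cvg f e f0 e0 ->
  (forall eps, 0 < eps <= 1 -> 0 <= u eps) -> u eps @[eps --> 0^'+] --> u0 ->
  f eps (u eps) @[eps --> 0^'+] --> f0 u0.
Proof.
move=> tf u_ge0 uu0.
have u00 : 0 <= u0.
  apply: (cvgr_to_ge uu0); near=> eps; apply: u_ge0; near: eps; exact: near_unit.
have small : e eps * `|u eps - u0| @[eps --> 0^'+] --> 0.
  rewrite -[X in _ --> X](mulr0 e0); apply: cvgM; first exact: trc_mean tf.
  suff : `|u eps - u0| @[eps --> 0^'+] --> `|u0 - u0| by rewrite subrr normr0.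
  by apply: cvg_norm; apply: cvgB; [exact: uu0|exact: cvg_cst].
apply: (@squeeze_cvgr _ _ _ _ (fun eps => f eps u0 - e eps * `|u eps - u0|)
  (fun eps => f eps u0 + e eps * `|u eps - u0|)).
- near=> eps.
  have he : 0 < eps <= 1 by near: eps; exact: near_unit.
  have := tr_lipschitz (trc_tr tf he) (u_ge0 _ he) u00.
  by rewrite ler_distl.
- by rewrite -[X in _ --> X]subr0; apply: cvgB small; exact: (trc_fun tf u00).
- by rewrite -[X in _ --> X]addr0; apply: cvgD small; exact: (trc_fun tf u00).
Unshelve. all: by end_near. Qed.

(* [(1 - f x) / x] is nonincreasing, at most the mean, and close to the mean of
   the limit at some fixed [x0]. *)
Lemma trc_slope f e (f0 : R -> R) e0 (d : R -> R) (s : R) : tr_cvg f e f0 e0 -> 0 <= s ->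
  (forall eps, 0 < eps <= 1 -> 0 < d eps) -> d eps @[eps --> 0^'+] --> 0 ->
  (1 - f eps (d eps * s)) / d eps @[eps --> 0^'+] --> e0 * s.
Proof.
move=> tf s0 d_gt0 d0; move: s0; rewrite le_eqVlt => /predU1P[<-|s0].
  rewrite mulr0; apply: (@cvg_trans _ ((0 : R) @[eps --> (0:R)^'+])); last exact: cvg_cst.
  apply: near_eq_cvg; near=> eps; rewrite mulr0 (tr0 (trc_tr tf _)) ?subrr ?mul0r//.
  by near: eps; exact: near_unit.
suff : (1 - f eps (d eps * s)) / (d eps * s) @[eps --> 0^'+] --> e0.
  move=> /(@cvgMr_tmp _ _ _ _ _ _ s); apply: cvg_trans; apply: near_eq_cvg.
  near=> eps; rewrite /= invfM; field; rewrite (gt_eqF s0) gt_eqF// d_gt0//.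
  by near: eps; exact: near_unit.
apply/cvgrPdist_le => h h0.
have h2 : 0 < h / 2 by rewrite divr_gt0.
have /cvgrPdist_le/(_ _ h2) Hs := tr_slope (trc_lim tf).
have [x0 [x00 Hx0]] : exists x, 0 < x /\ `|e0 - (1 - f0 x) / x| <= h / 2.
  apply: (@filter_ex _ (0:R)^'+); near=> x; split.
    by near: x; exact: nbhs_right_gt.
  by near: x; exact: Hs.
have Hf : (1 - f eps x0) / x0 @[eps --> 0^'+] --> (1 - f0 x0) / x0.
  apply: cvgMr_tmp; apply: cvgB; first exact: cvg_cst.
  exact: (trc_fun tf (ltW x00)).
have /cvgrPdist_le/(_ _ h2) Hf' := Hf.
have /cvgrPdist_le/(_ _ h0) He := trc_mean tf.
have dx0 : \forall eps \near 0^'+, d eps * s <= x0.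
  have : d eps * s @[eps --> 0^'+] --> 0 * s by exact: cvgMr_tmp.
  by rewrite mul0r => /cvgr_le; apply.
near=> eps.
have he : 0 < eps <= 1 by near: eps; exact: near_unit.
have te := trc_tr tf he.
have ds0 : 0 < d eps * s by rewrite mulr_gt0// d_gt0.
have dsx : d eps * s <= x0 by near: eps; exact: dx0.
have up : (1 - f eps (d eps * s)) / (d eps * s) <= e eps.
  by rewrite ler_pdivrMr//; apply: tr_bound te _; exact: ltW.
have lo : (1 - f eps x0) / x0 <= (1 - f eps (d eps * s)) / (d eps * s).
  rewrite ler_pdivrMr// mulrAC ler_pdivlMr// mulrC [leRHS]mulrC.
  exact: (tr_star te (ltW ds0) dsx).
have : `|(1 - f0 x0) / x0 - (1 - f eps x0) / x0| <= h / 2 by near: eps; exact: Hf'.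
have : `|e0 - e eps| <= h by near: eps; exact: He.
move: Hx0; rewrite !ler_distl => /andP[_ +] /andP[+ _] /andP[_ +].
by lra.
Unshelve. all: by end_near. Qed.

Lemma trc_eq f f' e e' (f0 f0' : R -> R) e0 e0' :
  (forall eps s, 0 < eps <= 1 -> 0 <= s -> f eps s = f' eps s) ->
  (forall eps, 0 < eps <= 1 -> e eps = e' eps) -> f0 =1 f0' -> e0 = e0' ->
  tr_cvg f e f0 e0 -> tr_cvg f' e' f0' e0'.
Proof.
move=> ff' ee' /funext<- <- tf; split; last 3 first.
- exact: trc_lim tf.
- move=> s s0; apply: cvg_trans (trc_fun tf s0); apply: near_eq_cvg.
  by near=> eps; rewrite ff'//; near: eps; exact: near_unit.
- apply: cvg_trans (trc_mean tf); apply: near_eq_cvg.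
  by near=> eps; rewrite ee'//; near: eps; exact: near_unit.
move=> eps he; have te := trc_tr tf he; rewrite -ee'//; split.
- by rewrite -ff'// (tr0 te).
- by move=> u u0; rewrite -ff'// (tr_ge0 te).
- move=> u u' u0 uu'; have u'0 := le_trans u0 uu'.
  by rewrite -!ff'// (tr_noninc te).
- move=> u u' u0 uu'; have u'0 := le_trans u0 uu'.
  by rewrite -!ff'// (tr_star te).
- apply: cvg_trans (tr_slope te); apply: near_eq_cvg; near=> u.
  by rewrite ff'// ltW//; near: u; exact: nbhs_right_gt.
Unshelve. all: by end_near. Qed.

Lemma trc_scale f e (f0 : R -> R) e0 (c : R -> R) (c0 : R) : tr_cvg f e f0 e0 ->
  (forall eps, 0 < eps <= 1 -> 0 <= c eps) -> c eps @[eps --> 0^'+] --> c0 ->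
  tr_cvg (fun eps s => f eps (c eps * s)) (fun eps => c eps * e eps)
         (fun s => f0 (c0 * s)) (c0 * e0).
Proof.
move=> tf c_ge0 cc0; have c00 : 0 <= c0.
  apply: (cvgr_to_ge cc0); near=> eps; apply: c_ge0; near: eps; exact: near_unit.
split.
- by move=> eps he; apply: tr_scale (trc_tr tf he) _; exact: c_ge0.
- by apply: tr_scale c00; exact: trc_lim tf.
- move=> s s0; apply: (trc_cont tf) => [eps he|]; first by rewrite mulr_ge0 ?c_ge0.
  exact: cvgMr_tmp.
- by apply: cvgM cc0 _; exact: trc_mean tf.
Unshelve. all: by end_near. Qed.

Lemma trc_mul f e (f0 : R -> R) e0 g e' (g0 : R -> R) e0' : tr_cvg f e f0 e0 -> tr_cvg g e' g0 e0' ->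
  tr_cvg (fun eps s => f eps s * g eps s) (fun eps => e eps + e' eps)
         (fun s => f0 s * g0 s) (e0 + e0').
Proof.
move=> tf tg; split.
- by move=> eps he; exact: tr_mul (trc_tr tf he) (trc_tr tg he).
- exact: tr_mul (trc_lim tf) (trc_lim tg).
- by move=> s s0; exact: cvgM (trc_fun tf s0) (trc_fun tg s0).
- exact: cvgD (trc_mean tf) (trc_mean tg).
Qed.

Lemma trc_mix f e (f0 : R -> R) e0 g e' (g0 : R -> R) e0' (p : R -> R) (p0 : R) :
  (forall eps, 0 < eps <= 1 -> 0 <= p eps <= 1) -> 0 <= p0 <= 1 ->
  p eps @[eps --> 0^'+] --> p0 ->
  tr_cvg f e f0 e0 -> tr_cvg g e' g0 e0' ->
  tr_cvg (fun eps s => p eps * f eps s + (1 - p eps) * g eps s)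
         (fun eps => p eps * e eps + (1 - p eps) * e' eps)
         (fun s => p0 * f0 s + (1 - p0) * g0 s) (p0 * e0 + (1 - p0) * e0').
Proof.
move=> p01 p001 pp0 tf tg.
have p'p0 : 1 - p eps @[eps --> 0^'+] --> 1 - p0 by apply: cvgB pp0; exact: cvg_cst.
split.
- by move=> eps he; apply: tr_mix (trc_tr tf he) (trc_tr tg he); exact: p01.
- exact: tr_mix (trc_lim tf) (trc_lim tg).
- by move=> s s0; apply: cvgD; apply: cvgM => //; [exact: (trc_fun tf s0)|exact: (trc_fun tg s0)].
- by apply: cvgD; apply: cvgM => //; [exact: trc_mean tf|exact: trc_mean tg].
Qed.

(** Removing a loop of probability [p] stretches the time scale by [(1 - p)^-1]. This explains the
    argument [(1 - p) s], and the mean, which is [1 - p] times that of [tr_geom] and stays bounded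
    as [p] tends to 1. *)
Lemma trc_geom f e (f0 : R -> R) e0 g e' (g0 : R -> R) e0' (p : R -> R) (p0 : R) :
  (forall eps, 0 < eps <= 1 -> 0 <= p eps < 1) -> p eps @[eps --> 0^'+] --> p0 ->
  tr_cvg f e f0 e0 -> tr_cvg g e' g0 e0' ->
  tr_cvg (fun eps s => (1 - p eps) * f eps ((1 - p eps) * s) /
                       (1 - p eps * g eps ((1 - p eps) * s)))
         (fun eps => (1 - p eps) * e eps + p eps * e' eps)
         (fun s => if p0 < 1 then
            (1 - p0) * f0 ((1 - p0) * s) / (1 - p0 * g0 ((1 - p0) * s))
            else (1 + e0' * s)^-1)
         ((1 - p0) * e0 + p0 * e0').
Proof.
move=> p01 pp0 tf tg.
have p'p0 : 1 - p eps @[eps --> 0^'+] --> 1 - p0 by apply: cvgB pp0; exact: cvg_cst.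
have p'_gt0 eps : 0 < eps <= 1 -> 0 < 1 - p eps.
  by move=> /p01/andP[_ ?]; rewrite subr_gt0.
have p00 : 0 <= p0.
  apply: (cvgr_to_ge pp0); near=> eps.
  have /p01/andP[] // : 0 < eps <= 1 by near: eps; exact: near_unit.
have p0_le1 : p0 <= 1.
  apply: (cvgr_to_le pp0); near=> eps.
  have /p01/andP[_ /ltW] // : 0 < eps <= 1 by near: eps; exact: near_unit.
have scaled h (h0 : R -> R) eh eh0 s : tr_cvg h eh h0 eh0 -> 0 <= s ->
    h eps ((1 - p eps) * s) @[eps --> 0^'+] --> h0 ((1 - p0) * s).
  move=> th s0; apply: (trc_cont th); last exact: cvgMr_tmp.
  by move=> eps he; rewrite mulr_ge0// ltW// p'_gt0.
split.
- move=> eps he; have p'e := p'_gt0 _ he.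
  have := tr_scale (tr_geom (p01 _ he) (trc_tr tf he) (trc_tr tg he)) (ltW p'e).
  rewrite mulrDr [_ * (p eps / _ * _)]mulrA [_ * (p eps / _)]mulrC divfK//.
  by rewrite gt_eqF.
- case: ltP => p01'; last first.
    have -> : p0 = 1 by apply/eqP; rewrite eq_le p0_le1.
    by rewrite subrr mul0r add0r mul1r; apply: tr_exp; exact: tr_mean_ge0 (trc_lim tg).
  have p'e : 0 < 1 - p0 by rewrite subr_gt0.
  have p001 : 0 <= p0 < 1 by rewrite p00.
  have := tr_scale (tr_geom p001 (trc_lim tf) (trc_lim tg)) (ltW p'e).
  by rewrite mulrDr [_ * (p0 / _ * _)]mulrA [_ * (p0 / _)]mulrC divfK ?gt_eqF.
- move=> s s0; case: ltP => p01'.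
    apply: cvgM; first by apply: cvgM => //; exact: (scaled _ _ _ _ _ tf).
    apply: cvgV.
      rewrite gt_eqF// subr_gt0 (le_lt_trans _ p01')// ler_piMr//.
      by apply: tr_le1 (trc_lim tg) _; rewrite mulr_ge0// subr_ge0.
    apply: cvgB; first exact: cvg_cst.
    by apply: cvgM => //; exact: (scaled _ _ _ _ _ tg).
  have p1 : p0 = 1 by apply/eqP; rewrite eq_le p0_le1.
  have d0 : 1 - p eps @[eps --> 0^'+] --> 0 by move: p'p0; rewrite p1 subrr.
  have gs := trc_slope tg s0 p'_gt0 d0.
  have fs := scaled _ _ _ _ _ tf s0; have gs' := scaled _ _ _ _ _ tg s0.
  rewrite p1 subrr mul0r (tr0 (trc_lim tf)) in fs.
  rewrite p1 subrr mul0r (tr0 (trc_lim tg)) in gs'.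
  have den0 : 1 + e0' * s != 0.
    by rewrite gt_eqF// ltr_pwDl// mulr_ge0// (tr_mean_ge0 (trc_lim tg)).
  (* At [p0 = 1] the quotient has the form 0/0. Since [1 - p g = (1 - p) g + (1 - g)], dividing by
     [1 - p] leaves [f / (g + (1 - g) / (1 - p))], where [f] and [g] tend to 1 and the last quotient
     to [e0' s] by [trc_slope]. *)
  have : f eps ((1 - p eps) * s) * (g eps ((1 - p eps) * s) +
      (1 - g eps ((1 - p eps) * s)) / (1 - p eps))^-1 @[eps --> 0^'+] -->
      1 * (1 + e0' * s)^-1.
    by apply: cvgM => //; apply: cvgV => //; exact: cvgD.
  rewrite mul1r; apply: cvg_trans; apply: near_eq_cvg; near=> eps.
  have he : 0 < eps <= 1 by near: eps; exact: near_unit.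
  have ps0 : 0 <= (1 - p eps) * s by rewrite mulr_ge0// ltW// p'_gt0.
  have n1 : 1 - p eps != 0 by rewrite gt_eqF// p'_gt0.
  have n2 : 1 - p eps * g eps ((1 - p eps) * s) != 0.
    rewrite gt_eqF// subr_gt0; have /andP[q0 q1] := p01 _ he.
    rewrite (le_lt_trans _ q1)// ler_piMr//.
    exact: tr_le1 (trc_tr tg he) _.
  set G := g eps _; have -> : G + (1 - G) / (1 - p eps) = (1 - p eps * G) / (1 - p eps).
    by field; exact: n1.
  by rewrite invf_div mulrA (mulrC (f eps _)).
- by apply: cvgD; apply: cvgM => //; [exact: trc_mean tf|exact: trc_mean tg].
Unshelve. all: by end_near. Qed.

End transform_convergence.

(** * Laplace transforms and weak convergence *)

Section laplace_transform.
Context {R : realType}.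
Implicit Types (mu : {finite_measure set R -> \bar R}) (s t u x : R).

Lemma expRN_star (u v x : R) : 0 <= u -> u <= v -> 0 <= x ->
  u * (1 - expR (- (v * x))) <= v * (1 - expR (- (u * x))).
Proof.
move=> u0 uv x0.
(* two tangent lines of [expR] at [- (u * x)] *)
have t1 : expR (- (u * x)) * (1 + u * x) <= 1.
  have := expR_ge1Dx (u * x); rewrite -(ler_pM2l (expR_gt0 (- (u * x)))).
  by rewrite -expRD addNr expR0.
have t2 : expR (- (u * x)) * (1 + (u * x - v * x)) <= expR (- (v * x)).
  have := expR_ge1Dx (u * x - v * x); rewrite -(ler_pM2l (expR_gt0 (- (u * x)))).
  by rewrite -expRD addKr.
have vu0 : 0 <= v - u by rewrite subr_ge0.
have := lerD (ler_wpM2l vu0 t1) (ler_wpM2l u0 t2); lra.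
Qed.

Lemma measurable_expRN s : measurable_fun [set: R] (fun t => expR (- (s * t))).
Proof. by apply: measurableT_comp => //; apply: measurableT_comp => //; exact: mulrl_measurable. Qed.

Lemma integrable_expRN mu s : 0 <= s ->
  mu.-integrable `[0%R, +oo[ (EFin \o (fun t => expR (- (s * t)))).
Proof.
move=> s0; apply: measurable_bounded_integrable => //.
- by rewrite -ge0_fin_numE// fin_num_measure.
- by apply: measurable_funTS; exact: measurable_expRN.
- exists 1; split => // M M1 t /=; rewrite in_itv/= andbT => t0.
  rewrite ger0_norm ?expR_ge0// (le_trans _ (ltW M1))// -[leRHS]expR0 ler_expR.
  by rewrite oppr_le0 mulr_ge0.
Qed.

Lemma laplaceE mu s : laplace mu s = \int[mu]_(t in `[0%R, +oo[) expR (- (s * t)).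
Proof. by []. Qed.

Lemma laplace0 mu : laplace mu 0 = fine (mu `[0%R, +oo[%classic).
Proof.
rewrite /laplace; congr fine; under eq_integral do rewrite mul0r oppr0 expR0.
by rewrite integral_cst// mul1e.
Qed.

Lemma laplace_ge0 mu s : 0 <= laplace mu s.
Proof. by apply: Rintegral_ge0 => t _; exact: expR_ge0. Qed.

Lemma laplace_noninc mu u v : 0 <= u -> u <= v -> laplace mu v <= laplace mu u.
Proof.
move=> u0 uv; apply: le_Rintegral => //.
- by apply: integrable_expRN; exact: le_trans uv.
- exact: integrable_expRN.
- move=> t /=; rewrite in_itv/= andbT => t0.
  by rewrite ler_expR lerN2 ler_wpM2r.
Qed.

Lemma one_sub_laplace mu u : 0 <= u ->
  laplace mu 0 - laplace mu u = \int[mu]_(t in `[0%R, +oo[) (1 - expR (- (u * t))).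
Proof.
move=> u0; rewrite !laplaceE -RintegralB//; last 2 first.
- exact: integrable_expRN.
- exact: integrable_expRN.
by apply: eq_Rintegral => t _; rewrite mul0r oppr0 expR0.
Qed.

Lemma integrable_one_sub mu u : 0 <= u ->
  mu.-integrable `[0%R, +oo[ (EFin \o (fun t => 1 - expR (- (u * t)))).
Proof.
move=> u0; have -> : EFin \o (fun t => 1 - expR (- (u * t))) =
    (fun t => (EFin \o (fun t => expR (- (0 * t)))) t -
              (EFin \o (fun t => expR (- (u * t)))) t)%E.
  by apply/funext => t /=; rewrite mul0r oppr0 expR0 EFinB.
by apply: integrableB => //; exact: integrable_expRN.
Qed.

Lemma laplace_star mu u v : 0 <= u -> u <= v ->
  u * (laplace mu 0 - laplace mu v) <= v * (laplace mu 0 - laplace mu u).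
Proof.
move=> u0 uv; have v0 := le_trans u0 uv.
rewrite !one_sub_laplace// -!RintegralZl//; try exact: integrable_one_sub.
apply: le_Rintegral => //.
- have -> : EFin \o (fun t => u * (1 - expR (- (v * t)))) =
    (fun t => u%:E * (EFin \o (fun t => 1 - expR (- (v * t)))%R) t)%E by [].
  by apply: integrableZl => //; exact: integrable_one_sub.
- have -> : EFin \o (fun t => v * (1 - expR (- (u * t)))) =
    (fun t => v%:E * (EFin \o (fun t => 1 - expR (- (u * t)))%R) t)%E by [].
  by apply: integrableZl => //; exact: integrable_one_sub.
- by move=> t /=; rewrite in_itv/= andbT => t0; exact: expRN_star.
Qed.

(** Dominated convergence along sequences: [(1 - exp (- r t)) / r] lies between [t exp (- r t)] and
    [t], and the finite mean makes [t] an integrable bound. *)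
Lemma laplace_slope mu : (mean mu < +oo)%E ->
  (laplace mu 0 - laplace mu u) / u @[u --> 0^'+] --> fine (mean mu).
Proof.
move=> mean_fin.
have mean0 : (0 <= mean mu)%E.
  by apply: integral_ge0 => t /=; rewrite in_itv/= andbT => t0; rewrite lee_fin.
apply/cvg_at_rightP => r [r0 rcvg].
have mid : measurable_fun (`[0%R, +oo[%classic : set R) (fun t : R => t%:E).
  by apply: measurable_funTS; exact/measurable_EFinP.
have mh n : measurable_fun (`[0%R, +oo[%classic : set R) (fun t : R => ((1 - expR (- (r n * t))) / r n)%:E).
  apply/measurable_EFinP; apply: measurable_funTS; apply: measurable_funM => //.
  by apply: measurable_funB => //; exact: measurable_expRN.
have ig : mu.-integrable `[0%R, +oo[ (fun t : R => t%:E).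
  apply/integrableP; split => //; move: mean_fin; rewrite /mean; apply: le_lt_trans.
  apply: ge0_le_integral => //=.
    by apply: measurableT_comp.
  by move=> t; rewrite in_itv/= andbT => t0; rewrite lee_fin ger0_norm.
have up n (t : R) : (1 - expR (- (r n * t))) / r n <= t.
  rewrite ler_pdivrMr//; have := expR_ge1Dx (- (r n * t)); lra.
have lo n (t : R) : t * expR (- (r n * t)) <= (1 - expR (- (r n * t))) / r n.
  rewrite ler_pdivlMr//; have := expR_ge1Dx (r n * t).
  rewrite -(ler_pM2l (expR_gt0 (- (r n * t)))) -expRD addNr expR0; lra.
have cv (t : R) : ((1 - expR (- (r n * t))) / r n)%:E @[n --> \oo] --> t%:E.
  apply/cvg_EFin; first by near=> n.
  apply: (@squeeze_cvgr _ _ _ _ (fun n => t * expR (- (r n * t))) (fun=> t)).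
  - by near=> n; rewrite lo up.
  - suff : t * expR (- (r n * t)) @[n --> \oo] --> t * expR (- (0 * t)).
      by rewrite mul0r oppr0 expR0 mulr1.
    apply: cvgMl_tmp; apply: continuous_cvg; first exact: continuous_expR.
    by apply: cvgN; apply: cvgMr_tmp.
  - exact: cvg_cst.
have {}up n t : `[0%R, +oo[%classic t ->
    (`|((1 - expR (- (r n * t))) / r n)%:E| <= t%:E)%E.
  move=> /=; rewrite in_itv/= andbT => t0; rewrite lee_fin ger0_norm ?up//.
  by rewrite (le_trans _ (lo _ _))// mulr_ge0// expR_ge0.
have [_ _ dc] := @dominated_convergence _ _ _ mu (`[0%R, +oo[%classic) (measurable_itv _)
  (fun n t => ((1 - expR (- (r n * t))) / r n)%:E) (fun t : R => t%:E)
  (fun t : R => t%:E) mh mid (aeW _ (fun t _ => cv t)) ig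
  (aeW _ (fun t n => up n t)).
have -> : (fun n => (laplace mu 0 - laplace mu (r n)) / r n) =
    (fun n => fine (\int[mu]_(t in `[0%R, +oo[) ((1 - expR (- (r n * t))) / r n)%:E)%E).
  apply/funext => n.
  rewrite one_sub_laplace ?(ltW (r0 n))// mulrC -RintegralZl//; last first.
    by apply: integrable_one_sub; rewrite ltW.
  by rewrite /Rintegral; under eq_integral do rewrite mulrC.
by apply: fine_cvg; rewrite fineK ?ge0_fin_numE.
Unshelve. all: by end_near. Qed.

Lemma measure_nneg mu : mu `]-oo, 0%R[%classic = 0%E ->
  mu `[0%R, +oo[%classic = mu setT.
Proof.
move=> mu0; rewrite -[setT](setUv `[0%R, +oo[%classic) measureU//; last 2 first.
- exact: measurableC.
- exact: setICr.
have -> : ~` `[0%R, +oo[%classic = `]-oo, 0%R[%classic :> set R.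
  by apply/seteqP; split => x /=; rewrite !in_itv/= andbT; [move/negP; rewrite -ltNge|move=> /lt_geF ->].
by rewrite [X in (_ + X)%E]mu0 adde0.
Qed.

Lemma tr_laplace (mu : probability R R) : mu `]-oo, 0%R[%classic = 0%E ->
  (mean mu < +oo)%E -> transform (laplace mu) (fine (mean mu)).
Proof.
move=> mu0 mean_fin.
have L0 : laplace mu 0 = 1 by rewrite laplace0 measure_nneg//= probability_setT.
split => //.
- by move=> u _; exact: laplace_ge0.
- by move=> u v; exact: laplace_noninc.
- by move=> u v u0 uv; rewrite -L0; exact: laplace_star.
- by rewrite -L0; exact: laplace_slope.
Qed.

End laplace_transform.

(** * Laplace transforms through distribution functions *)

Section layer_cake.
Context {R : realType}.

Lemma integral_exp_tail (s a : R) : 0 < s ->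
  (\int[lebesgue_measure]_(t in `[a, +oo[) (s * expR (- (s * t)))%:E =
   (expR (- (s * a)))%:E)%E.
Proof.
move=> s0.
have cexp : continuous (fun z : R => expR (- (s * z))).
  move=> z; apply: continuous_comp; last exact: continuous_expR.
  by apply: continuousN; apply: continuousM => //; exact: cst_continuous.
rewrite (@ge0_continuous_FTC2y _ _ (fun x => - expR (- (s * x))) _ 0)//.
- by rewrite EFinN oppeK add0e.
- by move=> x _; rewrite mulr_ge0 ?expR_ge0// ltW.
- apply: (@continuous_subspaceT _ _ _ (fun x : R => s * expR (- (s * x)))) => z.
  by apply: cvgMl_tmp; exact: cexp.
- rewrite -oppr0; apply: cvgN.
  apply: (@cvg_comp _ _ _ (fun z => s * z) (fun z => expR (- z)) _ (pinfty_nbhs R)).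
    exact: gt0_cvgMry.
  exact: cvgr_expR.
- by apply: cvgN; apply/cvg_at_right_filter; exact: cexp.
- move=> z _; rewrite derive1_comp// derive1N// derive1_id mulN1r.
  rewrite (derive1_comp (f := fun x => - (s * x)) (g := expR))//.
  rewrite [_^`()%classic _]derive1E; have /funeqP -> := @derive_expR R.
  rewrite derive1N// derive1Ml// derive1_id mulr1.
  by rewrite mulrN opprK mulrC.
Qed.

Context d (T : measurableType d) (P : {finite_measure set T -> \bar R}).
Variables (g k : T -> R).
Hypotheses (mg : measurable_fun [set: T] g) (mk : measurable_fun [set: T] k).
Hypothesis g0 : forall w, 0 <= g w.

(** Tonelli applied to [exp (- s k) = \int_k^oo s exp (- s t) dt]. The right-hand side involves [k]
    only through the events [k <= t], the form in which both the Markov property and weak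
    convergence are given. *)
Lemma layer_cake (s : R) : 0 < s ->
  (\int[P]_w (g w * expR (- (s * k w)))%:E =
   \int[lebesgue_measure]_t ((s * expR (- (s * t)))%:E *
      \int[P]_(w in [set w | k w <= t]%R) (g w)%:E))%E.
Proof.
move=> s0.
have mexp : measurable_fun [set: R] (fun t : R => s * expR (- (s * t))).
  by apply: measurable_funM => //; exact: measurable_expRN.
pose h (x : T * R) : \bar R :=
  (g x.1 * (s * expR (- (s * x.2))) * \1_[set x | k x.1 <= x.2] x)%:E.
have mle : measurable [set x : T * R | k x.1 <= x.2].
  have -> : [set x : T * R | k x.1 <= x.2] =
      (fun x : T * R => x.2 - k x.1) @^-1` `[0%R, +oo[%classic.
    by apply/seteqP; split => x /=; rewrite in_itv/= andbT subr_ge0.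
  rewrite -[X in measurable X]setTI.
  have mdif : measurable_fun setT (fun x : T * R => x.2 - k x.1).
    by apply: measurable_funB => //; exact: measurableT_comp.
  exact: mdif.
have mh : measurable_fun setT h.
  apply/measurable_EFinP; apply: measurable_funM; last exact: measurable_indic.
  apply: measurable_funM; first exact: measurableT_comp.
  exact: (@measurableT_comp _ _ _ _ _ _ (fun t : R => s * expR (- (s * t)))).
have h0 x : (0 <= h x)%E.
  by rewrite lee_fin !mulr_ge0 ?expR_ge0// ltW.
have := @fubini_tonelli _ _ T (measurableTypeR R) R P lebesgue_measure h mh h0.
have -> : (\int[P]_w \int[lebesgue_measure]_t h (w, t) =
    \int[P]_w (g w * expR (- (s * k w)))%:E)%E.
  apply: eq_integral => w _.
  rewrite EFinM -integral_exp_tail// -ge0_integralZl//; last 3 first.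
  - by apply/measurable_EFinP; apply: measurable_funTS.
  - by move=> t _; rewrite lee_fin mulr_ge0 ?expR_ge0// ltW.
  - by rewrite lee_fin.
  rewrite [RHS]integral_mkcond; apply: eq_integral => t _.
  rewrite /h patchE /= indicE; case: ifPn => [|]; rewrite ?notin_setE ?inE/= in_itv/= andbT.
    by move=> kt; rewrite mem_set//= mulr1.
  by move=> kt; rewrite memNset ?mulr0.
move=> ->; apply: eq_integral => t _.
have mkt : measurable [set w | k w <= t].
  have -> : [set w | k w <= t] = k @^-1` `]-oo, t]%classic.
    by apply/seteqP; split => w /=; rewrite in_itv.
  by rewrite -[X in measurable X]setTI; exact: mk.
rewrite -ge0_integralZl//; last 3 first.
- by apply/measurable_EFinP; apply: measurable_funTS.
- by move=> w _; rewrite lee_fin.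
- by rewrite lee_fin mulr_ge0 ?expR_ge0// ltW.
rewrite [RHS]integral_mkcond; apply: eq_integral => w _; rewrite patchE /h/= indicE.
case: ifPn => [|]; rewrite ?notin_setE ?inE/=.
  by move=> kt; rewrite mem_set//= mulr1 mulrC EFinM.
by move=> kt; rewrite memNset ?mulr0.
Qed.

End layer_cake.

Section distribution_function.
Context {R : realType}.
Implicit Types mu : {finite_measure set R -> \bar R}.

Lemma dfunE mu t : mu `]-oo, t]%classic = (dfun mu t)%:E.
Proof. by rewrite /dfun fineK// fin_num_measure. Qed.

Lemma dfun_ge0 mu t : 0 <= dfun mu t.
Proof. exact: fine_ge0. Qed.

Lemma dfun_nondecreasing mu : {homo dfun mu : x y / x <= y}.
Proof.
move=> x y xy; rewrite -lee_fin -!dfunE; apply: le_measure; rewrite ?inE//.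
exact: subitvPr.
Qed.

Lemma measurable_dfun mu : measurable_fun [set: R] (dfun mu).
Proof. by apply: nondecreasing_measurable => //; exact: dfun_nondecreasing. Qed.

Lemma dfun_cvgy mu : dfun mu t @[t --> +oo] --> fine (mu setT).
Proof.
have h1 : dfun mu t @[t --> +oo] --> sup (range (dfun mu)).
  apply: nondecreasing_cvgr; first exact: dfun_nondecreasing.
  exists (fine (mu setT)) => _ [t _ <-]; apply: fine_le; rewrite ?fin_num_measure//.
  by apply: le_measure; rewrite ?inE.
suff h2 : dfun mu n%:R @[n --> \oo] --> fine (mu setT).
  have /cvg_pinftyP/(_ _ (@cvgr_idn R)) h3 := h1.
  by rewrite -(cvg_unique _ h3 h2).
have <- : \bigcup_n `]-oo, n%:R]%classic = [set: R].
  apply/seteqP; split => // x _; exists (Num.truncn x).+1 => //=.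
  by rewrite in_itv/= ltW// truncnS_gt.
apply: fine_cvg; rewrite fineK ?fin_num_measure//; last exact: bigcup_measurable.
apply: nondecreasing_cvg_mu => //; first exact: bigcup_measurable.
by move=> n m nm; apply/subsetPset; apply: subitvPr; rewrite bnd_simp ler_nat.
Qed.

Lemma dfun_lt0 mu t : mu `]-oo, 0%R[%classic = 0%E -> t < 0 -> dfun mu t = 0.
Proof.
move=> mu0 t0; apply/eqP; rewrite eq_le dfun_ge0 andbT -lee_fin -dfunE.
apply: (@le_trans _ _ (mu `]-oo, 0%R[%classic)); last by rewrite mu0.
by apply: le_measure; rewrite ?inE//; exact: subitvPr.
Qed.

Lemma integral_dfun mu t :
  (\int[mu]_(w in [set w : R | idfun w <= t]%R) (cst 1 w)%:E = (dfun mu t)%:E)%E.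
Proof.
have -> : [set w : R | idfun w <= t] = `]-oo, t]%classic.
  by apply/seteqP; split => w /=; rewrite in_itv.
by rewrite (eq_integral (cst 1%E))// integral_cst//= mul1e dfunE.
Qed.

Lemma laplaceT mu s : 0 <= s -> mu `]-oo, 0%R[%classic = 0%E ->
  (\int[mu]_x (expR (- (s * x)))%:E = (laplace mu s)%:E)%E.
Proof.
move=> s0 mu0.
have mE : measurable_fun [set: R] (fun x => (expR (- (s * x)))%:E).
  by apply/measurable_EFinP; exact: measurable_expRN.
rewrite /laplace fineK; last first.
  by apply: integrable_fin_num => //; exact: integrable_expRN.
have CE : ~` `[0%R, +oo[%classic = `]-oo, 0%R[%classic :> set R.
  by apply/seteqP; split => x /=; rewrite !in_itv/= andbT; [move/negP; rewrite -ltNge|move=> /lt_geF ->].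
rewrite -(setUv (`[0%R, +oo[%classic : set R)) CE ge0_integral_setU//; last 2 first.
- exact: measurable_funTS.
- by apply/disj_setPS; rewrite -CE setICr.
rewrite [X in (_ + X)%E]null_set_integral ?adde0//.
exact: measurable_funTS.
Qed.

Lemma laplace_dfun mu s : 0 < s -> mu `]-oo, 0%R[%classic = 0%E ->
  ((laplace mu s)%:E =
   \int[lebesgue_measure]_(t in `[0%R, +oo[) (s * expR (- (s * t)) * dfun mu t)%:E)%E.
Proof.
move=> s0 mu0; rewrite -laplaceT ?(ltW s0)//.
have := @layer_cake R _ R mu (cst 1) idfun (measurable_cst _) (@measurable_id _ _ _)
  (fun=> ler01) s s0.
under eq_integral do rewrite mul1r.
move=> ->; rewrite [RHS]integral_mkcond; apply: eq_integral => t _.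
rewrite integral_dfun patchE.
case: ifPn => [_|]; rewrite ?EFinM// notin_setE/= in_itv/= andbT => /negP.
by rewrite -ltNge => /(dfun_lt0 mu0) ->; rewrite mule0.
Qed.

(** Monotonicity supplies the one-sided limits and places [f t] between them, so equal limits would
    force continuity. *)
Lemma nondecreasing_discontinuity (f : R -> R) t : {homo f : x y / x <= y} ->
  ~ {for t, continuous f} -> discontinuity f t.
Proof.
move=> ndf nct.
have cl : cvg (f x @[x --> t^'-]).
  apply: nondecreasing_at_left_is_cvgr.
    by near=> x => y z _ _; exact: ndf.
  near=> x; exists (f t) => _ [y + <-].
  by rewrite /= in_itv/= => /andP[_ /ltW]; exact: ndf.
have cr : cvg (f x @[x --> t^'+]).
  apply: nondecreasing_at_right_is_cvgr.
    by near=> x => y z _ _; exact: ndf.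
  near=> x; exists (f t) => _ [y + <-].
  by rewrite /= in_itv/= => /andP[/ltW + _]; exact: ndf.
split => //; apply/eqP => lr; apply: nct.
have ll : lim (f x @[x --> t^'-]) <= f t.
  apply: limr_le => //; near=> x; apply: ndf; apply: ltW.
  by near: x; exact: nbhs_left_lt.
have lR : f t <= lim (f x @[x --> t^'+]).
  apply: limr_ge => //; near=> x; apply: ndf; apply: ltW.
  by near: x; exact: nbhs_right_gt.
have e : f t = lim (f x @[x --> t^'+]) by apply/eqP; rewrite eq_le lR -lr.
apply/left_right_continuousP; split; rewrite e//.
by rewrite -lr.
Unshelve. all: by end_near. Qed.

Lemma nondecreasing_discontinuity_negligible (f : R -> R) : {homo f : x y / x <= y} ->
  lebesgue_measure.-negligible [set t | ~ {for t, continuous f}].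
Proof.
move=> ndf.
pose A (n : nat) := [set x : R | x \in (`]- n%:R, n%:R[) /\ discontinuity f x].
have cA n : countable (A n).
  by apply: discontinuity_countable => x y _ _; exact: ndf.
have sub : [set t | ~ {for t, continuous f}] `<=` \bigcup_n A n.
  move=> t /= /(nondecreasing_discontinuity ndf) dt.
  exists (Num.truncn `|t|).+1 => //; split => //.
  by rewrite in_itv/= -ltr_norml truncnS_gt.
have : lebesgue_measure.-negligible (\bigcup_n A n); last exact: negligibleS.
apply: negligible_bigcup => n; exists (A n); split => //.
- exact: countable_measurable.
- exact: countable_lebesgue_measure0.
Qed.

Section weak_to_laplace.
Variables (mu : R -> subprobability R R) (mu0 : subprobability R R).
Hypotheses (mu_nneg : forall eps, 0 < eps <= 1 -> mu eps `]-oo, 0%R[%classic = 0%E)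
  (mu0_nneg : mu0 `]-oo, 0%R[%classic = 0%E).

(** For [s > 0] the transform is the Lebesgue integral of [s exp (- s t)] times the distribution
    function. Weak convergence gives convergence of the integrand off the null set of jumps, and
    [s exp (- s t)] dominates. At [s = 0] the claim is the convergence of masses. *)
Lemma weak_cvg_laplace s : 0 <= s ->
  weak_cvg (fun eps => dfun (mu eps)) (dfun mu0) ->
  laplace (mu eps) s @[eps --> 0^'+] --> laplace mu0 s.
Proof.
move=> + [wc mc]; rewrite le_eqVlt => /predU1P[<-|s0].
  rewrite laplace0 measure_nneg// -(cvg_lim _ (@dfun_cvgy mu0))//.
  apply: cvg_trans mc; apply: near_eq_cvg; near=> eps.
  rewrite laplace0 measure_nneg ?(cvg_lim _ (@dfun_cvgy (mu eps)))//.
  by apply: mu_nneg; near: eps; exact: near_unit.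
have dfun_le1 (nu : subprobability R R) t : dfun nu t <= 1.
  rewrite -lee_fin -dfunE (le_trans _ (@sprobability_setT _ _ _ nu))//.
  by apply: le_measure; rewrite ?inE.
have s_ge0 := ltW s0.
apply/cvg_at_rightP => r [r0 rcvg].
pose h (nu : subprobability R R) (t : R) := (s * expR (- (s * t)) * dfun nu t)%:E.
have mexp : measurable_fun [set: R] (fun t : R => s * expR (- (s * t))).
  by apply: measurable_funM => //; exact: measurable_expRN.
have mh nu : measurable_fun (`[0%R, +oo[%classic : set R) (h nu).
  apply/measurable_EFinP; apply: measurable_funTS; apply: measurable_funM => //.
  exact: measurable_dfun.
have hcv : {ae lebesgue_measure, forall t : R, `[0%R, +oo[%classic t ->
    h (mu (r n)) t @[n --> \oo] --> h mu0 t}.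
  have := nondecreasing_discontinuity_negligible (@dfun_nondecreasing mu0).
  apply: negligibleS => t /= /not_implyP[_ nt] ct; apply: nt.
  apply/cvg_EFin; first by near=> n.
  apply: cvgMl_tmp; have /cvg_at_rightP := wc t ct; apply; split => //.
have ig : lebesgue_measure.-integrable (`[0%R, +oo[%classic : set R)
    (fun t : R => (s * expR (- (s * t)))%:E).
  apply/integrableP; split; first by apply/measurable_EFinP; apply: measurable_funTS.
  under eq_integral do rewrite abse_EFin ger0_norm ?mulr_ge0 ?expR_ge0//.
  by rewrite integral_exp_tail// ltry.
have bd : {ae lebesgue_measure, forall t : R, forall n, `[0%R, +oo[%classic t ->
    (`|h (mu (r n)) t| <= (s * expR (- (s * t)))%:E)%E}.
  apply: aeW => t n _; rewrite /h abse_EFin lee_fin ger0_norm; last first.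
    by rewrite !mulr_ge0// ?expR_ge0// dfun_ge0.
  by rewrite ler_piMr// mulr_ge0// expR_ge0.
have [_ _ dc] := @dominated_convergence _ _ _ lebesgue_measure (`[0%R, +oo[%classic)
  (measurable_itv _) (fun n => h (mu (r n))) (h mu0) _ (fun n => mh _) (mh _) hcv ig bd.
have {}dc : [sequence (\int[lebesgue_measure]_(x in `[0%R, +oo[) h (mu (r n)) x)%E]_n
    x @[x --> \oo] --> (laplace mu0 s)%:E by rewrite (laplace_dfun s0).
apply: cvg_trans (fine_cvg dc); apply: near_eq_cvg; near=> n.
rewrite /= -(laplace_dfun s0)//; apply: mu_nneg; rewrite r0/=.
by near: n; apply: (cvgr_le 0).
Unshelve. all: by end_near. Qed.

End weak_to_laplace.
End distribution_function.

Section transfer.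
Context {R : realType} d (T : measurableType d) (P : {finite_measure set T -> \bar R}).
Variables (g k : T -> R) (nu : {finite_measure set R -> \bar R}) (C : R).
Hypotheses (mg : measurable_fun [set: T] g) (mk : measurable_fun [set: T] k).
Hypotheses (g0 : forall w, 0 <= g w) (C0 : 0 <= C).
Hypothesis nu_nneg : nu `]-oo, 0%R[%classic = 0%E.
Hypothesis gk : forall t, (\int[P]_(w in [set w | k w <= t]%R) (g w)%:E =
  (C * dfun nu t)%:E)%E.

(** The hypothesis [gk] says that under the weight [g] the law of [k] is [C] times [nu]; both sides
    then have the same layer-cake representation. *)
Lemma transfer_laplace (s : R) : 0 <= s ->
  (\int[P]_w (g w * expR (- (s * k w)))%:E = (C * laplace nu s)%:E)%E.
Proof.
rewrite le_eqVlt => /predU1P[<-|s0]; last first.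
  rewrite layer_cake// EFinM (laplace_dfun s0)// -ge0_integralZl//; last 2 first.
  - apply/measurable_EFinP; apply: measurable_funTS; apply: measurable_funM.
      by apply: measurable_funM => //; exact: measurable_expRN.
    exact: measurable_dfun.
  - by move=> t _; rewrite lee_fin !mulr_ge0 ?expR_ge0 ?dfun_ge0// ltW.
  rewrite [RHS]integral_mkcond; apply: eq_integral => t _; rewrite gk patchE.
  case: ifPn => [_|]; first by rewrite -!EFinM mulrCA.
  rewrite notin_setE/= in_itv/= andbT => /negP; rewrite -ltNge.
  by move=> /(dfun_lt0 nu_nneg) ->; rewrite mulr0 mule0.
(* The layer cake requires [s > 0]. For [s = 0] the total masses are compared by monotone
   convergence along the events [k <= n]. *)
under eq_integral do rewrite mul0r oppr0 expR0 mulr1.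
rewrite laplace0 measure_nneg//.
have F n : measurable [set w | k w <= n%:R].
  have -> : [set w | k w <= n%:R] = k @^-1` `]-oo, n%:R]%classic.
    by apply/seteqP; split => w /=; rewrite in_itv.
  by rewrite -[X in measurable X]setTI; exact: mk.
have ndF : nondecreasing_seq (fun n : nat => [set w | k w <= n%:R]).
  by move=> n m nm; apply/subsetPset => w /= /le_trans; apply; rewrite ler_nat.
have mF (n : nat) : measurable_fun [set w | k w <= n%:R] (fun w => (g w)%:E).
  by apply/measurable_EFinP; apply: measurable_funTS.
have F0 (n : nat) w : [set w | k w <= n%:R] w -> (0 <= (g w)%:E)%E by rewrite lee_fin.
have := @ge0_nondecreasing_set_cvg_integral _ _ _ _ _ P ndF F mF F0.
have -> : \bigcup_i [set w | k w <= i%:R] = setT.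
  apply/seteqP; split => // w _; exists (Num.truncn (k w)).+1 => //=.
  by rewrite ltW// truncnS_gt.
move=> h1; apply: (cvg_unique _ h1) => //.
have -> : (fun i : nat => \int[P]_(x in [set w | k w <= i%:R]%R) (g x)%:E)%E =
    (fun i : nat => (C * dfun nu i%:R)%:E) by apply/funext => i; rewrite gk.
apply/cvg_EFin; first by near=> n.
apply: cvgMl_tmp; have /cvg_pinftyP := @dfun_cvgy R nu; apply.
exact: cvgr_idn.
Unshelve. all: by end_near. Qed.

End transfer.

(** * The continuity theorem *)

Section exponential_step.
Context {R : realType}.

Lemma bernoulli_ge (z : R) n : -1 <= z -> 1 + n%:R * z <= (1 + z) ^+ n.
Proof.
move=> z1; elim: n => [|n IH]; first by rewrite mul0r addr0 expr0.
rewrite exprS; apply: le_trans (ler_wpM2l _ IH); last by lra.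
have : 0 <= n%:R * z ^+ 2 by rewrite mulr_ge0 ?sqr_ge0.
rewrite -natr1 expr2; lra.
Qed.

Definition exp_step (n N : nat) (x : R) : R := (1 - expR (- (n%:R * x))) ^+ N.

Lemma exp_step01 n N x : 0 <= x -> 0 <= exp_step n N x <= 1.
Proof.
move=> x0; have z1 : expR (- (n%:R * x)) <= 1.
  by rewrite -[leRHS]expR0 ler_expR oppr_le0 mulr_ge0.
have z0 := expR_ge0 (- (n%:R * x)).
by rewrite /exp_step exprn_ge0 ?exprn_ile1 ?subr_ge0// gerBl.
Qed.

(* With [z = exp(-nx)], [(1 - z)^N <= 1 / (N z)] and [1 - (1 - z)^N <= N z];
   [N] is chosen about [exp(n c)] with [c] the midpoint of [t1] and [t2]. *)
Lemma exp_step_approx (t1 t2 h : R) : 0 <= t1 -> t1 < t2 -> 0 < h ->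
  exists n N : nat, forall x, 0 <= x ->
    (x <= t1 -> exp_step n N x <= h) /\ (t2 <= x -> 1 - h <= exp_step n N x).
Proof.
move=> t10 t12 h0.
pose d := (t2 - t1) / 2; have d0 : 0 < d by rewrite divr_gt0// subr_gt0.
(* This makes [n d >= 2 / h], hence [2 exp (- n d) <= h]; the 2 pays for rounding [N] up, as [N] is
   at most twice the exponential it replaces. *)
pose n := (Num.truncn (2 / (h * d))).+1.
pose N := (Num.truncn (expR (n%:R * (t1 + d)))).+1.
have nd : 2 * expR (- (n%:R * d)) <= h.
  have : 2 / h <= expR (n%:R * d).
    apply: le_trans (expR_ge1Dx _); apply: (@le_trans _ _ (n%:R * d)); last by rewrite lerDr.
    rewrite -ler_pdivrMr// -mulrA -invfM; apply: ltW; exact: truncnS_gt.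
  by rewrite ler_pdivrMr// => H; rewrite expRN ler_pdivrMr ?expR_gt0// mulrC.
have NE : expR (n%:R * (t1 + d)) <= N%:R by apply: ltW; exact: truncnS_gt.
have NE2 : N%:R <= 2 * expR (n%:R * (t1 + d)).
  rewrite /N -natr1 [2 * _]mulr_natl mulr2n lerD//.
    by rewrite truncn_le// expR_ge0.
  by rewrite -[leLHS]expR0 ler_expR mulr_ge0// addr_ge0// ltW.
exists n, N => x x0; set z := expR (- (n%:R * x)).
have z0 : 0 < z by exact: expR_gt0.
have z1 : z <= 1 by rewrite -[leRHS]expR0 ler_expR oppr_le0 mulr_ge0.
split => xt.
(* [(1 - z)^N (1 + z)^N <= 1], and Bernoulli bounds the second power below by [1 + N z]. *)
- have b : exp_step n N x * (1 + N%:R * z) <= 1.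
    apply: (@le_trans _ _ ((1 - z) ^+ N * (1 + z) ^+ N)).
      rewrite ler_wpM2l//; first by rewrite exprn_ge0// subr_ge0.
      by apply: bernoulli_ge; lra.
    rewrite -exprMn exprn_ile1//; nra.
  have Nz : expR (n%:R * d) <= N%:R * z.
    apply: le_trans (ler_wpM2r (ltW z0) NE); rewrite -expRD ler_expR.
    by rewrite -mulrBr ler_wpM2l//; lra.
  have /andP[s0 _] := exp_step01 n N x0.
  have : exp_step n N x * expR (n%:R * d) <= 1.
    apply: le_trans b; rewrite ler_wpM2l//; lra.
  rewrite -ler_pdivlMr ?expR_gt0// div1r -expRN => /le_trans; apply.
  apply: le_trans nd; rewrite ler_peMl ?expR_ge0//; lra.
- have b : 1 - N%:R * z <= exp_step n N x.
    by rewrite /exp_step -/z -mulrN; apply: bernoulli_ge; lra.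
  apply: le_trans b; rewrite lerD2l lerN2; apply: le_trans nd.
  apply: (le_trans (ler_wpM2r (ltW z0) NE2)); rewrite -mulrA -expRD ler_pM2l//.
  rewrite ler_expR -mulrBr -mulrN ler_wpM2l//.
  rewrite /d; lra.
Qed.

End exponential_step.

Section laplace_continuity.
Context {R : realType}.
Variables (mu : R -> subprobability R R) (Psi : R -> R).
Hypothesis mu_nneg : forall eps, 0 < eps <= 1 -> mu eps `]-oo, 0%R[%classic = 0%E.
Hypothesis mu_Psi : forall s, 0 <= s -> laplace (mu eps) s @[eps --> 0^'+] --> Psi s.
(** Right continuity at 0 is what prevents mass from escaping to infinity. *)
Hypothesis Psi0 : Psi s @[s --> 0^'+] --> Psi 0.

Definition integ (f : R -> R) (eps : R) : R := \int[mu eps]_(t in `[0%R, +oo[) f t.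

(** On these functions the limit [Lam] of the integrals exists and is linear: it is integration
    against the limit measure before that measure has been constructed. *)
Record test (f : R -> R) : Prop := Test {
  test_cont : continuous f;
  test_int : forall eps, (mu eps).-integrable `[0%R, +oo[ (EFin \o f);
  test_cvg : cvg (integ f eps @[eps --> 0^'+]) }.

Definition Lam f := lim (integ f eps @[eps --> 0^'+]).

Lemma test_exp (n : nat) : test (fun x => expR (- (n%:R * x))).
Proof.
split.
- move=> z; apply: continuous_comp; last exact: continuous_expR.
  by apply: continuousN; apply: continuousM => //; exact: cst_continuous.
- by move=> eps; exact: integrable_expRN.
- by apply/cvg_ex; exists (Psi n%:R); exact: mu_Psi.
Qed.

Lemma integ_lin a f g eps : test f -> test g ->
  integ (fun x => a * f x + g x) eps = a * integ f eps + integ g eps.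
Proof.
move=> tf tg; rewrite /integ RintegralD//; last 2 first.
- have -> : EFin \o (fun x => a * f x) = (fun x => a%:E * (EFin \o f) x)%E by [].
  by apply: integrableZl => //; exact: test_int tf _.
- exact: test_int tg _.
by rewrite RintegralZl//; exact: test_int tf _.
Qed.

Lemma test_lin a f g : test f -> test g -> test (fun x => a * f x + g x).
Proof.
move=> tf tg; split.
- move=> x; apply: cvgD; last exact: (test_cont tg).
  by apply: cvgMl_tmp; exact: (test_cont tf).
- move=> eps; have -> : EFin \o (fun x => a * f x + g x) =
    (fun x => a%:E * (EFin \o f) x + (EFin \o g) x)%E by [].
  apply: integrableD => //; last exact: test_int tg _.
  by apply: integrableZl => //; exact: test_int tf _.
- apply/cvg_ex; exists (a * Lam f + Lam g).
  have -> : integ (fun x => a * f x + g x) = (fun eps => a * integ f eps + integ g eps).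
    by apply/funext => eps; exact: integ_lin.
  by apply: cvgD; [apply: cvgMl_tmp|]; [exact: test_cvg tf|exact: test_cvg tg].
Qed.

Lemma Lam_lin a f g : test f -> test g ->
  Lam (fun x => a * f x + g x) = a * Lam f + Lam g.
Proof.
move=> tf tg; apply: cvg_lim => //.
have -> : integ (fun x => a * f x + g x) = (fun eps => a * integ f eps + integ g eps).
  by apply/funext => eps; exact: integ_lin.
by apply: cvgD; [apply: cvgMl_tmp|]; [exact: test_cvg tf|exact: test_cvg tg].
Qed.

Lemma test_cst c : test (fun=> c).
Proof.
have -> : (fun=> c) = (fun x : R => (c - 1) * expR (- (0%:R * x)) + expR (- (0%:R * x))).
  by apply/funext => x; rewrite mul0r oppr0 expR0 mulr1 subrK.
by apply: test_lin; exact: (test_exp 0).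
Qed.

Lemma integ_cst c eps : integ (fun=> c) eps = c * laplace (mu eps) 0.
Proof.
rewrite laplaceE -RintegralZl//; last exact: integrable_expRN.
by apply: eq_Rintegral => x _; rewrite mul0r oppr0 expR0 mulr1.
Qed.

Lemma Lam_cst c : Lam (fun=> c) = c * Psi 0.
Proof.
apply: cvg_lim => //; under eq_fun do rewrite integ_cst.
by apply: cvgMl_tmp; exact: mu_Psi.
Qed.

(** Only linear combinations are known to preserve [test]. The extra factor [exp (- m x)] makes the
    induction close: with [z = exp (- n x)], multiplying by [1 - z] is a difference of two such
    functions, with [m] shifted by [n] in one of them. *)
Lemma test_step n N : test (exp_step n N).
Proof.
suff H m : test (fun x : R => exp_step n N x * expR (- (m%:R * x))).
  have := H 0; congr test; apply/funext => x.
  by rewrite mul0r oppr0 expR0 mulr1.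
elim: N m => [|N IH] m.
  have -> : (fun x : R => exp_step n 0 x * expR (- (m%:R * x))) =
      (fun x : R => expR (- (m%:R * x))).
    by apply/funext => x; rewrite /exp_step expr0 mul1r.
  exact: test_exp.
have -> : (fun x : R => exp_step n N.+1 x * expR (- (m%:R * x))) =
    (fun x : R => (-1) * (exp_step n N x * expR (- ((n + m)%:R * x))) +
               exp_step n N x * expR (- (m%:R * x))).
  apply/funext => x; rewrite /exp_step exprSr natrD mulrDl opprD expRD.
  by ring.
exact: test_lin.
Qed.

Lemma integ_indic eps t : 0 < eps <= 1 ->
  integ (fun x => (x <= t)%R%:R) eps = dfun (mu eps) t.
Proof.
move=> he; rewrite /integ /Rintegral /dfun; congr fine.
transitivity (\int[mu eps]_(x in `[0%R, +oo[) (\1_(`]-oo, t]%classic : set R) x)%:E)%E.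
  apply: eq_integral => x _; rewrite indicE; congr (_%:R%:E).
  by rewrite mem_setE in_itv.
rewrite integral_indic//.
rewrite -[in RHS](setIT `]-oo, t]%classic) -(setUv (`[0%R, +oo[%classic : set R)) setIUr.
rewrite measureU//; last 3 first.
- exact: measurableI.
- by apply: measurableI => //; exact: measurableC.
- by rewrite setIACA setICr setI0.
rewrite [X in _ = (_ + X)%E](_ : _ = 0%E) ?adde0//.
apply/eqP; rewrite eq_le measure_ge0 andbT.
apply: (@le_trans _ _ (mu eps `]-oo, 0%R[%classic)); last by rewrite mu_nneg.
apply: le_measure; rewrite ?inE//.
  by apply: measurableI => //; exact: measurableC.
by move=> x /= [_]; rewrite !in_itv/= andbT => /negP; rewrite -ltNge.
Qed.

Lemma integrable_le eps t : (mu eps).-integrable `[0%R, +oo[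
  (EFin \o (fun x => (x <= t)%R%:R)).
Proof.
apply: measurable_bounded_integrable => //.
- by rewrite -ge0_fin_numE// fin_num_measure.
- apply: measurable_funTS.
  have -> : (fun x => (x <= t)%R%:R) = \1_(`]-oo, t]%classic : set R) :> (R -> R).
    apply/funext => x; rewrite indicE; congr (_%:R).
    by rewrite mem_setE in_itv.
  exact: measurable_indic.
- exists 1; split => // M M1 x _ /=; rewrite (le_trans _ (ltW M1))//.
  by case: (x <= t); rewrite ?normr1 ?normr0.
Qed.

Lemma dfun_le_integ eps t f : 0 < eps <= 1 -> test f ->
  (forall x, 0 <= x -> (x <= t)%R%:R <= f x) -> dfun (mu eps) t <= integ f eps.
Proof.
move=> he tf tf1; rewrite -integ_indic//; apply: le_Rintegral => //.
- exact: integrable_le.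
- exact: test_int tf _.
- by move=> x /=; rewrite in_itv/= andbT; exact: tf1.
Qed.

Lemma integ_le_dfun eps t f : 0 < eps <= 1 -> test f ->
  (forall x, 0 <= x -> f x <= (x <= t)%R%:R) -> integ f eps <= dfun (mu eps) t.
Proof.
move=> he tf tf1; rewrite -integ_indic//; apply: le_Rintegral => //.
- exact: test_int tf _.
- exact: integrable_le.
- by move=> x /=; rewrite in_itv/= andbT; exact: tf1.
Qed.

Definition upper t := [set f | test f /\ forall x, 0 <= x -> (x <= t)%R%:R <= f x].

(** The candidate for the limit distribution function. An infimum over continuous majorants of the
    indicator of [[0, t]] is automatically right-continuous, so no subsequence has to be
    selected. *)
Definition lim_dfun t := if t < 0 then 0 else inf [set Lam f | f in upper t].

Lemma Lam_ge0 t f : upper t f -> 0 <= Lam f.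
Proof.
move=> [tf f0]; apply: limr_ge; first exact: test_cvg tf.
near=> eps; apply: Rintegral_ge0 => x /=; rewrite in_itv/= andbT => /f0.
exact: le_trans.
Unshelve. all: by end_near. Qed.

Lemma Psi0_ge0 : 0 <= Psi 0.
Proof.
apply: (cvgr_to_ge (mu_Psi (lexx 0))); near=> eps; exact: laplace_ge0.
Unshelve. all: by end_near. Qed.

Lemma upper_has_inf t : has_inf [set Lam f | f in upper t].
Proof.
split; last by exists 0 => _ [f uf <-]; exact: Lam_ge0 uf.
exists (Lam (fun=> 1)), (fun=> 1) => //; split; first exact: test_cst.
by move=> x _; case: (x <= t).
Qed.

Lemma lim_dfun_ge0 t : 0 <= lim_dfun t.
Proof.
rewrite /lim_dfun; case: ifPn => // _.
apply: lb_le_inf; first by have [] := upper_has_inf t.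
by move=> _ [f uf <-]; exact: Lam_ge0 uf.
Qed.

Lemma lim_dfun_le t f : 0 <= t -> upper t f -> lim_dfun t <= Lam f.
Proof.
move=> t0 uf; rewrite /lim_dfun ltNge t0/=; apply: ge_inf; last by exists f.
by have [] := upper_has_inf t.
Qed.

Lemma lim_dfun_lt t h : 0 <= t -> 0 < h -> exists2 f, upper t f & Lam f < lim_dfun t + h.
Proof.
move=> t0 h0; rewrite /lim_dfun ltNge t0/=.
have [_ [f uf <-] ?] := inf_adherent h0 (upper_has_inf t); by exists f.
Qed.

Lemma lim_dfun_nd : {homo lim_dfun : x y / x <= y}.
Proof.
move=> x y xy; have [x0|x0] := ltP x 0; first by rewrite {1}/lim_dfun x0 lim_dfun_ge0.
have y0 := le_trans x0 xy; apply/ler_addgt0Pl => h h0; rewrite addrC.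
have [f [tf fy] /ltW] := lim_dfun_lt y0 h0; apply: le_trans; apply: lim_dfun_le => //.
split => // z z0; apply: le_trans (fy z z0); rewrite ler_nat.
by case: (z <= x) / idP => // /le_trans ->.
Qed.

Lemma dfun_mu_le t h : 0 < h -> \forall eps \near 0^'+, dfun (mu eps) t <= lim_dfun t + h.
Proof.
move=> h0; have [t0|t0] := ltP t 0.
  near=> eps; rewrite dfun_lt0 ?addr_ge0 ?lim_dfun_ge0// ?(ltW h0)//.
  by apply: mu_nneg; near: eps; exact: near_unit.
have [f [tf ft] Lf] := lim_dfun_lt t0 h0.
have := test_cvg tf => /(cvgr_le (Lam f)) /(_ _ Lf) H.
near=> eps; apply: (@le_trans _ _ (integ f eps)); last by near: eps.
by apply: dfun_le_integ => //; near: eps; exact: near_unit.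
Unshelve. all: by end_near. Qed.

(** The gap between [t1] and [t2] leaves room for an exponential step. Lifted, it majorises the
    indicator of [x <= t1]; lowered, it minorises that of [x <= t2]; the two versions differ by a
    small constant only. *)
Lemma dfun_mu_ge t1 t2 h : t1 < t2 -> 0 < h ->
  \forall eps \near 0^'+, lim_dfun t1 - h <= dfun (mu eps) t2.
Proof.
move=> t12 h0; have [t0|t0] := ltP t1 0.
  near=> eps; rewrite /lim_dfun t0 (le_trans _ (dfun_ge0 _ _))// sub0r oppr_le0.
  exact: ltW.
have P1 : 0 < Psi 0 + 1 by rewrite ltr_wpDl// Psi0_ge0.
(* The two shifts are [2 d] apart, which costs [2 d Psi 0 <= h / 2]; the other half of [h] is spent
   on the limit. Adding 1 keeps the denominator positive when [Psi 0 = 0]. *)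
pose d := h / 4 / (Psi 0 + 1).
have d0 : 0 < d by rewrite !divr_gt0.
have dP : d * Psi 0 <= h / 4.
  rewrite /d -mulrA ler_piMr ?divr_ge0 ?(ltW h0)// mulrC ler_pdivrMr// mul1r.
  by rewrite lerDl.
have [n [N step]] := exp_step_approx t0 t12 d0.
have ts := test_step n N.
pose f (c x : R) : R := (-1) * exp_step n N x + c.
have tf c : test (f c) by apply: test_lin => //; exact: test_cst.
have Lf c : Lam (f c) = - Lam (exp_step n N) + c * Psi 0.
  by rewrite Lam_lin// ?Lam_cst ?mulN1r//; exact: test_cst.
have up : lim_dfun t1 <= Lam (f (1 + d)).
  apply: lim_dfun_le => //; split => // x x0; have [s1 _] := step x x0.
  have /andP[s0 s01] := exp_step01 n N x0; rewrite /f.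
  by case: (x <= t1) / idP => [/s1|_]; rewrite ?mulr1n ?mulr0n; lra.
have lo eps : 0 < eps <= 1 -> integ (f (1 - d)) eps <= dfun (mu eps) t2.
  move=> he; apply: integ_le_dfun => // x x0; have [_ s2] := step x x0.
  have /andP[s0 s01] := exp_step01 n N x0; rewrite /f.
  have [xt|xt] := leP x t2; rewrite ?mulr1n ?mulr0n; first by lra.
  by have := s2 (ltW xt); lra.
have h2 : Lam (f (1 - d)) - h / 2 < Lam (f (1 - d)) by rewrite gtrBl divr_gt0.
have := test_cvg (tf (1 - d)) => /(cvgr_ge (Lam (f (1 - d)))) /(_ _ h2) H.
near=> eps.
have := lo eps; have -> : 0 < eps <= 1 by near: eps; exact: near_unit.
move=> /(_ isT); apply: le_trans; apply: (@le_trans _ _ (Lam (f (1 - d)) - h / 2)).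
  by move: up; rewrite !Lf; lra.
by near: eps.
Unshelve. all: by end_near. Qed.

(** A nearly optimal majorant [f] at [t] satisfies [f t >= 1]; by continuity [f + d] is still a
    majorant for every [x] slightly larger than [t], at the cost [d Psi 0]. *)
Lemma lim_dfun_rc : right_continuous lim_dfun.
Proof.
move=> t; have [t0|t0] := ltP t 0.
  apply: (@cvg_trans _ ((0 : R) @[x --> t^'+])).
    apply: near_eq_cvg; near=> x.
    have x0 : x < 0 by near: x; exact: nbhs_right_lt.
    by rewrite /lim_dfun x0.
  by rewrite /lim_dfun t0; exact: cvg_cst.
apply/cvgrPdist_le => h h0.
have P1 : 0 < Psi 0 + 1 by rewrite ltr_wpDl// Psi0_ge0.
pose d := h / 2 / (Psi 0 + 1).
have d0 : 0 < d by rewrite !divr_gt0.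
have dP : d * Psi 0 <= h / 2.
  rewrite /d -mulrA ler_piMr ?divr_ge0 ?(ltW h0)// mulrC ler_pdivrMr// mul1r.
  by rewrite lerDl.
have h2 : 0 < h / 2 by rewrite divr_gt0.
have [f [tf ft] Lf] := lim_dfun_lt t0 h2.
have ft1 : 1 <= f t by have := ft t t0; rewrite lexx.
have ftd : f t - d < f t by rewrite gtrBl.
have /(cvgr_gt (f t)) /(_ _ ftd) [r /= r0 rf] : f x @[x --> t] --> f t by exact: (test_cont tf).
near=> x.
have tx : t < x by near: x; exact: nbhs_right_gt.
have xr : x < t + r by near: x; apply: nbhs_right_lt; rewrite ltrDl.
rewrite distrC ger0_norm ?subr_ge0 ?lim_dfun_nd ?(ltW tx)//.
have : lim_dfun x <= Lam (fun z => 1 * f z + d).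
  apply: lim_dfun_le; first exact: le_trans (ltW tx).
  split; first by apply: test_lin => //; exact: test_cst.
  move=> z z0; rewrite mul1r; have [zx|zx] := leP z x; last first.
    by rewrite addr_ge0 ?(ltW d0)//; apply: le_trans (ft z z0).
  have [zt|zt] := leP z t.
    by have := ft z z0; rewrite zt mulr1n; lra.
  have : f t - d < f z.
    by apply: rf; rewrite /= distrC ger0_norm ?subr_ge0 ?(ltW zt)// ltrBlDl (le_lt_trans zx).
  by rewrite mulr1n; lra.
rewrite Lam_lin ?Lam_cst ?mul1r//; last exact: test_cst.
by lra.
Unshelve. all: by end_near. Qed.

Lemma lim_dfun_le_Psi0 t : lim_dfun t <= Psi 0.
Proof.
rewrite /lim_dfun; case: ifPn => [_|]; first exact: Psi0_ge0.
rewrite -leNgt => t0; have := @lim_dfun_le t (fun=> 1) t0.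
rewrite Lam_cst mul1r /lim_dfun ltNge t0/=; apply; split; first exact: test_cst.
by move=> x _; case: (x <= t).
Qed.

(** Integrate [exp (- s x) <= 1_(x <= t) + exp (- s t)] against measures of mass at most 1: this is
    a quantitative tightness bound. *)
Lemma lim_dfun_ge_Psi s t : 0 < s -> Psi s - expR (- (s * t)) <= lim_dfun t.
Proof.
move=> s0; apply/ler_addgt0Pr => h h0.
apply: (cvgr_to_le (_ : laplace (mu eps) s - expR (- (s * t)) @[eps --> 0^'+] --> _)).
  by apply: cvgB; [apply: mu_Psi; exact: ltW|exact: cvg_cst].
near=> eps.
have he : 0 < eps <= 1 by near: eps; exact: near_unit.
apply: (@le_trans _ _ (dfun (mu eps) t)); last by near: eps; exact: dfun_mu_le.
rewrite lerBlDr -integ_indic//.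
have c1 : integ (fun=> expR (- (s * t))) eps <= expR (- (s * t)).
  rewrite integ_cst ler_piMr ?expR_ge0// laplace0 -lee_fin fineK ?fin_num_measure//.
  apply: le_trans (@sprobability_setT _ _ _ (mu eps)).
  by apply: le_measure; rewrite ?inE.
apply: le_trans (lerD (lexx _) c1).
rewrite -RintegralD//; last 2 first.
- exact: integrable_le.
- exact: test_int (test_cst _) _.
apply: le_Rintegral => //.
- by apply: integrable_expRN; exact: ltW.
- pose ind (x : R) : R := (x <= t)%R%:R.
  have -> : EFin \o (fun x => (x <= t)%R%:R + expR (- (s * t))) =
    (fun x => (EFin \o ind) x + (EFin \o (cst (expR (- (s * t))%R))) x)%E by [].
  by apply: integrableD => //; [exact: integrable_le|exact: test_int (test_cst _) _].
- move=> x /=; rewrite in_itv/= andbT => x0; have [xt|xt] := leP x t.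
    rewrite mulr1n ler_wpDr ?expR_ge0// -[leRHS]expR0 ler_expR oppr_le0 mulr_ge0//.
    exact: ltW.
  by rewrite mulr0n add0r ler_expR lerN2 ler_pM2l// ltW.
Unshelve. all: by end_near. Qed.

(** In the tightness bound first [t] tends to infinity, then [s] to 0; the second limit uses the
    continuity of [Psi] at 0. *)
Lemma lim_dfun_cvgy : lim_dfun t @[t --> +oo] --> Psi 0.
Proof.
have ub : has_ubound (range lim_dfun).
  by exists (Psi 0) => _ [t _ <-]; exact: lim_dfun_le_Psi0.
have cv := nondecreasing_cvgr lim_dfun_nd ub.
suff <- : sup (range lim_dfun) = Psi 0 by [].
apply/eqP; rewrite eq_le; apply/andP; split.
  apply: (cvgr_to_le cv); near=> t; exact: lim_dfun_le_Psi0.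
apply: (cvgr_to_le Psi0); near=> s.
have s0 : 0 < s by near: s; exact: nbhs_right_gt.
have : Psi s - expR (- (s * t)) @[t --> +oo] --> Psi s - 0.
  apply: cvgB; first exact: cvg_cst.
  apply: (@cvg_comp _ _ _ (fun z => s * z) (fun z => expR (- z)) _ (pinfty_nbhs R)).
    exact: gt0_cvgMry.
  exact: cvgr_expR.
rewrite subr0 => cP; apply: (ler_cvg_to cP cv); near=> t.
exact: lim_dfun_ge_Psi.
Unshelve. all: by end_near. Qed.

#[local] HB.instance Definition _ :=
  isCumulative.Build R _ R lim_dfun lim_dfun_nd lim_dfun_rc.

Definition lim_measure (A : set R) : \bar R := lebesgue_stieltjes_measure lim_dfun A.

Let lim_measure0 : lim_measure set0 = 0%E.
Proof. exact: measure0. Qed.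

Let lim_measure_ge0 A : (0 <= lim_measure A)%E.
Proof. exact: measure_ge0. Qed.

Let lim_measure_sigma_additive : semi_sigma_additive lim_measure.
Proof.
exact: (@measure_semi_sigma_additive _ (measurableTypeR R) R
  (lebesgue_stieltjes_measure lim_dfun)).
Qed.

#[local] HB.instance Definition _ := isMeasure.Build _ _ _ lim_measure
  lim_measure0 lim_measure_ge0 lim_measure_sigma_additive.

Lemma lim_measureNyc t : lim_measure `]-oo, t]%classic = (lim_dfun t)%:E.
Proof.
rewrite itvNybndEbigcup.
have h1 : lim_measure `]- n%:R, t]%classic @[n --> \oo] --> (lim_dfun t)%:E.
  apply: (@cvg_trans _ ((lim_dfun t)%:E @[n --> \oo])); last exact: cvg_cst.
  apply: near_eq_cvg; near=> n.
  rewrite /lim_measure /lebesgue_stieltjes_measure /measure_extension/=.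
  rewrite measurable_mu_extE/= ?wlength_itv_bnd//; last first.
  - exact: is_ocitv.
  - by rewrite lerNl; near: n; exact: nbhs_infty_ger.
  have n0 : - n%:R < 0 :> R by rewrite oppr_lt0; near: n; exact: nbhs_infty_gtr.
  by rewrite [X in _ - X](_ : _ = 0) ?subr0// /lim_dfun n0.
have h2 : lim_measure `]- n%:R, t]%classic @[n --> \oo] -->
    lim_measure (\bigcup_n `]- n%:R, t]%classic).
  apply: nondecreasing_cvg_mu => //; first exact: bigcup_measurable.
  by move=> n m nm; apply/subsetPset/subset_itv; rewrite leBSide//= lerN2 ler_nat.
exact: cvg_unique h2 h1.
Unshelve. all: by end_near. Qed.

Lemma lim_measureT : lim_measure setT = (Psi 0)%:E.
Proof.
have <- : \bigcup_n `]-oo, n%:R]%classic = [set: R].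
  apply/seteqP; split => // x _; exists (Num.truncn x).+1 => //=.
  by rewrite in_itv/= ltW// truncnS_gt.
have h2 : lim_measure `]-oo, n%:R]%classic @[n --> \oo] -->
    lim_measure (\bigcup_n `]-oo, n%:R]%classic).
  apply: nondecreasing_cvg_mu => //; first exact: bigcup_measurable.
  by move=> n m nm; apply/subsetPset; apply: subitvPr; rewrite bnd_simp ler_nat.
have h1 : lim_measure `]-oo, n%:R]%classic @[n --> \oo] --> (Psi 0)%:E.
  under eq_fun do rewrite lim_measureNyc.
  apply/cvg_EFin; first by near=> n.
  by have /cvg_pinftyP := lim_dfun_cvgy; apply; exact: cvgr_idn.
exact: cvg_unique h2 h1.
Unshelve. all: by end_near. Qed.

Lemma lim_measure_nneg : lim_measure `]-oo, 0%R[%classic = 0%E.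
Proof.
have E : `]-oo, 0%R[%classic = \bigcup_n `]-oo, (- n.+1%:R^-1)]%classic :> set R.
  apply/seteqP; split => x /=.
    rewrite in_itv/= => x0; exists (Num.truncn (- x)^-1) => //=; rewrite in_itv/=.
    rewrite lerNr -[leRHS]invrK lef_pV2 ?posrE ?invr_gt0 ?oppr_gt0//.
    by apply: ltW; exact: truncnS_gt.
  by move=> [n _] /=; rewrite !in_itv/= => /le_lt_trans; apply; rewrite oppr_lt0.
have : lim_measure.-negligible (`]-oo, 0%R[%classic : set R).
  rewrite E; apply: negligible_bigcup => n.
  exists `]-oo, (- n.+1%:R^-1)]%classic; split => //.
  by rewrite [LHS]lim_measureNyc /lim_dfun oppr_lt0 invr_gt0 ltr0n.
by move/negligibleP; apply.
Qed.

Let lim_measure_le1 : (lim_measure setT <= 1)%E.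
Proof.
rewrite lim_measureT lee_fin; apply: (cvgr_to_le (mu_Psi (lexx 0))); near=> eps.
rewrite laplace0 -lee_fin fineK ?fin_num_measure//.
apply: le_trans (@sprobability_setT _ _ _ (mu eps)).
by apply: le_measure; rewrite ?inE.
Unshelve. all: by end_near. Qed.

#[local] HB.instance Definition _ :=
  Measure_isSubProbability.Build _ _ _ lim_measure lim_measure_le1.

Theorem laplace_continuity : exists G0 : subprobability R R,
  [/\ G0 `]-oo, 0%R[%classic = 0%E,
      weak_cvg (fun eps => dfun (mu eps)) (dfun G0) &
      forall s, 0 <= s -> laplace G0 s = Psi s].
Proof.
pose G0 : subprobability R R := lim_measure.
have dG0 t : dfun G0 t = lim_dfun t by rewrite /dfun [X in fine X]lim_measureNyc.
have wc : weak_cvg (fun eps => dfun (mu eps)) (dfun G0).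
  split.
    have -> : dfun G0 = lim_dfun by apply/funext.
    move=> t ct; apply/cvgrPdist_le => h h0.
    have h2 : 0 < h / 2 by rewrite divr_gt0.
    (* The lower bound needs a strictly smaller point; left continuity at [t] gives one that loses
       only [h / 2]. *)
    have [t1 t1t At1] : exists2 t1, t1 < t & lim_dfun t - h / 2 <= lim_dfun t1.
      have lt : lim_dfun t - h / 2 < lim_dfun t by rewrite gtrBl.
      have [r /= r0 rf] := cvgr_ge (lim_dfun t) ct _ lt.
      exists (t - r / 2); first by rewrite gtrBl divr_gt0.
      apply: rf; rewrite /= opprB addrC subrK gtr0_norm ?divr_gt0//.
      by rewrite ltr_pdivrMr// ltr_pMr// ltr1n.
    near=> eps; rewrite ler_distlC; apply/andP; split.
      apply: (@le_trans _ _ (lim_dfun t1 - h / 2)); first by lra.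
      by near: eps; exact: dfun_mu_ge.
    by near: eps; exact: dfun_mu_le.
  rewrite (cvg_lim _ (@dfun_cvgy R G0))//.
  have -> : fine (G0 setT) = Psi 0 by rewrite [X in fine X]lim_measureT.
  apply: cvg_trans (mu_Psi (lexx 0)); apply: near_eq_cvg; near=> eps.
  rewrite (cvg_lim _ (@dfun_cvgy R (mu eps)))// laplace0 measure_nneg//.
  by apply: mu_nneg; near: eps; exact: near_unit.
exists G0; split => //; first exact: lim_measure_nneg.
(* The transform of [G0] is never computed: both it and [Psi s] are limits of the same
   transforms. *)
move=> s s0; apply: (cvg_unique _ _ (mu_Psi s0)) => //.
exact: (weak_cvg_laplace mu_nneg lim_measure_nneg s0 wc).
Unshelve. all: by end_near. Qed.

End laplace_continuity.

(** * Hitting times of a Markov renewal process *)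

Lemma in_setb T (A : set T) (b : bool) x : (A x <-> b) -> b = (x \in A).
Proof. by case: b => h; [rewrite mem_set//; exact/h|rewrite memNset// => /h]. Qed.

Section markov_paths.
Context {R : realType} {X : finType} (Z : markov_renewal R X).
Local Notation P := (mr_prob Z).
Local Notation eta := (@Defs.eta R X Z).
Local Notation kappa := (Defs.kappa Z).

Lemma mr_QE i j B : mr_Q Z i j B = P i (eta 1 @^-1` [set j] `&` kappa 1 @^-1` B).
Proof. by rewrite /mr_Q /pushforward /mrestr setIC. Qed.

Lemma mr_Q_le1 i j B : measurable B -> (mr_Q Z i j B <= 1)%E.
Proof.
move=> mB; rewrite mr_QE; apply: probability_le1; apply: measurableI.
  exact: measurable_eta.
by rewrite -[X in measurable X]setTI; exact: measurable_funP.
Qed.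

Lemma mr_Q_fin i j B : measurable B -> mr_Q Z i j B \is a fin_num.
Proof.
move=> mB; rewrite ge0_fin_numE ?measure_ge0//.
exact: le_lt_trans (mr_Q_le1 i j mB) (ltry 1).
Qed.

Lemma mr_pE i j : (mr_p Z i j)%:E = mr_Q Z i j setT.
Proof. by rewrite /mr_p fineK// mr_Q_fin. Qed.

Lemma mr_p_ge0 i j : 0 <= mr_p Z i j.
Proof. by rewrite -lee_fin mr_pE measure_ge0. Qed.

Lemma mr_FE i j B : mr_F Z i j B =
  if (mr_Q Z i j setT == 0%E) || (mr_Q Z i j setT == +oo%E) then \d_(0 : R) B
  else (mr_Q Z i j B * ((mr_p Z i j)^-1)%:E)%E.
Proof. by rewrite /mr_F /= /mnormalize /=; case: ifP. Qed.

(** It also holds when [p_ij = 0]: the default Dirac mass in [mr_F] is then multiplied by 0. *)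
Lemma mr_Q_mr_F i j B : measurable B -> mr_Q Z i j B = ((mr_p Z i j)%:E * mr_F Z i j B)%E.
Proof.
move=> mB; rewrite mr_FE mr_pE.
case: ifPn => [/orP[/eqP p0|/eqP py]|/norP[p0 py]].
- rewrite p0 mul0e; apply/eqP; rewrite eq_le measure_ge0 andbT -p0.
  by apply: le_measure; rewrite ?inE.
- by have := mr_Q_fin i j (@measurableT _ R); rewrite py.
- rewrite muleCA -{1}mr_pE -EFinM divff ?mule1//.
  by rewrite -eqe mr_pE.
Qed.

Lemma mr_F_nneg i j : mr_F Z i j `]-oo, 0%R[%classic = 0%E.
Proof.
rewrite mr_FE; case: ifPn => _.
  by rewrite diracE memNset//= in_itv/= ltxx.
rewrite mr_QE (_ : _ `&` _ = set0) ?measure0 ?mul0e//.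
apply/seteqP; split => // w [_] /=; rewrite in_itv/=.
by apply/negP; rewrite -leNgt kappa_ge0.
Qed.

Lemma mr_step i j t :
  P i (eta 1 @^-1` [set j] `&` kappa 1 @^-1` `]-oo, t]%classic) =
  (mr_p Z i j * dfun (mr_F Z i j) t)%:E.
Proof. by rewrite -mr_QE mr_Q_mr_F// dfunE EFinM. Qed.

Definition mr_q (s : R) (i j : X) : R := mr_p Z i j * laplace (mr_F Z i j) s.

Lemma measurable_etaE n j : measurable_fun [set: mr_space Z] (fun w => (eta n w == j)%:R : R).
Proof.
have -> : (fun w => (eta n w == j)%:R) = \1_(eta n @^-1` [set j]) :> (mr_space Z -> R).
  apply/funext => w; rewrite indicE; congr (nat_of_bool _)%:R; apply: in_setb.
  by split => [->|/eqP].
by apply: measurable_indic; exact: measurable_eta.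
Qed.

Lemma integral_eta i n j : (\int[P i]_w ((eta n w == j)%:R)%:E = P i (eta n @^-1` [set j]))%E.
Proof.
rewrite -[in RHS](setIT (eta n @^-1` [set j])) -integral_indic//; last exact: measurable_eta.
by apply: eq_integral => w _; rewrite indicE; congr (nat_of_bool _)%:R%:E;
   apply: in_setb; split => [->|/eqP].
Qed.

Lemma sum_mr_p i : \sum_j mr_p Z i j = 1.
Proof.
apply: EFin_inj; rewrite -sumEFin -(probability_setT (P i)).
under eq_bigr do rewrite mr_pE mr_QE preimage_setT setIT -integral_eta.
rewrite -ge0_integral_sum//; last first.
  by move=> j; apply/measurable_EFinP; exact: measurable_etaE.
rewrite -[RHS]mul1e -integral_cst//; apply: eq_integral => w _.
rewrite sumEFin; congr EFin; rewrite (bigD1 (eta 1 w))//= eqxx big1 ?addr0//.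
by move=> j; rewrite eq_sym => /negbTE ->.
Qed.

Lemma measurable_kappa_le n t :
  measurable_fun [set: mr_space Z] (fun w => (kappa n w <= t)%R%:R : R).
Proof.
have -> : (fun w => (kappa n w <= t)%R%:R) =
    \1_(kappa n @^-1` `]-oo, t]%classic) :> (mr_space Z -> R).
  apply/funext => w; rewrite indicE; congr (nat_of_bool _)%:R; apply: in_setb.
  by rewrite /= in_itv.
by apply: measurable_indic; rewrite -[X in measurable X]setTI; exact: measurable_funP.
Qed.

Lemma measurable_exp_kappa s n :
  measurable_fun [set: mr_space Z] (fun w => expR (- (s * kappa n w))).
Proof.
by apply: (@measurableT_comp _ _ _ _ _ _ (fun t => expR (- (s * t)))) => //; exact: measurable_expRN.
Qed.

(** Iterated Markov property, with the indicators gathered into the single event [H n] to which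
    [mr_markov] applies. *)
Lemma path_prob i (x : nat -> X) (t : nat -> R) n : x 0%N = i ->
  (\int[P i]_w (\prod_(0 <= l < n.+1) (eta l w == x l)%:R *
     \prod_(1 <= l < n.+1) (kappa l w <= t l)%R%:R)%:E =
   (\prod_(1 <= l < n.+1) (mr_p Z (x l.-1) (x l) * dfun (mr_F Z (x l.-1) (x l)) (t l)))%:E)%E.
Proof.
move=> x0i.
(* [kappa 0] is not part of the hitting time, so it is left unconstrained. *)
pose B (l : nat) : set R := if l is 0 then setT else `]-oo, t l]%classic.
have mB l : measurable (B l).
  by case: l => [|l]; [exact: measurableT|exact: measurable_itv].
pose H n := \bigcap_(m in [set m | (m <= n)%N]) (eta m @^-1` [set x m] `&` kappa m @^-1` B m).
have mEl l : measurable (eta l @^-1` [set x l] `&` kappa l @^-1` B l).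
  apply: measurableI; first exact: measurable_eta.
  by rewrite -[X in measurable X]setTI; exact: measurable_funP.
have H0 : H 0%N = eta 0 @^-1` [set x 0%N].
  apply/seteqP; split => w; first by move=> /(_ 0%N) /= []//.
  by move=> /= ew m /=; rewrite leqn0 => /eqP ->.
have HS m : H m.+1 = H m `&` (eta m.+1 @^-1` [set x m.+1] `&` kappa m.+1 @^-1` B m.+1).
  apply/seteqP; split => w.
    move=> Hw; split; last exact: (Hw m.+1 (leqnn _)).
    by move=> l /= lm; apply: Hw => /=; exact: leqW.
  move=> [Hw Hw1] l /=; rewrite leq_eqVlt => /predU1P[->//|]; rewrite ltnS; exact: Hw.
have mH m : measurable (H m).
  elim: m => [|m IH]; first by rewrite H0; exact: measurable_eta.
  by rewrite HS; exact: measurableI.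
have indE m w : \prod_(0 <= l < m.+1) (eta l w == x l)%:R *
    \prod_(1 <= l < m.+1) (kappa l w <= t l)%R%:R = \1_(H m) w :> R.
  elim: m => [|m IH].
    rewrite big_nat1 big_geq// mulr1 H0 indicE; congr (nat_of_bool _)%:R; apply: in_setb.
    by split => [->|/eqP].
  rewrite big_nat_recr//= [X in _ * X]big_nat_recr//= HS indicI /= -IH mulrACA; congr (_ * _).
  rewrite indicI /= !indicE; congr ((nat_of_bool _)%:R * (nat_of_bool _)%:R); apply: in_setb.
    by split => [->|/eqP].
  by rewrite /= in_itv.
under eq_integral do rewrite indE.
rewrite integral_indic// setIT.
elim: n => [|n IH].
  by rewrite big_geq// H0 x0i; exact: mr_init.
rewrite HS; apply: eq_trans (@mr_markov _ _ Z i n x B (x n.+1) (t n.+1) mB) _.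
by rewrite [X in (X * _)%E]IH [X in (_ * X)%E]mr_step [in RHS]big_nat_recr.
Qed.

(* The indicators [kappa_l <= t_l] are replaced by exponentials one at a time. *)
Lemma path_laplace_aux i (x : nat -> X) s m n (t : nat -> R) : 0 <= s -> x 0%N = i -> (m <= n)%N ->
  (\int[P i]_w (\prod_(0 <= l < n.+1) (eta l w == x l)%:R *
     (\prod_(1 <= l < m.+1) expR (- (s * kappa l w)) *
      \prod_(m.+1 <= l < n.+1) (kappa l w <= t l)%R%:R))%:E =
   (\prod_(1 <= l < m.+1) mr_q s (x l.-1) (x l) *
    \prod_(m.+1 <= l < n.+1) (mr_p Z (x l.-1) (x l) * dfun (mr_F Z (x l.-1) (x l)) (t l)))%:E)%E.
Proof.
move=> s0 x0i; elim: m t => [|m IH] t mn.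
  rewrite [in RHS]big_geq// mul1r -(path_prob t n x0i).
  by apply: eq_integral => w _; rewrite [X in _ * (X * _)]big_geq// mul1r.
(* [g] holds every factor except the one of [kappa m.+1], and [C] is the constant multiplying the
   distribution function of that sojourn; [transfer_laplace] exchanges the latter for its
   transform. *)
pose g w : R := \prod_(0 <= l < n.+1) (eta l w == x l)%:R *
     (\prod_(1 <= l < m.+1) expR (- (s * kappa l w)) *
      \prod_(m.+2 <= l < n.+1) (kappa l w <= t l)%R%:R).
pose C : R := \prod_(1 <= l < m.+1) mr_q s (x l.-1) (x l) * (mr_p Z (x m) (x m.+1) *
  \prod_(m.+2 <= l < n.+1) (mr_p Z (x l.-1) (x l) * dfun (mr_F Z (x l.-1) (x l)) (t l))).
have mg : measurable_fun setT g.
  apply: measurable_funM; last apply: measurable_funM.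
  - by apply: measurable_prod => l _; exact: measurable_etaE.
  - by apply: measurable_prod => l _; exact: measurable_exp_kappa.
  - by apply: measurable_prod => l _; exact: measurable_kappa_le.
have g0 w : 0 <= g w.
  by rewrite !mulr_ge0// prodr_ge0// => l _; rewrite ?expR_ge0.
have C0 : 0 <= C.
  rewrite !mulr_ge0 ?mr_p_ge0// prodr_ge0// => l _; rewrite mulr_ge0 ?mr_p_ge0 ?dfun_ge0//.
  exact: laplace_ge0.
transitivity (\int[P i]_w (g w * expR (- (s * kappa m.+1 w)))%:E)%E.
  apply: eq_integral => w _; congr EFin.
  by rewrite /g [in LHS](big_nat_recr m.+1)//=; ring.
have mn' : (m < n.+1)%N by rewrite ltnS ltnW.
rewrite (@transfer_laplace _ _ _ (P i) g (kappa m.+1) (mr_F Z (x m) (x m.+1)) C)//.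
- by congr EFin; rewrite /C [in RHS](big_nat_recr m.+1)//= /mr_q; ring.
- exact: mr_F_nneg.
(* The induction hypothesis is used for every threshold of [kappa m.+1], which gives the whole
   distribution function required by the transfer. *)
move=> t'; pose t1 l := if l == m.+1 then t' else t l.
have E w : \prod_(m.+1 <= l < n.+1) (kappa l w <= t1 l)%R%:R =
    (kappa m.+1 w <= t')%R%:R * \prod_(m.+2 <= l < n.+1) (kappa l w <= t l)%R%:R :> R.
  rewrite big_ltn//; congr (_ * _); first by rewrite /t1 eqxx.
  by apply: eq_big_nat => l /andP[lm _]; rewrite /t1 gtn_eqF.
transitivity (\int[P i]_w (\prod_(0 <= l < n.+1) (eta l w == x l)%:R *
     (\prod_(1 <= l < m.+1) expR (- (s * kappa l w)) *
      \prod_(m.+1 <= l < n.+1) (kappa l w <= t1 l)%R%:R))%:E)%E.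
  rewrite integral_mkcond; apply: eq_integral => w _; rewrite patchE E.
  case: ifPn => [|]; rewrite ?notin_setE ?inE/= => kt.
    by rewrite kt mul1r.
  by rewrite (negbTE (introN idP kt)) mul0r !mulr0.
rewrite IH ?(ltnW mn)//; congr EFin.
rewrite /C [X in _ * X](@big_ltn _ _ _ m.+1)//= /t1 eqxx.
rewrite (_ : \prod_(m.+2 <= l < n.+1) _ = \prod_(m.+2 <= l < n.+1)
  (mr_p Z (x l.-1) (x l) * dfun (mr_F Z (x l.-1) (x l)) (t l))); first by ring.
by apply: eq_big_nat => l /andP[lm _]; rewrite gtn_eqF.
Qed.

Definition path_fun (x : nat -> X) s m w : R :=
  \prod_(0 <= l < m.+1) (eta l w == x l)%:R * \prod_(1 <= l < m.+1) expR (- (s * kappa l w)).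

Lemma path_laplace i x s m : 0 <= s -> x 0%N = i ->
  (\int[P i]_w (path_fun x s m w)%:E = (\prod_(1 <= l < m.+1) mr_q s (x l.-1) (x l))%:E)%E.
Proof.
move=> s0 x0i; have := path_laplace_aux (fun=> 0) s0 x0i (leqnn m).
rewrite [X in _ = (_ * X)%:E -> _]big_geq// mulr1 => <-.
by apply: eq_integral => w _; rewrite [X in (_ * (_ * X))%:E]big_geq// mulr1.
Qed.

Variable D : {set X}.

(** The discounted indicator that, after time [m], the path makes [n] steps outside [D] and then one
    to [j]. The start [m] is a parameter because the Markov property conditions on the complete
    past, which is carried separately by [path_fun]. *)
Fixpoint future (s : R) (m n : nat) (j : X) (w : mr_space Z) : R :=
  if n is n'.+1 then
    \sum_(y in ~: D) (eta m.+1 w == y)%:R * expR (- (s * kappa m.+1 w)) * future s m.+1 n' j w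
  else (eta m.+1 w == j)%:R * expR (- (s * kappa m.+1 w)).

Fixpoint hit_q (s : R) (n : nat) (i j : X) : R :=
  if n is n'.+1 then \sum_(y in ~: D) mr_q s i y * hit_q s n' y j else mr_q s i j.

Lemma future_ge0 s m n j w : 0 <= future s m n j w.
Proof.
elim: n m => [|n IH] m /=; first by rewrite mulr_ge0 ?expR_ge0.
by apply: sumr_ge0 => y _; rewrite !mulr_ge0 ?expR_ge0.
Qed.

Lemma measurable_future s m n j : measurable_fun setT (future s m n j).
Proof.
elim: n m => [|n IH] m /=.
  by apply: measurable_funM; [exact: measurable_etaE|exact: measurable_exp_kappa].
under eq_fun do rewrite big_mkcond/=.
apply: measurable_sum => y; case: (y \in ~: D) => //; apply: measurable_funM => //.
by apply: measurable_funM; [exact: measurable_etaE|exact: measurable_exp_kappa].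
Qed.

Definition upd (x : nat -> X) m y l := if l == m then y else x l.

Lemma path_fun_upd x s m y w : path_fun x s m w *
  ((eta m.+1 w == y)%:R * expR (- (s * kappa m.+1 w))) = path_fun (upd x m.+1 y) s m.+1 w.
Proof.
rewrite /path_fun [in RHS]big_nat_recr//= [X in _ = _ * X]big_nat_recr//= {2}/upd eqxx.
rewrite mulrACA; congr (_ * _ * _).
by apply: eq_big_nat => l /= lm; rewrite /upd ltn_eqF.
Qed.

Lemma path_fun_ge0 x s m w : 0 <= path_fun x s m w.
Proof. by rewrite mulr_ge0// prodr_ge0// => l _; rewrite ?expR_ge0. Qed.

Lemma measurable_path_fun x s m : measurable_fun setT (path_fun x s m).
Proof.
apply: measurable_funM; apply: measurable_prod => l _.
  exact: measurable_etaE.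
exact: measurable_exp_kappa.
Qed.

Lemma prod_upd x s m y : \prod_(1 <= l < m.+2) mr_q s (upd x m.+1 y l.-1) (upd x m.+1 y l) =
  \prod_(1 <= l < m.+1) mr_q s (x l.-1) (x l) * mr_q s (x m) y.
Proof.
rewrite big_nat_recr//= /upd eqxx ltn_eqF//; congr (_ * _).
apply: eq_big_nat => l /andP[l0 lm]; rewrite !ltn_eqF//.
by rewrite (leq_ltn_trans (leq_pred _)).
Qed.

(** Each summand of the next step is absorbed into the past by extending the prescribed path, so the
    induction on [n] must leave [m] and [x] free. *)
Lemma future_laplace i x s m n j : 0 <= s -> x 0%N = i ->
  (\int[P i]_w (path_fun x s m w * future s m n j w)%:E =
   (\prod_(1 <= l < m.+1) mr_q s (x l.-1) (x l) * hit_q s n (x m) j)%:E)%E.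
Proof.
move=> s0 x0i; elim: n m x x0i => [|n IH] m x x0i /=.
  under eq_integral do rewrite path_fun_upd.
  by rewrite path_laplace// prod_upd.
under eq_integral do rewrite mulr_sumr big_mkcond/= -sumEFin.
rewrite ge0_integral_sum//; last 2 first.
- move=> y; case: (y \in ~: D) => //; apply/measurable_EFinP.
  apply: measurable_funM; first exact: measurable_path_fun.
  apply: measurable_funM; last exact: measurable_future.
  by apply: measurable_funM; [exact: measurable_etaE|exact: measurable_exp_kappa].
- move=> y w _; case: (y \in ~: D) => //.
  by rewrite lee_fin mulr_ge0 ?path_fun_ge0// mulr_ge0 ?future_ge0// mulr_ge0 ?expR_ge0.
rewrite mulr_sumr [in RHS]big_mkcond -sumEFin; apply: eq_bigr => y _.
case: (y \in ~: D); last by rewrite integral0.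
under eq_integral do rewrite mulrA path_fun_upd.
by rewrite IH// prod_upd /upd eqxx mulrA.
Qed.

Lemma mr_q_ge0 s i j : 0 <= mr_q s i j.
Proof. by rewrite mulr_ge0 ?mr_p_ge0// laplace_ge0. Qed.

Lemma hit_q_ge0 s n i j : 0 <= hit_q s n i j.
Proof.
elim: n i => [|n IH] i /=; first exact: mr_q_ge0.
by apply: sumr_ge0 => y _; rewrite mulr_ge0// mr_q_ge0.
Qed.

(** For [j] in [D] this is the event that the first visit to [D] is at time [n.+1] and in [j]; the
    index counts the steps spent outside [D]. *)
Definition hit_ind n j w :=
  all (fun l => eta l w \notin D) (iota 1 n) && (eta n.+1 w == j).

Definition hit_time n w : R := \sum_(1 <= l < n.+2) kappa l w.

Lemma future_hit s n j w :
  future s 0 n j w = (hit_ind n j w)%:R * expR (- (s * hit_time n w)).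
Proof.
rewrite /hit_ind /hit_time.
suff H m : future s m n j w =
    (all (fun l => eta l w \notin D) (iota m.+1 n) && (eta (m + n).+1 w == j))%:R *
    expR (- (s * \sum_(m.+1 <= l < (m + n).+2) kappa l w)) by exact: (H 0%N).
elim: n m => [|n IH] m /=; first by rewrite addn0 big_nat1.
rewrite IH addSnnS [in RHS]big_ltn; last by rewrite ltnS ltnS leq_addr.
rewrite -!mulr_suml.
have -> : \sum_(y in ~: D) (eta m.+1 w == y)%:R = (eta m.+1 w \notin D)%:R :> R.
  have [eD|eD] := boolP (eta m.+1 w \in D).
    rewrite big1// => y; rewrite inE; case: eqP => // <-.
    by rewrite eD.
  rewrite (bigD1 (eta m.+1 w)) ?inE//= eqxx big1 ?addr0// => y /andP[_].
  by rewrite eq_sym => /negbTE ->.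
by rewrite -andbA -[in RHS]mulnb natrM mulrDr opprD expRD mulrACA.
Qed.

Lemma measurable_hit_time n : measurable_fun setT (hit_time n).
Proof. by apply: measurable_sum => l; exact: measurable_funP. Qed.

Lemma measurable_hit_indR n j : measurable_fun setT (fun w => (hit_ind n j w)%:R : R).
Proof.
have := measurable_future 0 0 n j; congr measurable_fun; apply/funext => w.
by rewrite future_hit mul0r oppr0 expR0 mulr1.
Qed.

Lemma measurable_hit_ind n j : measurable [set w | hit_ind n j w].
Proof.
have -> : [set w | hit_ind n j w] = (fun w => (hit_ind n j w)%:R : R) @^-1` [set 1].
  apply/seteqP; split => w /=; first by move=> ->.
  by case: (hit_ind n j w) => // /esym/eqP; rewrite oner_eq0.
by rewrite -[X in measurable X]setTI; apply: measurable_hit_indR.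
Qed.

Lemma hit_nuP n j w : j \in D -> hit_ind n j w <-> hit_nu D w = Some n.+1 /\ eta n.+1 w = j.
Proof.
move=> jD; rewrite /hit_nu; case: pselect => [h|nh]; last first.
  split => [/andP[_ /eqP e]|[]//]; exfalso; apply: nh; exists n.+1.
  by rewrite e jD.
case: ex_minnP => k /andP[k1 kD] kmin; split.
  move=> /andP[/allP al /eqP e]; split => //; congr Some.
  apply/eqP; rewrite eqn_leq kmin ?e//= ltnNge; apply/negP => kn.
  by move: (al k); rewrite mem_iota k1/= add1n ltnS kn kD => /(_ isT).
move=> [[kE] e]; rewrite /hit_ind e eqxx andbT; apply/allP => l.
rewrite mem_iota add1n => /andP[l1 ln]; apply/negP => lD.
by have := kmin l; rewrite l1 lD kE leqNgt ln => /(_ isT).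
Qed.

(** * The law of the hitting time as a sum over the number of steps *)

Section hit_measure.
Variables (i j : X).

Definition hit_part n : set R -> \bar R :=
  pushforward (mrestr (P i) (measurable_hit_ind n j)) (hit_time n).

Section hit_part_measure.
Variable n : nat.

Let hit_part0 : hit_part n set0 = 0%E.
Proof. by rewrite /hit_part /pushforward preimage_set0 measure0. Qed.

Let hit_part_ge0 B : (0 <= hit_part n B)%E.
Proof. by rewrite /hit_part /pushforward; exact: measure_ge0. Qed.

Let hit_part_sigma_additive : semi_sigma_additive (hit_part n).
Proof.
by apply: measure_semi_sigma_additive; exact: measurable_hit_time.
Qed.

HB.instance Definition _ := isMeasure.Build _ _ _ (hit_part n)
  hit_part0 hit_part_ge0 hit_part_sigma_additive.

Lemma hit_partE B : hit_part n B = P i ([set w | hit_ind n j w] `&` hit_time n @^-1` B).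
Proof. by rewrite /hit_part /pushforward /mrestr setIC. Qed.

Let hit_part_le1 : (hit_part n setT <= 1)%E.
Proof.
by rewrite hit_partE preimage_setT setIT; apply: probability_le1; exact: measurable_hit_ind.
Qed.

HB.instance Definition _ := Measure_isSubProbability.Build _ _ _ (hit_part n) hit_part_le1.

Lemma hit_part_nneg : hit_part n `]-oo, 0%R[%classic = 0%E.
Proof.
rewrite hit_partE (_ : _ `&` _ = set0) ?measure0//.
apply/seteqP; split => // w [_] /=; rewrite in_itv/=.
by apply/negP; rewrite -leNgt sumr_ge0// => l _; exact: kappa_ge0.
Qed.

(** [transfer_laplace] with the weight [hit_ind] turns the transform into an expectation under
    [P i], which [future_laplace] evaluates with the trivial past [m = 0]. *)
Lemma laplace_hit_part s : 0 <= s -> laplace (hit_part n) s = hit_q s n i j.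
Proof.
move=> s0; apply: EFin_inj.
have T t : (\int[P i]_(w in [set w | hit_time n w <= t]%R) ((hit_ind n j w)%:R)%:E =
    (1 * dfun (hit_part n) t)%:E)%E.
  rewrite mul1r -dfunE [RHS]hit_partE.
  have -> : hit_time n @^-1` `]-oo, t]%classic = [set w | hit_time n w <= t].
    by apply/seteqP; split => w /=; rewrite in_itv.
  rewrite -integral_indic//; last first.
  - exact: measurable_hit_ind.
  - have -> : [set w | hit_time n w <= t] = hit_time n @^-1` `]-oo, t]%classic.
      by apply/seteqP; split => w /=; rewrite in_itv.
    by rewrite -[X in measurable X]setTI; exact: measurable_hit_time.
  apply: eq_integral => w _; rewrite indicE; congr (nat_of_bool _)%:R%:E.
  exact: in_setb.
have := transfer_laplace (measurable_hit_indR n j) (measurable_hit_time n)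
  (fun w => ler0n _ _) ler01 hit_part_nneg T s0.
rewrite mul1r => <-.
have := @future_laplace i (fun=> i) s 0 n j s0 erefl; rewrite big_geq// mul1r => <-.
apply: ge0_ae_eq_integral => //.
- apply/measurable_EFinP; apply: measurable_funM; first exact: measurable_hit_indR.
  apply: (@measurableT_comp _ _ _ _ _ _ (fun t => expR (- (s * t)))) => //.
    exact: measurable_expRN.
  exact: measurable_hit_time.
- apply/measurable_EFinP; apply: measurable_funM; last exact: measurable_future.
  exact: measurable_path_fun.
- by move=> w _; rewrite lee_fin mulr_ge0 ?path_fun_ge0 ?future_ge0.
(* The past at [m = 0] is the indicator of [eta 0 = i], equal to 1 only almost surely. *)
exists (~` (eta 0 @^-1` [set i])); split.
- by apply: measurableC; exact: measurable_eta.
- rewrite [LHS]probability_setC; last exact: measurable_eta.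
  by rewrite [X in (_ - X)%E]mr_init subee.
- move=> w /= /not_implyP[_ nw] e0; apply: nw.
  by rewrite future_hit /path_fun big_nat1 big_geq// e0 eqxx !mul1r.
Qed.

End hit_part_measure.

Definition hit_measure : set R -> \bar R :=
  mseries (fun n => hit_part n : {measure set R -> \bar R}) 0.

HB.instance Definition _ := Measure.on hit_measure.

Lemma hit_measureE B : hit_measure B =
  (\sum_(0 <= n <oo) P i ([set w | hit_ind n j w] `&` hit_time n @^-1` B))%E.
Proof.
by rewrite /hit_measure /mseries; apply: eq_eseriesr => n _; exact: hit_partE.
Qed.

Hypothesis jD : j \in D.

Lemma hit_measure_bigcup B : measurable B -> hit_measure B =
  P i (\bigcup_n ([set w | hit_ind n j w] `&` hit_time n @^-1` B)).
Proof.
move=> mB; have mA n : measurable ([set w | hit_ind n j w] `&` hit_time n @^-1` B).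
  apply: measurableI; first exact: measurable_hit_ind.
  by rewrite -[X in measurable X]setTI; exact: measurable_hit_time.
rewrite hit_measureE measure_semi_bigcup//; last exact: bigcup_measurable.
apply/trivIsetP => n m _ _ nm; apply/seteqP; split => // w [[/= hn _] [hm _]].
move: hn => /(hit_nuP _ _ jD) [hn _]; move: hm => /(hit_nuP _ _ jD) [hm _].
by move: nm; rewrite hn in hm; case: hm => ->; rewrite eqxx.
Qed.

Lemma hit_measure_le1 : (hit_measure setT <= 1)%E.
Proof.
rewrite hit_measure_bigcup//; apply: probability_le1; apply: bigcup_measurable => n _.
by rewrite preimage_setT setIT; exact: measurable_hit_ind.
Qed.

Lemma hit_measure_nneg : hit_measure `]-oo, 0%R[%classic = 0%E.
Proof.
rewrite hit_measureE eseries0// => n _ _; rewrite -hit_partE; exact: hit_part_nneg.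
Qed.

Lemma dfun_hit_measure t : dfun hit_measure t = hit_G Z D i j t.
Proof.
rewrite /dfun hit_measure_bigcup// /hit_G; congr (fine (P i _)).
apply/seteqP; split => w /=.
  move=> [n _ [/= /(hit_nuP _ _ jD) [hn e]]]; rewrite in_itv/= => ht; split.
    by rewrite /hit_tau hn lee_fin.
  by exists n.+1.
move=> [+ [n hn e]]; rewrite /hit_tau hn lee_fin => ht.
case: n hn e ht => [|n] hn e ht.
  (* The hitting time is at least 1, so the value [Some 0] cannot occur. *)
  move: hn; rewrite /hit_nu; case: pselect => // h []; case: ex_minnP => k /andP[k1 _] _ k0.
  by rewrite k0 in k1.
exists n => //; split; last by rewrite /= in_itv.
exact/(hit_nuP _ _ jD).
Qed.

Lemma laplace_hit_measure s : 0 <= s ->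
  ((laplace hit_measure s)%:E = \sum_(0 <= n <oo) (hit_q s n i j)%:E)%E.
Proof.
move=> s0; rewrite /laplace fineK.
  rewrite ge0_integral_measure_series//.
  - apply: eq_eseriesr => n _; rewrite -laplace_hit_part// /laplace fineK//.
    by apply: integrable_fin_num => //; exact: integrable_expRN.
  - by apply/measurable_EFinP; apply: measurable_funTS; exact: measurable_expRN.
rewrite ge0_fin_numE; last by apply: integral_ge0 => t _; rewrite lee_fin expR_ge0.
apply: (@le_lt_trans _ _ (\int[hit_measure]_(t in `[0%R, +oo[) (cst 1%E t))%E).
  apply: ge0_le_integral => //.
  - by apply/measurable_EFinP; apply: measurable_funTS; exact: measurable_expRN.
  - move=> t /=; rewrite in_itv/= andbT => t0.
    by rewrite lee_fin -[leRHS]expR0 ler_expR oppr_le0 mulr_ge0.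
rewrite integral_cst// mul1e (le_lt_trans _ (ltry 1))//.
apply: le_trans hit_measure_le1; apply: le_measure; rewrite ?inE//.
Qed.

End hit_measure.

(** First-step analysis read off from the recursion of [hit_q]: the term [n = 0] is the direct step,
    and nonnegativity allows the remaining series to be exchanged with the sum over [y]. *)
Lemma laplace_hit_eq s i j : 0 <= s -> j \in D ->
  laplace (hit_measure i j) s =
  mr_q s i j + \sum_(y in ~: D) mr_q s i y * laplace (hit_measure y j) s.
Proof.
move=> s0 jD; apply: EFin_inj; rewrite laplace_hit_measure//.
rewrite nneseries_recl//; last by move=> n _; rewrite lee_fin hit_q_ge0.
rewrite EFinD; congr (_ + _)%E.
rewrite -nneseries_addn; last first.
  by move=> n; rewrite lee_fin hit_q_ge0.
rewrite -sumEFin; under eq_eseriesr do rewrite addn1 /= -sumEFin.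
rewrite nneseries_sum; last by move=> y n _; rewrite lee_fin mulr_ge0 ?mr_q_ge0 ?hit_q_ge0.
apply: eq_bigr => y _; under eq_eseriesr do rewrite EFinM.
rewrite nneseriesZl; last by move=> n _; rewrite lee_fin hit_q_ge0.
by rewrite [RHS]EFinM (laplace_hit_measure y jD s0).
Qed.

End markov_paths.

(** * Exclusion of states *)

Section enumeration.
Context {X : finType} (k : nat -> X) (D : {set X}).
Local Notation m := #|~: D|.
Hypothesis k_enum : perm_eq [seq k n | n <- iota 1 m] (enum (~: D)).

Lemma X_levS n j : (j \in X_lev k n.+1) = (j != k n.+1) && (j \in X_lev k n).
Proof.
have E : iota 1 n.+1 = rcons (iota 1 n) n.+1.
  by have := iotaD 1 n 1; rewrite addn1 add1n /= cats1.
by rewrite /X_lev !finset.in_set E map_rcons mem_rcons in_cons negb_or.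
Qed.

Lemma Dbar_levS n i : (i \in Dbar_lev k D n.+1) = (i != k n.+1) && (i \in Dbar_lev k D n).
Proof. by rewrite inE [in RHS]inE X_levS andbCA. Qed.

Lemma Dbar_levW n i : i \in Dbar_lev k D n.+1 -> i \in Dbar_lev k D n.
Proof. by rewrite Dbar_levS => /andP[]. Qed.

Lemma X_levW n i : i \in X_lev k n.+1 -> i \in X_lev k n.
Proof. by rewrite X_levS => /andP[]. Qed.

Lemma Dbar_lev0 : Dbar_lev k D 0 = ~: D.
Proof. by apply/setP => i; rewrite !inE andbT. Qed.

Lemma Dbar_X_lev n i : i \in Dbar_lev k D n -> i \in X_lev k n.
Proof. by rewrite inE => /andP[]. Qed.

Lemma Dbar_notin n i : i \in Dbar_lev k D n -> i \in ~: D.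
Proof. by rewrite inE => /andP[]. Qed.

Lemma uniq_k : uniq [seq k n | n <- iota 1 m].
Proof. by rewrite (perm_uniq k_enum) enum_uniq. Qed.

Lemma k_inj a b : (0 < a <= m)%N -> (0 < b <= m)%N -> k a = k b -> a = b.
Proof.
move=> /andP[a0 am] /andP[b0 bm] kab.
have sz : size (iota 1 m) = m by rewrite size_iota.
have nthk n : (0 < n <= m)%N -> nth (k a) [seq k n | n <- iota 1 m] n.-1 = k n.
  by case: n => //= n nm; rewrite (nth_map 0%N) ?sz// nth_iota// add1n.
have := nth_uniq (k a) _ _ uniq_k; rewrite size_map sz => /(_ a.-1 b.-1).
rewrite !nthk ?a0 ?b0// kab eqxx; case: a b a0 am b0 bm {kab nthk} => [//|a] [//|b] _ am _ bm /=.
by move=> /(_ am bm) /esym/eqP ->.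
Qed.

Lemma k_notin n : (0 < n <= m)%N -> k n \in ~: D.
Proof.
move=> /andP[n0 nm]; rewrite -mem_enum -(perm_mem k_enum); apply: map_f.
by rewrite mem_iota n0 add1n ltnS.
Qed.

Lemma k_Dbar n l : (n < l <= m)%N -> k l \in Dbar_lev k D n.
Proof.
move=> /andP[nl lm]; rewrite !inE.
have := @k_notin l; rewrite (leq_ltn_trans _ nl)//= lm inE => /(_ isT) -> /=.
apply/negP => /mapP[j]; rewrite mem_iota add1n ltnS => /andP[j0 jn] kj.
have lj : l = j.
  apply: k_inj => //; first by rewrite lm (leq_ltn_trans _ nl).
  by rewrite j0 (leq_trans jn)// ltnW// (leq_trans nl).
by move: nl; rewrite lj ltnNge jn.
Qed.

Lemma D_X_lev n j : (n <= m)%N -> j \in D -> j \in X_lev k n.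
Proof.
move=> nm jD; rewrite inE; apply/negP => /mapP[l]; rewrite mem_iota add1n ltnS.
move=> /andP[l0 ln] jl; have := @k_notin l; rewrite l0 (leq_trans ln nm) -jl inE jD.
by move=> /(_ isT).
Qed.

Lemma Dbar_lev_full i : i \in Dbar_lev k D m = false.
Proof.
apply/negP; rewrite !inE => /andP[iD]; rewrite (perm_mem k_enum) mem_enum inE.
by rewrite iD.
Qed.

End enumeration.

Section levels.
Context {R : realType} {X : finType} (k : nat -> X) (D : {set X}).
Local Notation m := #|~: D|.
Hypothesis k_enum : perm_eq [seq k n | n <- iota 1 m] (enum (~: D)).

(** No nonempty set of remaining states outside [D] is closed. This replaces the chain condition,
    since it passes to the next level without rebuilding chains. *)
Definition exits (p : X -> X -> R) n := forall S : {set X}, S \subset Dbar_lev k D n ->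
  S != finset.set0 -> exists i j, [/\ i \in S, j \in X_lev k n, j \notin S & 0 < p_lev k p n i j].

Record regular (p : X -> X -> R) n : Prop := Regular {
  reg_ge0 : forall i j, i \in Dbar_lev k D n -> j \in X_lev k n -> 0 <= p_lev k p n i j;
  reg_sum : forall i, i \in Dbar_lev k D n -> \sum_(j in X_lev k n) p_lev k p n i j <= 1;
  reg_exit : exits p n }.

Section one_kernel.
Variables (p : X -> X -> R) (n : nat).
Hypothesis reg : regular p n.
Local Notation pn := (p_lev k p n).
Local Notation ptn := (pt_lev k p n).

(** Apply the exit property to the singleton of [i]: some other state receives positive mass, and
    the row sum is at most 1. *)
Lemma reg_lt1 i : i \in Dbar_lev k D n -> pn i i < 1.
Proof.
move=> iD; have iX := Dbar_X_lev iD.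
have [||i' [j []]] := @reg_exit _ _ reg [set i]%SET.
- by apply/fintype.subsetP => x; rewrite inE => /eqP ->.
- by apply/set0Pn; exists i; rewrite inE.
rewrite inE => /eqP -> jX; rewrite inE => ji pij.
have := reg_sum reg iD; rewrite (bigD1 i)//= (bigD1 j)/= ?jX ?ji//.
have : 0 <= \sum_(l in X_lev k n | (l != i) && (l != j)) pn i l.
  by apply: sumr_ge0 => l /andP[lX _]; exact: (reg_ge0 reg).
under [in X in _ + (_ + X)]eq_bigl do rewrite -andbA.
by lra.
Qed.

Lemma reg_den_gt0 i : i \in Dbar_lev k D n -> 0 < 1 - pn i i.
Proof. by move=> iD; rewrite subr_gt0 reg_lt1. Qed.

Lemma pt_ge0 i j : i \in Dbar_lev k D n -> j \in X_lev k n -> 0 <= ptn i j.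
Proof.
move=> iD jX; rewrite /pt_lev /loop_free; case: ifP => // _.
by rewrite divr_ge0 ?(reg_ge0 reg)// ltW// reg_den_gt0.
Qed.

Lemma pt_gt0 i j : i \in Dbar_lev k D n -> j \in X_lev k n ->
  (0 < ptn i j) = (j != i) && (0 < pn i j).
Proof.
move=> iD jX; rewrite /pt_lev /loop_free; case: ifP => _ /=; last by rewrite ltxx.
by rewrite pmulr_lgt0// invr_gt0 reg_den_gt0.
Qed.

Lemma pt_sum i : i \in Dbar_lev k D n -> \sum_(j in X_lev k n) ptn i j <= 1.
Proof.
move=> iD; have iX := Dbar_X_lev iD.
rewrite (bigD1 i)//= {1}/pt_lev /loop_free eqxx add0r.
rewrite (eq_bigr (fun j => pn i j / (1 - pn i i))); last first.
  by move=> j /andP[_ ji]; rewrite /pt_lev /loop_free ji.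
rewrite -mulr_suml ler_pdivrMr ?reg_den_gt0// mul1r lerBrDl.
by have := reg_sum reg iD; rewrite (bigD1 i).
Qed.

Hypothesis nm : (n < m)%N.
Local Notation kk := (k n.+1).

Lemma kk_Dbar : kk \in Dbar_lev k D n.
Proof. by apply: k_Dbar => //; rewrite ltnSn. Qed.

Lemma p_levS i j : p_lev k p n.+1 i j = ptn i j + ptn i kk * ptn kk j.
Proof. by []. Qed.

Lemma p_levS_gt0 i j : i \in Dbar_lev k D n -> j \in X_lev k n ->
  (0 < p_lev k p n.+1 i j) = (0 < ptn i j) || ((0 < ptn i kk) && (0 < ptn kk j)).
Proof.
move=> iD jX; rewrite p_levS.
have a0 := pt_ge0 iD jX; have b0 := pt_ge0 iD (Dbar_X_lev kk_Dbar).
have c0 := pt_ge0 kk_Dbar jX.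
have [a|] := ltP 0 (ptn i j); first by rewrite /= ltr_pwDl// mulr_ge0.
move=> a1; have -> : ptn i j = 0 by apply/eqP; rewrite eq_le a1.
rewrite add0r /=; have [b|] := ltP 0 (ptn i kk); first by rewrite pmulr_rgt0.
by move=> b1; have -> : ptn i kk = 0; [apply/eqP; rewrite eq_le b1|rewrite mul0r ltxx].
Qed.

(** For the row sums, the mass sent to the excluded state is redistributed along a row of total at
    most 1. *)
Lemma regularS : regular p n.+1.
Proof.
split.
- move=> i j /Dbar_levW iD /X_levW jX; rewrite p_levS addr_ge0 ?pt_ge0//.
  by rewrite mulr_ge0 ?pt_ge0 ?(Dbar_X_lev kk_Dbar) ?kk_Dbar.
- move=> i iD'; have iD := Dbar_levW iD'; have kX := Dbar_X_lev kk_Dbar.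
  have XE (f : X -> R) : \sum_(j in X_lev k n) f j = f kk + \sum_(j in X_lev k n.+1) f j.
    rewrite (bigD1 kk)//=; congr (_ + _); apply: eq_bigl => j.
    by rewrite X_levS andbC.
  rewrite big_split/= -mulr_sumr.
  apply: le_trans (pt_sum iD); rewrite XE addrC lerD2r ler_piMr ?pt_ge0//.
  apply: le_trans (pt_sum kk_Dbar); rewrite XE lerDr pt_ge0//.
  exact: kk_Dbar.
- move=> S SD S0.
  have SDn : S \subset Dbar_lev k D n.
    by apply/fintype.subsetP => x /(fintype.subsetP SD); exact: Dbar_levW.
  have kS : kk \notin S.
    by apply/negP => /(fintype.subsetP SD); rewrite Dbar_levS eqxx.
  have [i [j [iS jX jS pij]]] := reg_exit reg SDn S0.
  have iD := fintype.subsetP SDn i iS.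
  have ji : j != i by apply: contraNneq jS => ->.
  have ptij : 0 < ptn i j by rewrite pt_gt0// ji.
  have [jk|jk] := eqVneq j kk; last first.
    by exists i, j; split => //; [rewrite X_levS jk|rewrite p_levS_gt0// ptij].
  subst j.
  (* The exit found leads to the excluded state, so the set enlarged by that state is used. If its
     exit starts at the excluded state, the two steps form a detour from [i]; otherwise the new exit
     is already direct. *)
  have [||a [b [aS bX bS pab]]] := @reg_exit _ _ reg (kk |: S).
  - by rewrite finset.subUset SDn andbT; apply/fintype.subsetP => x; rewrite inE => /eqP ->; exact: kk_Dbar.
  - by apply/set0Pn; exists kk; rewrite !inE eqxx.
  have bk : b != kk by apply: contraNneq bS => ->; rewrite !inE eqxx.
  have bS' : b \notin S by apply: contraNN bS => bS; rewrite !inE bS orbT.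
  have bX' : b \in X_lev k n.+1 by rewrite X_levS bk.
  move: aS; rewrite !inE => /predU1P[ak|aS].
    subst a; exists i, b; split => //; rewrite p_levS_gt0// ptij.
    by rewrite [X in _ || X](_ : _ = true) ?orbT//= pt_gt0 ?kk_Dbar// bk.
  have aD := fintype.subsetP SDn a aS.
  have ba : b != a by apply: contraNneq bS' => ->.
  by exists a, b; split => //; rewrite p_levS_gt0// pt_gt0// ba pab.
Qed.

End one_kernel.

Lemma regular_lev p n : regular p 0 -> (n <= m)%N -> regular p n.
Proof.
move=> r0; elim: n => [//|n IH] nm.
by apply: regularS => //; apply: IH; exact: ltnW.
Qed.

(** The zero pattern of a level depends only on that of the original kernel, so the sets [Y_lev]
    read off at [eps = 1] serve every [eps]. *)
Lemma support_lev p p' n i j : regular p 0 -> regular p' 0 ->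
  (forall i j, i \in ~: D -> (0 < p i j) = (0 < p' i j)) ->
  (n <= m)%N -> i \in Dbar_lev k D n -> j \in X_lev k n ->
  (0 < p_lev k p n i j) = (0 < p_lev k p' n i j).
Proof.
move=> r r' pp'; elim: n i j => [|n IH] i j nm iD jX.
  by apply: pp'; exact: Dbar_notin iD.
have rn := regular_lev r (ltnW nm); have rn' := regular_lev r' (ltnW nm).
have {}iD := Dbar_levW iD; have {}jX := X_levW jX.
have kD := kk_Dbar nm; have kX := Dbar_X_lev kD.
by rewrite !p_levS_gt0// !pt_gt0// !IH// ltnW.
Qed.

Lemma v_lev_gt0 p v n i : regular p 0 -> (forall i, i \in ~: D -> 0 < v i) ->
  (n <= m)%N -> i \in Dbar_lev k D n -> 0 < v_lev k p v n i.
Proof.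
move=> r v0; elim: n => [|n IH] nm iD /=; first by apply: v0; exact: Dbar_notin iD.
have {}iD := Dbar_levW iD; have rn := regular_lev r (ltnW nm).
by rewrite divr_gt0 ?IH ?(ltnW nm)// (reg_den_gt0 rn).
Qed.

Section transforms_at_level.
Variables (p : X -> X -> R) (phi : X -> X -> R -> R) (e : X -> X -> R).

Definition phit_of n (f : X -> X -> R -> R) i j s : R :=
  (1 - p_lev k p n i i) * f i j s / (1 - p_lev k p n i i * f i i s).

(** One formula covers the three cases of the limit recursion: where a route is missing, [qh_lev] is
    0 or 1 and the meaningless transform has coefficient 0. Time is not rescaled here, so both legs
    of a detour have the same argument. *)
Fixpoint phi_lev n : X -> X -> R -> R :=
  if n is n'.+1 then fun i j s =>
    let ft := phit_of n' (phi_lev n') in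
    let q := qh_lev k p n i j in
    q * ft i j s + (1 - q) * (ft i (k n) s * ft (k n) j s)
  else phi.

Definition et_of n (f : X -> X -> R) i j : R :=
  f i j + p_lev k p n i i / (1 - p_lev k p n i i) * f i i.

Fixpoint e_lev n : X -> X -> R :=
  if n is n'.+1 then fun i j =>
    let ft := et_of n' (e_lev n') in
    let q := qh_lev k p n i j in
    q * ft i j + (1 - q) * (ft i (k n) + ft (k n) j)
  else e.

Hypothesis r : regular p 0.

Lemma pt_lev_phi s n i j : (n < m)%N -> i \in Dbar_lev k D n ->
  (forall j, j \in X_lev k n ->
    p_lev k (fun i j => p i j * phi i j s) n i j = p_lev k p n i j * phi_lev n i j s) ->
  j \in X_lev k n ->
  pt_lev k (fun i j => p i j * phi i j s) n i j =
  pt_lev k p n i j * phit_of n (phi_lev n) i j s.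
Proof.
move=> nm iD H jX; have rn := regular_lev r (ltnW nm).
rewrite /pt_lev /loop_free; case: ifP => _; last by rewrite mul0r.
rewrite (H j)// (H i) ?(Dbar_X_lev iD)// /phit_of [RHS]mulrA; congr (_ / _).
by field; rewrite gt_eqF// (reg_den_gt0 rn).
Qed.

(** Eliminating states from the discounted kernel [p phi] yields the level-[n] probabilities times
    the level-[n] transforms; this is how the recursion for laws is obtained from linear algebra. *)
Lemma p_lev_phi s n i j : (n <= m)%N -> i \in Dbar_lev k D n -> j \in X_lev k n ->
  p_lev k (fun i j => p i j * phi i j s) n i j = p_lev k p n i j * phi_lev n i j s.
Proof.
elim: n i j => [//|n IH] i j nm iD jX.
have rn := regular_lev r (ltnW nm).
have {}iD := Dbar_levW iD; have {}jX := X_levW jX.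
have kD := kk_Dbar nm; have kX := Dbar_X_lev kD.
have H i' j' : i' \in Dbar_lev k D n -> j' \in X_lev k n ->
    p_lev k (fun i j => p i j * phi i j s) n i' j' = p_lev k p n i' j' * phi_lev n i' j' s.
  by move=> iD' jX'; apply: IH => //; exact: ltnW.
rewrite p_levS !pt_lev_phi//; try by move=> j'; exact: H.
rewrite /= -/(p_lev k p n.+1 i j) /qh_lev /=.
set a := pt_lev k p n i j; set b := pt_lev k p n i _; set c := pt_lev k p n _ j.
have a0 : 0 <= a by exact: (pt_ge0 rn).
have b0 : 0 <= b by exact: (pt_ge0 rn).
have c0 : 0 <= c by exact: (pt_ge0 rn).
have bc0 : 0 <= b * c by rewrite mulr_ge0.
rewrite (_ : loop_free (p_lev k p n) i j = a)// (_ : loop_free (p_lev k p n) i _ = b)//.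
rewrite (_ : loop_free (p_lev k p n) _ j = c)//.
(* If [p_lev k p n.+1 i j = 0] then [qh_lev] is a division by 0; both routes have probability 0 and
   both sides vanish. *)
have [z|z] := eqVneq (a + b * c) 0; last by field.
have a1 : a = 0 by lra.
have bc1 : b * c = 0 by lra.
by rewrite z a1 !mul0r add0r mulrACA bc1 mul0r.
Qed.

Lemma qh_01 n i j : (n < m)%N -> i \in Dbar_lev k D n -> j \in X_lev k n ->
  0 <= qh_lev k p n.+1 i j <= 1.
Proof.
move=> nm iD jX; have rn := regular_lev r (ltnW nm).
have kD := kk_Dbar nm; have kX := Dbar_X_lev kD.
rewrite /qh_lev p_levS /=.
have a0 := pt_ge0 rn iD jX; have bc0 := mulr_ge0 (pt_ge0 rn iD kX) (pt_ge0 rn kD jX).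
have [->|z] := eqVneq (pt_lev k p n i j + pt_lev k p n i (k n.+1) * pt_lev k p n (k n.+1) j) 0.
  by rewrite invr0 mulr0 lexx ler01.
rewrite divr_ge0 ?addr_ge0//= ler_pdivrMr ?mul1r ?lerDl//.
by rewrite lt0r z addr_ge0.
Qed.

End transforms_at_level.

Lemma big_Dbar_lev n (f : X -> R) : (n < m)%N -> \sum_(y in Dbar_lev k D n) f y =
  f (k n.+1) + \sum_(y in Dbar_lev k D n.+1) f y.
Proof.
move=> nm; rewrite (bigD1 (k n.+1)) ?kk_Dbar//=; congr (_ + _); apply: eq_bigl => y.
by rewrite Dbar_levS andbC.
Qed.

Section elimination.
Variables (q : X -> X -> R) (h : X -> R) (j : X).
Hypothesis jD : j \in D.
Hypothesis den : forall n i, (n < m)%N -> i \in Dbar_lev k D n -> 1 - p_lev k q n i i != 0.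
Hypothesis hE : forall i, i \in ~: D -> h i = q i j + \sum_(y in ~: D) q i y * h y.

Lemma eliminate_loop n i : (n < m)%N -> i \in Dbar_lev k D n ->
  h i = p_lev k q n i j + \sum_(y in Dbar_lev k D n) p_lev k q n i y * h y ->
  h i = pt_lev k q n i j + \sum_(y in Dbar_lev k D n) pt_lev k q n i y * h y.
Proof.
move=> nm iD H; have d := den nm iD.
have ji : j != i.
  by apply: contraTneq jD => ->; have := Dbar_notin iD; rewrite inE.
apply: (mulIf d); rewrite mulrBr mulr1 mulrDl mulr_suml.
rewrite {1}/pt_lev /loop_free ji divfK// (bigD1 i)//= {1}/pt_lev /loop_free eqxx !mul0r add0r.
rewrite {1}H (bigD1 i)//=.
rewrite [in RHS](eq_bigr (fun y => p_lev k q n i y * h y)); first by ring.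
by move=> y /andP[_ yi]; rewrite /pt_lev /loop_free yi mulrAC divfK.
Qed.

(* Gaussian elimination of the states [k 1], ..., [k n] from the hitting system. *)
Lemma eliminate n i : (n <= m)%N -> i \in Dbar_lev k D n ->
  h i = p_lev k q n i j + \sum_(y in Dbar_lev k D n) p_lev k q n i y * h y.
Proof.
elim: n i => [|n IH] i nm iD.
  by rewrite Dbar_lev0 in iD *; exact: hE.
have hn l : l \in Dbar_lev k D n ->
    h l = pt_lev k q n l j + \sum_(y in Dbar_lev k D n) pt_lev k q n l y * h y.
  by move=> lD; apply: eliminate_loop => //; apply: IH => //; exact: ltnW.
have kD := kk_Dbar nm; have iD' := Dbar_levW iD.
have kk0 : pt_lev k q n (k n.+1) (k n.+1) = 0 by rewrite /pt_lev /loop_free eqxx.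
rewrite (hn _ iD') (big_Dbar_lev _ nm) (hn _ kD) (big_Dbar_lev _ nm) kk0 mul0r add0r.
rewrite [in RHS](eq_bigr (fun y => pt_lev k q n i y * h y +
  pt_lev k q n i (k n.+1) * (pt_lev k q n (k n.+1) y * h y))); last first.
  by move=> y _; rewrite p_levS mulrDl mulrA.
by rewrite p_levS big_split/= -mulr_sumr; ring.
Qed.

Lemma eliminate_pt n i : (n < m)%N -> i \in Dbar_lev k D n ->
  h i = pt_lev k q n i j + \sum_(y in Dbar_lev k D n) pt_lev k q n i y * h y.
Proof.
by move=> nm iD; apply: eliminate_loop => //; apply: eliminate => //; exact: ltnW.
Qed.

End elimination.

(** * Passage to the limit along the levels *)

Section level_convergence.
Variables (p : R -> X -> X -> R) (phi : R -> X -> X -> R -> R) (e : R -> X -> X -> R)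
  (v : R -> X -> R) (p0 : X -> X -> R) (pt0 qh0 : nat -> X -> X -> R)
  (w0 : nat -> X -> X -> \bar R) (F0 : X -> X -> probability R R).
Hypothesis p_regular : forall eps, 0 < eps <= 1 -> regular (p eps) 0.
Hypothesis p_support : forall eps i j, 0 < eps <= 1 -> i \in ~: D ->
  (0 < p eps i j) = (0 < p 1 i j).
Hypothesis v_gt0 : forall eps i, 0 < eps <= 1 -> i \in ~: D -> 0 < v eps i.
Hypothesis hC : forall i j, i \in ~: D -> p eps i j @[eps --> 0^'+] --> p0 i j.
Hypothesis phi_cvg : forall i j, i \in ~: D -> 0 < p 1 i j ->
  tr_cvg (fun eps s => phi eps i j (s / v eps i)) (fun eps => e eps i j / v eps i)
         (laplace (F0 i j)) (fine (mean (F0 i j))).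
Hypothesis h_i : forall (n : nat) (i j : X), (n < m)%N ->
  i \in Dbar_lev k D n -> j \in X_lev k n ->
  pt_lev k (p eps) n i j @[eps --> 0^'+] --> pt0 n i j.
Hypothesis h_ii : forall (n : nat) (i j : X), (1 <= n < m)%N ->
  i \in Dbar_lev k D n -> j \in Y_lev k (p 1) n i ->
  0 <= qh0 n i j <= 1 /\ qh_lev k (p eps) n i j @[eps --> 0^'+] --> qh0 n i j.
Hypothesis h_iii : forall (n : nat) (i : X), (n.+1 < m)%N -> i \in Dbar_lev k D n ->
  vt_lev k (p eps) (v eps) n (k n.+1) / vt_lev k (p eps) (v eps) n i @[eps --> 0^'+]
    --> fine (w0 n (k n.+1) i).

Local Notation phi0 := (phi0_lev k (p 1) p0 pt0 qh0 w0 F0).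
Local Notation e0 := (e0_lev k (p 1) p0 pt0 qh0 w0 F0).
Local Notation phi_eps eps := (phi_lev (p eps) (phi eps)).
Local Notation e_eps eps := (e_lev (p eps) (e eps)).

Lemma one_unit : 0 < (1 : R) <= 1.
Proof. by rewrite ltr01 lexx. Qed.

Lemma reg_n eps n : 0 < eps <= 1 -> (n <= m)%N -> regular (p eps) n.
Proof. by move=> he; apply: regular_lev; exact: p_regular. Qed.

Lemma supp_n eps n i j : 0 < eps <= 1 -> (n <= m)%N -> i \in Dbar_lev k D n ->
  j \in X_lev k n -> (0 < p_lev k (p eps) n i j) = (0 < p_lev k (p 1) n i j).
Proof.
move=> he nm iD jX; apply: support_lev => //; try exact: p_regular.
  by apply: p_regular; exact: one_unit.
by move=> i' j'; exact: p_support.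
Qed.

Lemma p_lev_eq0 eps n i j : 0 < eps <= 1 -> (n <= m)%N -> i \in Dbar_lev k D n ->
  j \in X_lev k n -> j \notin Y_lev k (p 1) n i -> p_lev k (p eps) n i j = 0.
Proof.
move=> he nm iD jX; rewrite inE jX/= -(supp_n he nm iD jX) -leNgt => p_le0.
by apply/eqP; rewrite eq_le p_le0 (reg_ge0 (reg_n he nm)).
Qed.

Lemma Yt_pt eps n i j : 0 < eps <= 1 -> (n <= m)%N -> i \in Dbar_lev k D n ->
  j \in X_lev k n -> (j \in Yt_lev k (p 1) n i) = (0 < pt_lev k (p eps) n i j).
Proof.
move=> he nm iD jX; rewrite (pt_gt0 (reg_n he nm) iD jX) (supp_n he nm iD jX).
by rewrite in_setD1 inE jX.
Qed.

Lemma Yt_pt0 eps n i j : 0 < eps <= 1 -> (n <= m)%N -> i \in Dbar_lev k D n ->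
  j \in X_lev k n -> j \notin Yt_lev k (p 1) n i -> pt_lev k (p eps) n i j = 0.
Proof.
move=> he nm iD jX; rewrite (Yt_pt he nm iD jX) -leNgt => p_le0.
by apply/eqP; rewrite eq_le p_le0 (pt_ge0 (reg_n he nm)).
Qed.

Lemma p_lev_cvg n i j : (n <= m)%N -> i \in Dbar_lev k D n -> j \in X_lev k n ->
  p_lev k (p eps) n i j @[eps --> 0^'+] --> p0_lev k p0 pt0 n i j.
Proof.
case: n => [|n] nm iD jX; first by apply: hC; exact: Dbar_notin iD.
have {}iD := Dbar_levW iD; have {}jX := X_levW jX.
have kD := kk_Dbar nm; have kX := Dbar_X_lev kD.
by apply: cvgD; [exact: h_i|apply: cvgM; exact: h_i].
Qed.

Lemma vt_gt0 eps n i : 0 < eps <= 1 -> (n < m)%N -> i \in Dbar_lev k D n ->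
  0 < vt_lev k (p eps) (v eps) n i.
Proof.
move=> he nm iD; rewrite divr_gt0//.
  apply: v_lev_gt0 => //; [exact: p_regular|by move=> i'; exact: v_gt0|exact: ltnW].
by apply: (reg_den_gt0 (reg_n he (ltnW nm))).
Qed.

Definition cvg_lev n := forall i j, i \in Dbar_lev k D n -> j \in Y_lev k (p 1) n i ->
  tr_cvg (fun eps s => phi_eps eps n i j (s / v_lev k (p eps) (v eps) n i))
         (fun eps => e_eps eps n i j / v_lev k (p eps) (v eps) n i) (phi0 n i j) (e0 n i j).

Definition cvgt_lev n := forall i j, i \in Dbar_lev k D n -> j \in Yt_lev k (p 1) n i ->
  tr_cvg (fun eps s => phit_of (p eps) n (phi_eps eps n) i j (s / vt_lev k (p eps) (v eps) n i))
         (fun eps => et_of (p eps) n (e_eps eps n) i j / vt_lev k (p eps) (v eps) n i)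
         (phit_step k (p 1) p0 pt0 qh0 w0 F0 n (phi0 n) i j)
         (et_step k (p 1) p0 pt0 n (e0 n) i j).

(** With a loop this is [trc_geom], because [vt_lev] is [v_lev] divided by [1 - p_ii]. Without one,
    [p_ii = 0] for every [eps] and the step is the identity. *)
Lemma cvgt_of_cvg n : (n < m)%N -> cvg_lev n -> cvgt_lev n.
Proof.
move=> nm H i j iD; rewrite in_setD1 => /andP[ji jY].
have iX := Dbar_X_lev iD; rewrite /phit_step /et_step.
case: ifPn => [iY|/negPn iY].
  have p_eq0 eps : 0 < eps <= 1 -> p_lev k (p eps) n i i = 0.
    by move=> he; apply: p_lev_eq0 => //; exact: ltnW.
  apply: trc_eq (H i j iD jY) => // [eps s|eps] he => [_|];
    by rewrite /vt_lev /phit_of /et_of p_eq0// subr0 !divr1 ?mul0r ?subr0 ?addr0 ?mul1r ?divr1.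
have p01 eps : 0 < eps <= 1 -> 0 <= p_lev k (p eps) n i i < 1.
  move=> he; rewrite (reg_ge0 (reg_n he (ltnW nm)))//=.
  exact: (reg_lt1 (reg_n he (ltnW nm))).
have pc := p_lev_cvg (ltnW nm) iD iX.
have := trc_geom p01 pc (H i j iD jY) (H i i iD iY).
apply: trc_eq => // [eps s he s0|eps he].
  have -> : s / vt_lev k (p eps) (v eps) n i =
      (1 - p_lev k (p eps) n i i) * s / v_lev k (p eps) (v eps) n i.
    by rewrite /vt_lev invf_div mulrA (mulrC s).
  by [].
rewrite /et_of /vt_lev; field.
rewrite !gt_eqF//; last by rewrite subr_gt0; have /andP[] := p01 _ he.
by apply: v_lev_gt0 => //; [exact: p_regular|by move=> i'; exact: v_gt0|exact: ltnW].
Qed.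

Lemma cvg_of_cvgt n : (n.+1 < m)%N -> cvgt_lev n -> cvg_lev n.+1.
Proof.
move=> nm H i j iD1 jY.
have nm' := ltnW nm; have nm'' := ltnW nm'.
have iD := Dbar_levW iD1; have kD := kk_Dbar nm'; have kX := Dbar_X_lev kD.
have jX1 : j \in X_lev k n.+1 by move: jY; rewrite inE => /andP[].
have jX := X_levW jX1.
have pij eps : 0 < eps <= 1 -> 0 < p_lev k (p eps) n.+1 i j.
  by move=> he; rewrite (supp_n he nm' iD1 jX1); move: jY; rewrite inE => /andP[].
set w := fine (w0 n (k n.+1) i).
have wc := h_iii nm iD; rewrite -/w in wc.
(* The second leg converges on the scale of the excluded state but is read on that of [i]; the ratio
   of the two scales tends to [w], whence the argument [w * s]. *)
have detour : k n.+1 \in Yt_lev k (p 1) n i -> j \in Yt_lev k (p 1) n (k n.+1) ->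
  tr_cvg (fun eps s =>
      phit_of (p eps) n (phi_eps eps n) i (k n.+1) (s / vt_lev k (p eps) (v eps) n i) *
      phit_of (p eps) n (phi_eps eps n) (k n.+1) j (s / vt_lev k (p eps) (v eps) n i))
    (fun eps => (et_of (p eps) n (e_eps eps n) i (k n.+1) +
       et_of (p eps) n (e_eps eps n) (k n.+1) j) / vt_lev k (p eps) (v eps) n i)
    (fun s => phit_step k (p 1) p0 pt0 qh0 w0 F0 n (phi0 n) i (k n.+1) s *
       phit_step k (p 1) p0 pt0 qh0 w0 F0 n (phi0 n) (k n.+1) j (w * s))
    (et_step k (p 1) p0 pt0 n (e0 n) i (k n.+1) +
       w * et_step k (p 1) p0 pt0 n (e0 n) (k n.+1) j).
  move=> kY jkY.
  have c_ge0 eps : 0 < eps <= 1 -> 0 <= vt_lev k (p eps) (v eps) n (k n.+1) /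
      vt_lev k (p eps) (v eps) n i.
    by move=> he; rewrite divr_ge0// ltW// vt_gt0.
  have := trc_mul (H _ _ iD kY) (trc_scale (H _ _ kD jkY) c_ge0 wc).
  apply: trc_eq => // [eps s he s0|eps he].
    congr (_ * phit_of _ _ _ _ _ _); field.
    by rewrite !gt_eqF// vt_gt0.
  by field; rewrite !gt_eqF// vt_gt0.
have [jYt|jYt] := boolP (j \in Yt_lev k (p 1) n i); last first.
  (* Without a direct step the mixture weight is 0 for every [eps], and positivity of the new
     transition probability forces both legs of the detour to exist. *)
  have q0 eps : 0 < eps <= 1 -> qh_lev k (p eps) n.+1 i j = 0.
    by move=> he; rewrite /qh_lev /= (Yt_pt0 he nm'' iD jX jYt) mul0r.
  have : (k n.+1 \in Yt_lev k (p 1) n i) && (j \in Yt_lev k (p 1) n (k n.+1)).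
    have := pij 1 one_unit; rewrite (p_levS_gt0 (reg_n one_unit nm'') nm')//.
    by rewrite -!(Yt_pt one_unit)// (negbTE jYt).
  move=> /andP[kY jkY]; have := detour kY jkY.
  apply: trc_eq => [eps s he s0|eps he|s|].
  - by rewrite /= q0// mul0r add0r subr0 mul1r.
  - by rewrite /= q0// mul0r add0r subr0 mul1r.
  - by rewrite /= /phi_step (negbTE jYt).
  - by rewrite /= /e_step (negbTE jYt).
have [/andP[kY jkY]|nkY] :=
    boolP ((k n.+1 \in Yt_lev k (p 1) n i) && (j \in Yt_lev k (p 1) n (k n.+1))); last first.
  (* Without a complete detour the mixture weight is 1 for every [eps]. *)
  have q1 eps : 0 < eps <= 1 -> qh_lev k (p eps) n.+1 i j = 1.
    move=> he; rewrite /qh_lev p_levS /=.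
    have z : pt_lev k (p eps) n i (k n.+1) * pt_lev k (p eps) n (k n.+1) j = 0.
      by move: nkY; rewrite negb_and => /orP[] /(Yt_pt0 he nm'') ->//; rewrite ?mul0r ?mulr0.
    by rewrite z addr0 divff// gt_eqF// -(Yt_pt he nm'' iD jX).
  have := H i j iD jYt; apply: trc_eq => [eps s he s0|eps he|s|].
  - by rewrite /= q1// subrr mul0r addr0 mul1r.
  - by rewrite /= q1// subrr mul0r addr0 mul1r.
  - by rewrite /= /phi_step jYt (negbTE nkY).
  - by rewrite /= /e_step jYt (negbTE nkY).
have [|q01 qc] := @h_ii n.+1 i j _ iD1 jY; first by rewrite nm.
have q01e eps : 0 < eps <= 1 -> 0 <= qh_lev k (p eps) n.+1 i j <= 1.
  by move=> he; apply: (qh_01 (p_regular he)).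
have := trc_mix q01e q01 qc (H i j iD jYt) (detour kY jkY).
apply: trc_eq => [eps s he s0|eps he|s|].
- by [].
- by rewrite /= mulrA mulrA -mulrDl.
- by rewrite /= /phi_step jYt kY jkY.
- by rewrite /= /e_step jYt kY jkY.
Qed.

Lemma cvg_levP n : (n < m)%N -> cvg_lev n.
Proof.
elim: n => [|n IH] nm.
  move=> i j iD; rewrite inE => /andP[_ pij].
  by apply: phi_cvg => //; exact: Dbar_notin iD.
by apply: cvg_of_cvgt => //; apply: cvgt_of_cvg; [|apply: IH]; exact: ltnW.
Qed.

Lemma cvgt_levP n : (n < m)%N -> cvgt_lev n.
Proof. by move=> nm; apply: cvgt_of_cvg => //; exact: cvg_levP. Qed.

Local Notation phit_eps eps n := (phit_of (p eps) n (phi_eps eps n)).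
Local Notation phit0 := (phit0_lev k (p 1) p0 pt0 qh0 w0 F0).

Lemma pt0_eq0 n i j : (n < m)%N -> i \in Dbar_lev k D n -> j \in X_lev k n ->
  j \notin Yt_lev k (p 1) n i -> pt0 n i j = 0.
Proof.
move=> nm iD jX jY; apply: (cvg_unique _ (h_i nm iD jX)) => //.
apply: (@cvg_trans _ ((0 : R) @[eps --> (0:R)^'+])); last exact: cvg_cst.
apply: near_eq_cvg; near=> eps; apply/esym; apply: Yt_pt0 => //; last exact: ltnW.
by near: eps; exact: near_unit.
Unshelve. all: by end_near. Qed.

(** [c] is a normalisation common to all terms of an equation, and [rho] compares the own scale of
    [i] with it. Outside [Yt_lev] no convergence of transforms is known, but the probability is 0
    there. *)
Lemma term_cvg n i j (c : R -> R) (rho s : R) : (n < m)%N -> i \in Dbar_lev k D n ->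
  j \in X_lev k n -> (forall eps, 0 < eps <= 1 -> 0 < c eps) ->
  vt_lev k (p eps) (v eps) n i / c eps @[eps --> 0^'+] --> rho -> 0 <= s ->
  pt_lev k (p eps) n i j * phit_eps eps n i j (s / c eps) @[eps --> 0^'+] -->
  phit0 n i j (rho * s) * pt0 n i j.
Proof.
move=> nm iD jX c0 vc s0; rewrite mulrC.
have [jY|jY] := boolP (j \in Yt_lev k (p 1) n i); last first.
  rewrite (pt0_eq0 nm iD jX jY) mul0r.
  apply: (@cvg_trans _ ((0 : R) @[eps --> (0:R)^'+])); last exact: cvg_cst.
  apply: near_eq_cvg; near=> eps; rewrite (@Yt_pt0 eps n i j) ?mul0r ?(ltnW nm)//.
  by near: eps; exact: near_unit.
apply: cvgM; first exact: h_i.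
have u0 eps : 0 < eps <= 1 -> 0 <= vt_lev k (p eps) (v eps) n i / c eps * s.
  by move=> he; rewrite mulr_ge0// divr_ge0// ltW ?c0 ?vt_gt0.
have uc : vt_lev k (p eps) (v eps) n i / c eps * s @[eps --> 0^'+] --> rho * s.
  exact: cvgMr_tmp.
apply: cvg_trans (trc_cont (cvgt_levP nm iD jY) u0 uc).
apply: near_eq_cvg; near=> eps; congr phit_of.
have he : 0 < eps <= 1 by near: eps; exact: near_unit.
by field; rewrite !gt_eqF ?c0 ?vt_gt0.
Unshelve. all: by end_near. Qed.

Lemma term_cont n i j rho : (n < m)%N -> i \in Dbar_lev k D n -> j \in X_lev k n -> 0 <= rho ->
  phit0 n i j (rho * s) * pt0 n i j @[s --> 0^'+] --> phit0 n i j (rho * 0) * pt0 n i j.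
Proof.
move=> nm iD jX r0; have [jY|jY] := boolP (j \in Yt_lev k (p 1) n i); last first.
  rewrite (pt0_eq0 nm iD jX jY) mulr0; under eq_fun do rewrite mulr0.
  exact: cvg_cst.
apply: cvgMr_tmp; have tr := tr_scale (trc_lim (cvgt_levP nm iD jY)) r0.
have := tr_cvg0 tr; have := tr0 tr; rewrite /phit0_lev => ->.
exact.
Qed.

Lemma phi_lev_le1 eps n i j s : 0 < eps <= 1 -> (n < m)%N -> i \in Dbar_lev k D n ->
  j \in Y_lev k (p 1) n i -> 0 <= s -> phi_eps eps n i j s <= 1.
Proof.
move=> he nm iD jY s0.
have v0 : 0 < v_lev k (p eps) (v eps) n i.
  by apply: v_lev_gt0 => //; [exact: p_regular|by move=> i'; exact: v_gt0|exact: ltnW].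
have := tr_le1 (trc_tr (cvg_levP nm iD jY) he) (_ : 0 <= s * v_lev k (p eps) (v eps) n i).
by rewrite mulfK ?gt_eqF//; apply; rewrite mulr_ge0// ltW.
Qed.

Lemma phit_01 eps n i j s : 0 < eps <= 1 -> (n < m)%N -> i \in Dbar_lev k D n ->
  j \in Yt_lev k (p 1) n i -> 0 <= s -> 0 <= phit_eps eps n i j s <= 1.
Proof.
move=> he nm iD jY s0; have v0 := vt_gt0 he nm iD.
have sv0 : 0 <= s * vt_lev k (p eps) (v eps) n i by rewrite mulr_ge0// ltW.
have tr := trc_tr (cvgt_levP nm iD jY) he.
have := tr_le1 tr sv0; have := tr_ge0 tr sv0.
by rewrite mulfK ?gt_eqF// => -> ->.
Qed.

Section hitting.
Variables (j : X) (h : R -> X -> R -> R).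
Hypothesis jD : j \in D.
Hypothesis hE : forall eps s i, 0 < eps <= 1 -> 0 <= s -> i \in ~: D ->
  h eps i s = p eps i j * phi eps i j s + \sum_(y in ~: D) p eps i y * phi eps i y s * h eps y s.
Hypothesis h01 : forall eps s i, 0 < eps <= 1 -> 0 <= s -> 0 <= h eps i s <= 1.

(** Elimination at fixed [s]; the pivots do not vanish because a transform is at most 1 and
    [p_ii < 1]. *)
Lemma hit_level eps s n i : 0 < eps <= 1 -> 0 <= s -> (n < m)%N -> i \in Dbar_lev k D n ->
  h eps i s = pt_lev k (p eps) n i j * phit_eps eps n i j s +
    \sum_(y in Dbar_lev k D n) pt_lev k (p eps) n i y * phit_eps eps n i y s * h eps y s.
Proof.
move=> he s0 nm iD.
have pE l i' j' : (l < m)%N -> i' \in Dbar_lev k D l -> j' \in X_lev k l ->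
    p_lev k (fun i j => p eps i j * phi eps i j s) l i' j' =
    p_lev k (p eps) l i' j' * phi_eps eps l i' j' s.
  by move=> lm iD' jX'; apply: p_lev_phi => //; [exact: p_regular|exact: ltnW].
have den l i' : (l < m)%N -> i' \in Dbar_lev k D l ->
    1 - p_lev k (fun i j => p eps i j * phi eps i j s) l i' i' != 0.
  move=> lm iD'; have iX' := Dbar_X_lev iD'; rewrite pE//.
  have [iY|iY] := boolP (i' \in Y_lev k (p 1) l i'); last first.
    by rewrite (p_lev_eq0 he (ltnW lm) iD' iX' iY) mul0r subr0 oner_eq0.
  have rl := reg_n he (ltnW lm).
  rewrite gt_eqF// subr_gt0 (le_lt_trans _ (reg_lt1 rl iD'))//.
  by rewrite ler_piMr ?(reg_ge0 rl)// phi_lev_le1.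
have ptE y : y \in X_lev k n -> pt_lev k (fun i j => p eps i j * phi eps i j s) n i y =
    pt_lev k (p eps) n i y * phit_eps eps n i y s.
  by move=> yX; apply: pt_lev_phi => //; [exact: p_regular|by move=> j' jX'; exact: pE].
rewrite (@eliminate_pt _ (fun i => h eps i s) j jD den _ n i nm iD); last first.
  by move=> i'; exact: hE.
rewrite ptE; last exact: (D_X_lev k_enum (ltnW nm) jD).
by congr (_ + _); apply: eq_bigr => y yD; rewrite ptE// (Dbar_X_lev yD).
Qed.

Variable n : nat.
Hypothesis mE : m = n.+2.
Local Notation a := (k n.+1).
Local Notation b := (k n.+2).

Let nm : (n < m)%N. Proof. by rewrite mE ltnS leqnSn. Qed.
Let nm1 : (n.+1 < m)%N. Proof. by rewrite mE. Qed.
Let aD : a \in Dbar_lev k D n. Proof. exact: kk_Dbar. Qed.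
Let bD : b \in Dbar_lev k D n.+1. Proof. exact: kk_Dbar. Qed.
Let bD' : b \in Dbar_lev k D n. Proof. exact: Dbar_levW. Qed.

Let sum1 (f : X -> R) : \sum_(y in Dbar_lev k D n.+1) f y = f b.
Proof.
rewrite big_Dbar_lev// big1 ?addr0// => y; rewrite -mE Dbar_lev_full//.
Qed.

Lemma hit_b eps s : 0 < eps <= 1 -> 0 <= s ->
  h eps b s = pt_lev k (p eps) n.+1 b j * phit_eps eps n.+1 b j s.
Proof.
move=> he s0; rewrite (hit_level he s0 nm1 bD) sum1.
by rewrite [X in _ + X * _ * _](_ : _ = 0) ?mul0r ?addr0// /pt_lev /loop_free eqxx.
Qed.

Lemma hit_a eps s : 0 < eps <= 1 -> 0 <= s ->
  h eps a s = pt_lev k (p eps) n a j * phit_eps eps n a j s +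
    pt_lev k (p eps) n a b * phit_eps eps n a b s * h eps b s.
Proof.
move=> he s0; rewrite (hit_level he s0 nm aD) big_Dbar_lev// sum1.
by rewrite [X in _ + (X * _ * _ + _)](_ : _ = 0) ?mul0r ?add0r// /pt_lev /loop_free eqxx.
Qed.

Let jX : j \in X_lev k n. Proof. exact: (D_X_lev k_enum (ltnW nm) jD). Qed.
Let jX1 : j \in X_lev k n.+1. Proof. exact: (D_X_lev k_enum (ltnW nm1) jD). Qed.
Let bX : b \in X_lev k n. Proof. exact: Dbar_X_lev bD'. Qed.

Definition vcheck eps := if 0 < pt0 n a b then vt_lev k (p eps) (v eps) n.+1 b
  else vt_lev k (p eps) (v eps) n a.

Definition cst_c := (1 - p0_lev k p0 pt0 n.+1 b b) * fine (w0 n a b).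

Definition Psi_b s := phit0 n.+1 b j s * pt0 n.+1 b j.

Definition Psi_a s := if 0 < pt0 n a b then
    phit0 n a j (cst_c * s) * pt0 n a j + Psi_b s * phit0 n a b (cst_c * s) * pt0 n a b
  else phit0 n a j s * pt0 n a j.

Lemma vcheck_gt0 eps : 0 < eps <= 1 -> 0 < vcheck eps.
Proof. by move=> he; rewrite /vcheck; case: ifP => _; exact: vt_gt0. Qed.

(** The origin of [c]: the scale of [b] after its last loop removal is its previous scale divided by
    [1 - p_bb] at level [n.+1]. *)
Lemma vt_ratio : vt_lev k (p eps) (v eps) n a / vt_lev k (p eps) (v eps) n.+1 b
  @[eps --> 0^'+] --> cst_c.
Proof.
have : (1 - p_lev k (p eps) n.+1 b b) *
    (vt_lev k (p eps) (v eps) n a / vt_lev k (p eps) (v eps) n b) @[eps --> 0^'+] --> cst_c.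
  apply: cvgM; last exact: h_iii.
  apply: cvgB; first exact: cvg_cst.
  exact: (p_lev_cvg (ltnW nm1) bD (Dbar_X_lev bD)).
apply: cvg_trans; apply: near_eq_cvg; near=> eps.
have -> : vt_lev k (p eps) (v eps) n.+1 b =
  vt_lev k (p eps) (v eps) n b / (1 - p_lev k (p eps) n.+1 b b) by [].
by rewrite mulrCA [in RHS]invf_div.
Unshelve. all: by end_near. Qed.

Lemma cst_c_ge0 : 0 <= cst_c.
Proof.
apply: (cvgr_to_ge vt_ratio); near=> eps.
have he : 0 < eps <= 1 by near: eps; exact: near_unit.
by rewrite divr_ge0// ltW// vt_gt0.
Unshelve. all: by end_near. Qed.

Lemma vt_self l i : (l < m)%N -> i \in Dbar_lev k D l ->
  vt_lev k (p eps) (v eps) l i / vt_lev k (p eps) (v eps) l i @[eps --> 0^'+] --> (1 : R).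
Proof.
move=> lm iD; apply: (@cvg_trans _ ((1 : R) @[eps --> (0:R)^'+])); last exact: cvg_cst.
apply: near_eq_cvg; near=> eps; rewrite divff// gt_eqF// vt_gt0//.
by near: eps; exact: near_unit.
Unshelve. all: by end_near. Qed.

(** If [b] is reached with positive limiting probability, everything is measured on the final scale
    of [b]; otherwise on that of [a], where the visits to [b] disappear. *)
Lemma hit_cvg s : 0 <= s -> h eps a (s / vcheck eps) @[eps --> 0^'+] --> Psi_a s.
Proof.
move=> s0; rewrite /vcheck /Psi_a; case: ifPn => pab.
  have vb0 eps : 0 < eps <= 1 -> 0 < vt_lev k (p eps) (v eps) n.+1 b.
    by move=> he; exact: vt_gt0.
  have H : pt_lev k (p eps) n a j * phit_eps eps n a j (s / vt_lev k (p eps) (v eps) n.+1 b) +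
      pt_lev k (p eps) n a b * phit_eps eps n a b (s / vt_lev k (p eps) (v eps) n.+1 b) *
      (pt_lev k (p eps) n.+1 b j * phit_eps eps n.+1 b j (s / vt_lev k (p eps) (v eps) n.+1 b))
      @[eps --> 0^'+] --> phit0 n a j (cst_c * s) * pt0 n a j +
      phit0 n a b (cst_c * s) * pt0 n a b * (phit0 n.+1 b j (1 * s) * pt0 n.+1 b j).
    apply: cvgD; first exact: (term_cvg nm aD jX vb0 vt_ratio s0).
    apply: cvgM; first exact: (term_cvg nm aD bX vb0 vt_ratio s0).
    exact: (term_cvg nm1 bD jX1 vb0 (vt_self nm1 bD) s0).
  rewrite mul1r -/(Psi_b s) [_ * Psi_b s]mulrC [Psi_b s * (_ * _)]mulrA in H.
  apply: cvg_trans H; apply: near_eq_cvg; near=> eps.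
  have he : 0 < eps <= 1 by near: eps; exact: near_unit.
  have sv : 0 <= s / vt_lev k (p eps) (v eps) n.+1 b by rewrite divr_ge0// ltW// vb0.
  by rewrite hit_a// hit_b.
have va0 eps : 0 < eps <= 1 -> 0 < vt_lev k (p eps) (v eps) n a.
  by move=> he; exact: vt_gt0.
have pab0 : pt0 n a b = 0.
  apply/eqP; rewrite eq_le leNgt pab/=; apply: (cvgr_to_ge (h_i nm aD bX)); near=> eps.
  have he : 0 < eps <= 1 by near: eps; exact: near_unit.
  exact: (pt_ge0 (reg_n he (ltnW nm))).
have H1 := term_cvg nm aD jX va0 (vt_self nm aD) s0; rewrite mul1r in H1.
(* No limit of the last two factors is available on this scale. They lie in [[0, 1]], so the product
   is squeezed by the vanishing probability. *)
have H2 : pt_lev k (p eps) n a b * phit_eps eps n a b (s / vt_lev k (p eps) (v eps) n a) *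
    h eps b (s / vt_lev k (p eps) (v eps) n a) @[eps --> 0^'+] --> 0.
  apply: (@squeeze_cvgr _ _ _ _ (fun=> 0) (fun eps => pt_lev k (p eps) n a b)).
  - near=> eps.
    have he : 0 < eps <= 1 by near: eps; exact: near_unit.
    have sv : 0 <= s / vt_lev k (p eps) (v eps) n a by rewrite divr_ge0// ltW// va0.
    have /andP[hb0 hb1] := h01 b he sv.
    have q0 := pt_ge0 (reg_n he (ltnW nm)) aD bX.
    have [bY|bY] := boolP (b \in Yt_lev k (p 1) n a); last first.
      by rewrite (Yt_pt0 he (ltnW nm) aD bX bY) !mul0r lexx.
    have /andP[f0 f1] := phit_01 he nm aD bY sv.
    apply/andP; split; first by apply: mulr_ge0 hb0; exact: mulr_ge0.
    by rewrite -mulrA ler_piMr// mulr_ile1.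
  - exact: cvg_cst.
  - by have := h_i nm aD bX; rewrite pab0.
rewrite -[X in _ --> X]addr0; apply: cvg_trans (cvgD H1 H2).
apply: near_eq_cvg; near=> eps.
have he : 0 < eps <= 1 by near: eps; exact: near_unit.
have sv : 0 <= s / vt_lev k (p eps) (v eps) n a by rewrite divr_ge0// ltW// va0.
by rewrite hit_a.
Unshelve. all: by end_near. Qed.

Lemma Psi_a_cont : Psi_a s @[s --> 0^'+] --> Psi_a 0.
Proof.
have c0 := cst_c_ge0.
have Hb := term_cont nm1 bD jX1 ler01.
have Ha l : 0 <= l -> _ := term_cont nm aD jX.
have Hab := term_cont nm aD bX c0.
rewrite /Psi_a; case: ifPn => _; last first.
  by have := Ha _ ler01; under eq_fun do rewrite mul1r; rewrite mul1r.
apply: cvgD; first exact: Ha.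
rewrite -[X in _ --> X]mulrA; under eq_fun do rewrite -mulrA.
apply: cvgM => //.
by move: Hb; under eq_fun do rewrite mul1r; rewrite mul1r.
Qed.

End hitting.
End level_convergence.

End levels.

(** * Change of time scale *)

Section rescale.
Context {R : realType}.

Definition rescale (mu : set R -> \bar R) (c : R) : set R -> \bar R :=
  pushforward mu (fun x : R => x / c).

Section rescale_measure.
Variables (mu : subprobability R R) (c : R).

Let measurable_div : measurable_fun [set: R] (fun x : R => x / c).
Proof. by apply: measurable_funM. Qed.

Let rescale0 : rescale mu c set0 = 0%E.
Proof. by rewrite /rescale /pushforward preimage_set0 measure0. Qed.

Let rescale_ge0 B : (0 <= rescale mu c B)%E.
Proof. by rewrite /rescale /pushforward; exact: measure_ge0. Qed.

Let rescale_sigma_additive : semi_sigma_additive (rescale mu c).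
Proof. by apply: measure_semi_sigma_additive; exact: measurable_div. Qed.

HB.instance Definition _ := isMeasure.Build _ _ _ (rescale mu c)
  rescale0 rescale_ge0 rescale_sigma_additive.

Let rescale_le1 : (rescale mu c setT <= 1)%E.
Proof. by rewrite /rescale /pushforward preimage_setT; exact: sprobability_setT. Qed.

HB.instance Definition _ := Measure_isSubProbability.Build _ _ _ (rescale mu c) rescale_le1.

Hypothesis c_gt0 : 0 < c.

Lemma dfun_rescale t : dfun (rescale mu c) t = dfun mu (t * c).
Proof.
rewrite /dfun /rescale /pushforward; congr (fine (mu _)).
by apply/seteqP; split => x /=; rewrite !in_itv/= ler_pdivrMr.
Qed.

Lemma rescale_nneg : mu `]-oo, 0%R[%classic = 0%E -> rescale mu c `]-oo, 0%R[%classic = 0%E.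
Proof.
move=> <-; rewrite /rescale /pushforward; congr (mu _).
by apply/seteqP; split => x /=; rewrite !in_itv/= ltr_pdivrMr// mul0r.
Qed.

Lemma laplace_rescale s : laplace (rescale mu c) s = laplace mu (s / c).
Proof.
rewrite /laplace /rescale ge0_integral_pushforward//=; last first.
  by apply/measurable_EFinP; apply: measurable_funTS; exact: measurable_expRN.
congr fine; have -> : (fun x : R => x / c) @^-1` `[0%R, +oo[%classic = `[0%R, +oo[%classic.
  by apply/seteqP; split => x /=; rewrite !in_itv/= !andbT ler_pdivlMr// mul0r.
by apply: eq_integral => x _; rewrite /= mulrA mulrAC.
Qed.

End rescale_measure.

Lemma weak_cvg_eq (G G' : R -> R -> R) G0 :
  (forall eps t, 0 < eps <= 1 -> G eps t = G' eps t) -> weak_cvg G G0 -> weak_cvg G' G0.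
Proof.
move=> GG' [w1 w2]; split.
  move=> t ct; apply: cvg_trans (w1 t ct); apply: near_eq_cvg; near=> eps.
  by apply: GG'; near: eps; exact: near_unit.
apply: cvg_trans w2; apply: near_eq_cvg; near=> eps.
have -> // : G eps = G' eps; apply/funext => t; apply: GG'.
by near: eps; exact: near_unit.
Unshelve. all: by end_near. Qed.

End rescale.

Lemma exit_step (X : finType) (S : {set X}) (c : nat -> X) n :
  c 0%N \in S -> c n \notin S -> exists l, [/\ (l < n)%N, c l \in S & c l.+1 \notin S].
Proof.
elim: n => [->//|n IHn] c0 cn; have [cS|/(IHn c0)[l [ln cl cl1]]] := boolP (c n \in S).
  by exists n.
by exists l; split => //; exact: leq_trans ln _.
Qed.

Section hit_law.
Context {R : realType} {X : finType} (Z : markov_renewal R X) (D : {set X}) (i j : X).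
Hypothesis jD : j \in D.

(* The proof of [j \in D] is an argument because the total mass is at most 1 only then. *)
Definition hit_law of j \in D : set R -> \bar R := hit_measure Z D i j.

HB.instance Definition _ := Measure.copy (hit_law jD) (hit_measure Z D i j).

HB.instance Definition _ := Measure_isSubProbability.Build _ _ _ (hit_law jD)
  (hit_measure_le1 Z i jD).

Lemma laplace_hit_01 s : 0 <= s -> 0 <= laplace (hit_measure Z D i j) s <= 1.
Proof.
move=> s0; have e : hit_measure Z D i j = (hit_law jD : subprobability R R) by [].
rewrite e laplace_ge0/=; apply: le_trans (laplace_noninc _ (lexx 0) s0) _.
rewrite laplace0 -lee_fin fineK ?fin_num_measure//.
apply: le_trans (hit_measure_le1 Z i jD).
by apply: le_measure; rewrite ?inE.
Qed.

End hit_law.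

(** A chain from a state of [S] to [D] must leave [S] at some step, and that step is the exit. *)
Lemma mr_regular (R : realType) (X : finType) (Z : markov_renewal R X) (D : {set X})
    (k : nat -> X) :
  (forall i, i \in ~: D -> exists n (c : nat -> X),
    [/\ c 0%N = i, c n \in D &
        forall l, (l < n)%N -> c l \in ~: D -> 0 < mr_p Z (c l) (c l.+1)]) ->
  regular k D (mr_p Z) 0.
Proof.
have DE : Dbar_lev k D 0 = ~: D by apply/setP => x; rewrite !inE andbT.
move=> chain; split => /=.
- by move=> i j _ _; exact: mr_p_ge0.
- move=> i _; rewrite -(sum_mr_p Z i) [leRHS](bigID (mem (X_lev k 0)))/= lerDl.
  by apply: sumr_ge0 => j _; exact: mr_p_ge0.
- move=> S; rewrite DE => SD /set0Pn[i iS].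
  have [n [c [c0 cn pc]]] := chain i (fintype.subsetP SD i iS).
  have [||l [ln cl cl1]] := @exit_step X S c n; first by rewrite c0.
    by apply/negP => /(fintype.subsetP SD); rewrite inE cn.
  exists (c l), (c l.+1); split; rewrite ?inE//=.
  by apply: pc => //; exact: (fintype.subsetP SD).
Qed.

Theorem theorem5 (R : realType) (M : nat) (D : {set 'I_M})
  (D_neq0 : (0 < #|D|)%N)
  (mbar_ge2 : (2 <= #|~: D|)%N)
  (Z : R -> markov_renewal R 'I_M)
  (v : R -> 'I_M -> R)
  (v_ge1 : forall (eps : R) (i : 'I_M), 0 < eps <= 1 -> i \in ~: D -> 1 <= v eps i)
  (hA : forall (eps : R) (i : 'I_M), 0 < eps <= 1 -> mr_Fi (Z eps) i 0 < 1)
  (hB1 : forall i j : 'I_M, i \in ~: D ->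
    (forall eps : R, 0 < eps <= 1 -> 0 < mr_p (Z eps) i j) \/
    (forall eps : R, 0 < eps <= 1 -> mr_p (Z eps) i j = 0))
  (hB2 : forall i : 'I_M, i \in ~: D ->
    exists (n : nat) (c : nat -> 'I_M),
      [/\ (1 <= n)%N, c 0%N = i,
          (forall l, (1 <= l < n)%N -> c l \in ~: D), c n \in D &
          0 < \prod_(1 <= l < n.+1) mr_p (Z 1) (c l.-1) (c l)])
  (p0 : 'I_M -> 'I_M -> R)
  (hC : forall i j : 'I_M, i \in ~: D ->
    mr_p (Z eps) i j @[eps --> 0^'+] --> p0 i j)
  (F0 : 'I_M -> 'I_M -> probability R R)
  (v0 : 'I_M -> \bar R)
  (hD1 : forall i j : 'I_M, i \in ~: D -> 0 < mr_p (Z 1) i j ->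
    [/\ F0 i j `]-oo, 0[%classic = 0%E, dfun (F0 i j) 0 < 1 &
        weak_cvg (fun eps t => dfun (mr_F (Z eps) i j) (t * v eps i))
                 (dfun (F0 i j))])
  (hD2 : forall i : 'I_M, i \in ~: D ->
    (1%:E <= v0 i)%E /\ (v eps i)%:E @[eps --> 0^'+] --> v0 i)
  (hE : forall i j : 'I_M, i \in ~: D -> 0 < mr_p (Z 1) i j ->
    [/\ (forall eps : R, 0 < eps <= 1 -> (mean (mr_F (Z eps) i j) < +oo)%E),
        (mean (F0 i j) < +oo)%E &
        fine (mean (mr_F (Z eps) i j)) / v eps i @[eps --> 0^'+]
          --> fine (mean (F0 i j))])
  (k : nat -> 'I_M)
  (k_enum : perm_eq [seq k n | n <- iota 1 #|~: D|] (enum (~: D)))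
  (pt0 qh0 : nat -> 'I_M -> 'I_M -> R)
  (w0 : nat -> 'I_M -> 'I_M -> \bar R)
  (h_i : forall (n : nat) (i j : 'I_M), (n < #|~: D|)%N ->
    i \in Dbar_lev k D n -> j \in X_lev k n ->
    0 <= pt0 n i j <= 1 /\
    pt_lev k (mr_p (Z eps)) n i j @[eps --> 0^'+] --> pt0 n i j)
  (h_ii : forall (n : nat) (i j : 'I_M), (1 <= n < #|~: D|)%N ->
    i \in Dbar_lev k D n -> j \in Y_lev k (mr_p (Z 1)) n i ->
    0 <= qh0 n i j <= 1 /\
    qh_lev k (mr_p (Z eps)) n i j @[eps --> 0^'+] --> qh0 n i j)
  (h_iii : forall (n : nat) (i j : 'I_M), (1 <= n < #|~: D|)%N ->
    i \in Dbar_lev k D n.-1 -> j \in Dbar_lev k D n.-1 ->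
    (0 <= w0 n.-1 j i)%E /\
    (vt_lev k (mr_p (Z eps)) (v eps) n.-1 j /
     vt_lev k (mr_p (Z eps)) (v eps) n.-1 i)%:E @[eps --> 0^'+]
      --> w0 n.-1 j i)
  (h_iv : forall (n : nat) (i : 'I_M), (1 <= n < #|~: D|)%N ->
    i \in Dbar_lev k D n.-1 -> (w0 n.-1 (k n) i < +oo)%E) :
  let m := #|~: D| in
  let a := k m.-1 in
  let b := k m in
  let vcheck (eps : R) :=
    if 0 < pt0 m.-2 a b then vt_lev k (mr_p (Z eps)) (v eps) m.-1 b
    else vt_lev k (mr_p (Z eps)) (v eps) m.-2 a in
  let phit0 := phit0_lev k (mr_p (Z 1)) p0 pt0 qh0 w0 F0 in
  let c := (1 - p0_lev k p0 pt0 m.-1 b b) * fine (w0 m.-2 a b) in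
  let Psi_b (j : 'I_M) (s : R) := phit0 m.-1 b j s * pt0 m.-1 b j in
  let Psi_a (j : 'I_M) (s : R) :=
    if 0 < pt0 m.-2 a b then
      phit0 m.-2 a j (c * s) * pt0 m.-2 a j
      + Psi_b j s * phit0 m.-2 a b (c * s) * pt0 m.-2 a b
    else phit0 m.-2 a j s * pt0 m.-2 a j in
  forall j : 'I_M, j \in D ->
  exists G0 : subprobability R R,
    [/\ G0 `]-oo, 0[%classic = 0%E,
        weak_cvg (fun eps t => hit_G (Z eps) D a j (t * vcheck eps)) (dfun G0) &
        forall s : R, 0 <= s -> laplace G0 s = Psi_a j s].
Proof.
pose p eps := mr_p (Z eps).
have p_support eps i j : 0 < eps <= 1 -> i \in ~: D -> (0 < p eps i j) = (0 < p 1 i j).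
  move=> he iD; have h1 := @one_unit R; have [pp|p0'] := hB1 i j iD.
    by rewrite /p !pp.
  by rewrite /p !p0'.
have mr_reg eps : 0 < eps <= 1 -> regular k D (p eps) 0.
  move=> he; apply: mr_regular => i iD; have [n [c [_ c0 _ cn pc]]] := hB2 i iD.
  exists n, c; split => // l ln cl.
  rewrite -/(p eps _ _) p_support// lt0r mr_p_ge0 andbT.
  (* A zero step would annihilate the product; the step out of [c l] is the factor of index
     [l.+1]. *)
  apply: contraTneq pc => pl; rewrite -leNgt (big_rem l.+1)/=; last first.
    by rewrite mem_index_iota.
  by rewrite -/(p 1 _ _) pl mul0r.
have v_gt0 eps i : 0 < eps <= 1 -> i \in ~: D -> 0 < v eps i.
  by move=> he iD; apply: lt_le_trans (v_ge1 eps i he iD).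
pose phi eps i j := laplace (mr_F (Z eps) i j).
pose e eps i j := fine (mean (mr_F (Z eps) i j)).
have phi_cvg i j : i \in ~: D -> 0 < p 1 i j ->
  tr_cvg (fun eps s => phi eps i j (s / v eps i)) (fun eps => e eps i j / v eps i)
         (laplace (F0 i j)) (fine (mean (F0 i j))).
  move=> iD pij; have [F0n _ wc] := hD1 i j iD pij; have [mf mf0 mc] := hE i j iD pij.
  split => //.
  - move=> eps he; have vi := v_gt0 eps i he iD.
    have vV : 0 <= (v eps i)^-1 by rewrite invr_ge0 ltW.
    have := tr_scale (tr_laplace (mr_F_nneg (Z eps) i j) (mf eps he)) vV.
    by under eq_fun do rewrite mulrC; rewrite mulrC.
  - exact: tr_laplace.
  - move=> s s0.
    pose mu eps : subprobability R R := rescale (mr_F (Z eps) i j) (v eps i).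
    have mu_nneg eps : 0 < eps <= 1 -> mu eps `]-oo, 0%R[%classic = 0%E.
      by move=> he; apply: rescale_nneg; [exact: v_gt0|exact: mr_F_nneg].
    have muF : weak_cvg (fun eps => dfun (mu eps)) (dfun (F0 i j)).
      apply: weak_cvg_eq wc => eps t he; rewrite dfun_rescale//; exact: v_gt0.
    have := weak_cvg_laplace mu_nneg F0n s0 muF.
    apply: cvg_trans; apply: near_eq_cvg; near=> eps.
    have he : 0 < eps <= 1 by near: eps; exact: near_unit.
    by rewrite laplace_rescale//; exact: v_gt0.
(* Writing the cardinal as [n.+2] makes [a] and [b] reduce to [k n.+1] and [k n.+2]. *)
case E : #|~: D| mbar_ge2 => [//|[//|n]] _ /=.
move=> j jD.
have hi n' i j' : (n' < #|~: D|)%N -> i \in Dbar_lev k D n' -> j' \in X_lev k n' ->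
    pt_lev k (p eps) n' i j' @[eps --> 0^'+] --> pt0 n' i j'.
  by move=> nm iD jX; have [] := h_i n' i j' nm iD jX.
have hiii n' i : (n'.+1 < #|~: D|)%N -> i \in Dbar_lev k D n' ->
    vt_lev k (p eps) (v eps) n' (k n'.+1) / vt_lev k (p eps) (v eps) n' i @[eps --> 0^'+]
      --> fine (w0 n' (k n'.+1) i).
  move=> nm iD; have kD : k n'.+1 \in Dbar_lev k D n' by apply: kk_Dbar => //; exact: ltnW.
  have [w_ge0 wc] := h_iii n'.+1 i (k n'.+1) nm iD kD.
  have w_fin := h_iv n'.+1 i nm iD.
  (* Finiteness of the ratios from the excluded state, condition (iv), brings the extended-real
     convergence back to the reals. *)
  have wE : w0 n' (k n'.+1) i = (fine (w0 n' (k n'.+1) i))%:E.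
    by rewrite fineK// ge0_fin_numE.
  by move: wc; rewrite /= wE => /fine_cvg.
pose h eps i s := laplace (hit_measure (Z eps) D i j) s.
have hE' eps s i : 0 < eps <= 1 -> 0 <= s -> i \in ~: D ->
    h eps i s = p eps i j * phi eps i j s +
      \sum_(y in ~: D) p eps i y * phi eps i y s * h eps y s.
  by move=> he s0 iD; rewrite /h laplace_hit_eq.
have h01 eps s i : 0 < eps <= 1 -> 0 <= s -> 0 <= h eps i s <= 1.
  by move=> he s0; exact: laplace_hit_01.
have hcvg := hit_cvg k_enum mr_reg p_support v_gt0 hC phi_cvg hi h_ii hiii jD hE' h01 E.
have cont := Psi_a_cont k_enum mr_reg p_support v_gt0 hC phi_cvg hi h_ii hiii jD E.
have vc_gt0 := vcheck_gt0 k_enum pt0 mr_reg v_gt0 E.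
pose vc := vcheck k p v pt0 n.
pose mu eps : subprobability R R := rescale (hit_law (Z eps) (k n.+1) jD) (vc eps).
have mu_nneg eps : 0 < eps <= 1 -> mu eps `]-oo, 0%R[%classic = 0%E.
  move=> he; apply: rescale_nneg; first exact: vc_gt0.
  exact: hit_measure_nneg.
have mu_Psi s : 0 <= s -> laplace (mu eps) s @[eps --> 0^'+]
    --> Psi_a k p p0 pt0 qh0 w0 F0 j n s.
  move=> s0; apply: cvg_trans (hcvg s s0); apply: near_eq_cvg; near=> eps.
  have he : 0 < eps <= 1 by near: eps; exact: near_unit.
  by rewrite laplace_rescale//; exact: vc_gt0.
have [G0 [G0n wG lG]] := laplace_continuity mu_nneg mu_Psi cont.
exists G0; split => //; apply: weak_cvg_eq wG => eps t he.
by rewrite dfun_rescale; [rewrite -dfun_hit_measure|exact: vc_gt0].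
Unshelve. all: by end_near. Qed.
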